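(* Let $T:[0,1)\to[0,1)$ be a generalized interval exchange transformation (GIET). Then there exists a partition of $[0,1)$ into a finite disjoint union $$[0,1)=D\sqcup\Big(\bigsqcup_{i=1}^{k}R_i\Big),$$ where $D$ and $R_i$, $1\le i\le k$, are finite unions of right-open intervals, $D$ is a domain of transition, each $R_i$ is a domain of recurrence, and for each $i$ the g-GIET $T|_{R_i}$ obtained by restricting $T$ to $R_i$ is described by exactly one of the following two cases: (1) (periodic domain) there exists a periodic orbit (possibly at an endpoint) and all recurrent orbits are periodic of the same period; (2) (quasiminimal domain) there exists a unique quasiminimal and all recurrent orbits are non-trivially recurrent.
   Context: Fix a regularity $r\ge1$. A right-open interval is an interval $[a,b)$, $a<b$. g-GIETs. A ($C^r$-)generalized interval exchange transformation with gaps (g-GIET) on $d\ge 1$ intervals is a map $T:I^t\to I^b$ with $I^t,I^b\subset[0,1)$, together with decompositions $I^t=\bigsqcup_{\alpha\in\mathcal A}I^t_\alpha$ and $I^b=\bigsqcup_{\alpha\in\mathcal A}I^b_\alpha$, $|\mathcal A|=d$, into right-open intervals (the top and bottom intervals), such that for each $\alpha$ the restriction $T|_{I^t_\alpha}$ is an orientation-preserving $C^r$-diffeomorphism onto $I^b_\alpha$ which extends to a $C^r$-diffeomorphism between the closures of $I^t_\alpha$ and $I^b_\alpha$. The connected components of $[0,1)\setminus I^t$ (resp. $[0,1)\setminus I^b$) are the top (resp. bottom) gaps. A GIET is a g-GIET with $I^t=I^b=[0,1)$. Orbits. For $x\in I^t$, $T^n(x)$ ($n\ge1$) is defined as long as $x,T(x),\dots,T^{n-1}(x)\in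 I^t$, and $T^{-n}(x)$ as long as $x,T^{-1}(x),\dots,T^{-(n-1)}(x)\in I^b$. $\mathcal O^+(x)$ (resp. $\mathcal O^-(x)$) consists of $x$ and all its defined forward (resp. backward) iterates, and $\mathcal O(x)=\mathcal O^+(x)\cup\mathcal O^-(x)$. The orbit is regular if $\mathcal O(x)\subset I^t\cap I^b$; periodic if it is regular and finite (its period is its cardinality); transient if it is finite, its last defined forward iterate lies in a top gap and its last defined backward iterate lies in a bottom gap. Recurrence. For infinite $\mathcal O^{+}(x)$ (resp. $\mathcal O^-(x)$), $\omega(x)$ (resp. $\alpha(x)$) is the set of accumulation points of $\mathcal O^+(x)$ (resp. $\mathcal O^-(x)$) in $I^t$. Periodic orbits are called trivially recurrent. An infinite regular orbit $\mathcal O(x)$ is non-trivially recurrent if $x\in\omega(x)\cap\alpha(x)$. Recurrent means trivially or non-trivially recurrent. A quasiminimal of $T$ is the topological closure in $I^t$ of a non-trivially recurrent orbit. Periodic orbits at endpoints. Let $\overline T$ be the left-open g-GIET obtained from $T$ by restricting $T$ to the interiors of the intervals $I^t_\alpha$ and extending by continuity to their right endpoints. A periodic orbit of $T$ containing a left endpoint of an interval is a periodic orbit at a left endpoint; a periodic orbit of $\overline T$ containing a right endpoint of an interval is a periodic orbit at a right endpoint of $T$. ''Periodic orbit (possibly at an endpoint)'' means a periodic orbit of $T$ or a periodic orbit at a left or right endpoint of $T$. Restrictions and domains. If $J\subset I^t$ is a finite union of right-open intervals, $T|_J:J\to T(J)$ is the g-GIET whose top intervals are the connected components of the sets $J\cap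 I^t_\alpha$ and whose bottom intervals are their images. $J$ is a domain of transition if every $x\in J$ has transient orbit under $T|_J$; $J$ is a domain of recurrence if no $x\in J$ has transient orbit under $T|_J$. *)

(* Defs.v *)
From HB Require Import structures.
From mathcomp Require Import all_boot all_order all_algebra.
From mathcomp Require Import all_classical all_reals all_analysis.

Set Implicit Arguments.
Unset Strict Implicit.
Unset Printing Implicit Defensive.

Import Order.TTheory GRing.Theory Num.Theory.
Import numFieldNormedType.Exports.

Local Open Scope classical_set_scope.
Local Open Scope ring_scope.

Section Regularity.
Variable R : realType.
Implicit Types (D E : set R) (f g : R -> R) (r : R).

(* The derivative is taken relatively to D: at an endpoint of an interval D it
   is one-sided. *)
Definition has_derivative_on D f g :=
  forall x, D x -> (f y - f x) / (y - x) @[y --> within D x^'] --> g x.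

(* f is of class C^r on D, r >= 0 a real number: with n the integer part of r,
   f has n successive derivatives F 1, ..., F n on D, and F n is continuous and
   Hoelder of exponent r - n.  For integer r one has t `^ 0 = 1 for all t,
   0 included, so that the last clause only says that F n has bounded
   oscillation, which is automatic on a compact interval; C^r is then the
   usual class. *)
Definition class_C r D f :=
  let n := Num.truncn r in
  exists F : nat -> R -> R,
    [/\ forall x, D x -> F 0%N x = f x,
        forall k, (k < n)%N -> has_derivative_on D (F k) (F k.+1),
        {within D, continuous (F n)} &
        exists M : R, forall x y, D x -> D y ->
          `|F n x - F n y| <= M * `|x - y| `^ (r - n%:R)].

Definition C_diffeo r D E f :=
  [/\ set_bij D E f,
      class_C r D f &
      exists2 g, (forall x, D x -> g (f x) = x) & class_C r E g].

Definition finite_right_open_union D :=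
  exists s : seq (R * R),
    (forall p, p \in s -> p.1 < p.2) /\
    D = \bigcup_(p in [set` s]) `[p.1, p.2[%classic.

End Regularity.

(* A partial map of R, together with its domain and its range; the values of
   pfun outside pdom are irrelevant.  All the maps below are bijections from
   pdom onto pcod. *)
Record partial_map (R : realType) := PartialMap {
  pdom : set R;
  pcod : set R;
  pfun :> R -> R }.

Section Orbits.
Variables (R : realType) (F : partial_map R).
Implicit Types x y : R.

(* iterate n x y: the n-th iterate of x is defined and is equal to y. As F is
   injective, it also says that the n-th backward iterate of y is defined and is
   equal to x. *)
Definition iterate (n : nat) x y :=
  (forall m, (m < n)%N -> pdom F (iter m F x)) /\ iter n F x = y.

Definition fwd_orbit x : set R := [set y | exists n, iterate n x y].
Definition bwd_orbit x : set R := [set y | exists n, iterate n y x].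
Definition full_orbit x : set R := fwd_orbit x `|` bwd_orbit x.

Definition regular_orbit x :=
  pdom F x /\ full_orbit x `<=` pdom F `&` pcod F.

Definition periodic x := regular_orbit x /\ finite_set (full_orbit x).

Definition periodic_of_period (p : nat) x :=
  periodic x /\ (full_orbit x #= `I_p)%card.

(* An iterate lying in a gap is necessarily the last one defined. *)
Definition transient x :=
  [/\ pdom F x,
      finite_set (full_orbit x),
      exists2 y, fwd_orbit x y & (`[0, 1[%classic `\` pdom F) y &
      exists2 y, bwd_orbit x y & (`[0, 1[%classic `\` pcod F) y].

Definition omega_set x : set R := limit_point (fwd_orbit x) `&` pdom F.
Definition alpha_set x : set R := limit_point (bwd_orbit x) `&` pdom F.

Definition nontrivially_recurrent x :=
  [/\ regular_orbit x,
      infinite_set (full_orbit x) &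
      (omega_set x `&` alpha_set x) x].

Definition recurrent x := periodic x \/ nontrivially_recurrent x.

Definition quasiminimal (Q : set R) :=
  exists2 x, nontrivially_recurrent x &
    Q = closure (full_orbit x) `&` pdom F.

End Orbits.

(* The alphabet A is allowed to be empty, so that the restriction of a g-GIET to
   the empty set is a g-GIET; if the domain is not empty then neither is A. *)
Record gGIET (R : realType) (r : R) (A : finType) := GGIET {
  tl : A -> R;
  tr : A -> R;
  bl : A -> R;
  br : A -> R;
  gfun : R -> R;
  top a : set R := `[tl a, tr a[%classic;
  bot a : set R := `[bl a, br a[%classic;
  tl_lt_tr : forall a, tl a < tr a;
  bl_lt_br : forall a, bl a < br a;
  top_sub01 : forall a, top a `<=` `[0, 1[%classic;
  bot_sub01 : forall a, bot a `<=` `[0, 1[%classic;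
  top_disjoint : trivIset setT top;
  bot_disjoint : trivIset setT bot;
  gfun_diffeo : forall a, C_diffeo r (top a) (bot a) gfun;
  gfun_incr : forall a x y, top a x -> top a y -> x < y -> gfun x < gfun y;
  gfun_extends : forall a, exists g : R -> R,
    (forall x, top a x -> g x = gfun x) /\
    C_diffeo r (closure (top a)) (closure (bot a)) g }.

Section GIET.
Variables (R : realType) (r : R).

Definition gmap (A : finType) (T : gGIET r A) : partial_map R :=
  PartialMap (\bigcup_a top T a) (\bigcup_a bot T a) (gfun T).

Coercion gmap : gGIET >-> partial_map.

Definition is_GIET (A : finType) (T : gGIET r A) :=
  pdom T = `[0, 1[%classic /\ pcod T = `[0, 1[%classic.

Definition left_open_map (A : finType) (T : gGIET r A) : partial_map R :=
  PartialMap (\bigcup_a `]tl T a, tr T a]%classic)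
    (\bigcup_a `]bl T a, br T a]%classic)
    (fun x => if `[< exists a, tl T a < x < tr T a >] then T x
              else lim (T y @[y --> x^'-])).

Definition periodic_at_left_endpoint (A : finType) (T : gGIET r A) x :=
  periodic T x /\ exists a, full_orbit T x (tl T a).

Definition periodic_at_right_endpoint (A : finType) (T : gGIET r A) x :=
  periodic (left_open_map T) x /\
  exists a, full_orbit (left_open_map T) x (tr T a).

Definition periodic_possibly_at_endpoint (A : finType) (T : gGIET r A) x :=
  [\/ periodic T x, periodic_at_left_endpoint T x
    | periodic_at_right_endpoint T x].

(* S is the g-GIET T|_J; it is unique up to the names of its intervals. *)
Definition is_restriction (A B : finType) (T : gGIET r A) (J : set R)
    (S : gGIET r B) :=
  [/\ J `<=` pdom T /\ finite_right_open_union J,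
      range (top S) = [set C | exists a, exists2 x, (J `&` top T a) x &
                         C = connected_component (J `&` top T a) x],
      forall b, bot S b = T @` top S b &
      forall x, J x -> S x = T x].

Definition domain_of_transition (A : finType) (T : gGIET r A) (J : set R) :=
  exists (B : finType) (S : gGIET r B),
    is_restriction T J S /\ forall x, J x -> transient S x.

Definition domain_of_recurrence (A : finType) (T : gGIET r A) (J : set R) :=
  exists (B : finType) (S : gGIET r B),
    is_restriction T J S /\ forall x, J x -> ~ transient S x.

Definition periodic_type (A : finType) (T : gGIET r A) :=
  (exists x, periodic_possibly_at_endpoint T x) /\
  exists p, forall x, recurrent T x -> periodic_of_period T p x.

Definition quasiminimal_type (A : finType) (T : gGIET r A) :=
  (exists! Q, quasiminimal T Q) /\
  forall x, recurrent T x -> nontrivially_recurrent T x.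

End GIET.

(* Main.v *)
(** Split every point x of [0, 1] into a right germ and a left germ.  Ordered
    lexicographically the germs form a compact space K whose clopen sets are the
    finite unions of right-open intervals, and a GIET becomes a homeomorphism of
    K that is an order isomorphism between finitely many clopen intervals.

    Every limit set contains a minimal set.  A periodic germ of period p is the
    end of arbitrarily small clopen intervals J on which T^p is increasing; T^p
    fixes the end, so T^p J and J are nested, and the union of J, ..., T^(p-1) J
    is invariant in one direction of time.  If M is an infinite minimal set, the
    convex components of its complement are clopen; T maps a component to a
    component unless it meets an end of one of the intervals of T, which happens
    for finitely many of them.  Removing from K those components, and those whose
    orbits meet them both in the future and in the past (finitely many again),
    leaves a clopen neighbourhood of M that contains the future or the past of each
    of its points, and in which half-orbits accumulate only on M.

    By compactness finitely many of these neighbourhoods are met by all future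
    and all past orbits.  Those attached to the same period or to the same M are
    merged, and the others are made disjoint by taking differences; this keeps
    their properties since limit sets attached to different labels are disjoint.
    What is left of K is the domain of transition. *)
Require Import Defs.
From HB Require Import structures.
From mathcomp Require Import all_boot all_order all_algebra.
From mathcomp Require Import all_classical all_reals all_analysis.
From mathcomp Require Import lra.

Set Implicit Arguments.
Unset Strict Implicit.
Unset Printing Implicit Defensive.

Import Order.TTheory GRing.Theory Num.Theory.
Import numFieldNormedType.Exports.

Local Open Scope classical_set_scope.
Local Open Scope ring_scope.

(** * The order topology of the split interval *)

(** The delicate step is the return from germs to the line. A point of [0, 1) is followed through
    its right germ, but its orbit may come back to it from the left, so recurrence on the line only
    says that one of the two germs at the point is a limit in K. In a periodic domain the limit
    would be a periodic left germ lying in both limit sets of a right germ; small neighbourhoods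
    that are invariant in one direction of time exclude this. In a quasiminimal domain such orbits
    may occur; the quasiminimal is still unique, because inside the neighbourhood of M the two germs
    travel together, so that the orbit projects into the projection of M. Left germs are also the
    reason for periodic orbits at right endpoints: the periodic germs of a domain may all be left
    ones. A domain is only asked to hold the future or the past of each of its points, which is
    exactly the negation of transience. A transient point must exit on both sides, so the
    neighbourhoods have to catch all futures and all pasts. *)

Section SplitOrder.
Local Open Scope order_scope.
Local Open Scope classical_set_scope.

(* plus_of x says that x is a right germ; adj_of x is the other germ at the same
   point (junk at the two ends, which have no other germ). *)
Record split_order d (K : orderType d) := SplitOrder {
  plus_of : K -> bool;
  adj_of : K -> K;
  kmin_of : K;
  kmax_of : K;
  kmin_le : forall x, kmin_of <= x;
  le_kmax : forall x, x <= kmax_of;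
  plus_kmin : plus_of kmin_of;
  plus_kmax : ~~ plus_of kmax_of;
  adj_plus : forall x, plus_of x -> x != kmin_of ->
    [/\ adj_of x < x, ~~ plus_of (adj_of x), adj_of (adj_of x) = x &
        forall z, z < x -> z <= adj_of x];
  adj_minus : forall x, ~~ plus_of x -> x != kmax_of ->
    [/\ x < adj_of x, plus_of (adj_of x), adj_of (adj_of x) = x &
        forall z, x < z -> adj_of x <= z];
  plus_minus_dense : forall x y, plus_of x -> ~~ plus_of y -> x < y ->
    exists b, [/\ ~~ plus_of b, x < b & b < y];
  lub_exists : forall S : set K, exists s, (forall x, S x -> x <= s) /\
    forall u, (forall x, S x -> x <= u) -> s <= u }.

Variables (d : Order.disp_t) (K : orderType d) (O : split_order K).
Implicit Types (x y z a b : K) (P Q U M : set K).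
Local Notation plus := (plus_of O).
Local Notation adj := (adj_of O).
Local Notation kmin := (kmin_of O).
Local Notation kmax := (kmax_of O).

(* The clopen intervals [a, b], with a a right germ and b a left germ, are a
   basis of the order topology of K. *)
Definition nb x P := exists a b, [/\ plus a, ~~ plus b, a <= x <= b &
  forall z, a <= z <= b -> P z].

Definition kopen U := forall x, U x -> nb x U.
Definition kclopen U := kopen U /\ kopen (~` U).

Lemma nb_self x P : nb x P -> P x.
Proof. by move=> [a [b [_ _ xab]]]; apply. Qed.

Lemma nbW x P Q : (forall z, P z -> Q z) -> nb x P -> nb x Q.
Proof.
by move=> PQ [a [b [pa pb xab Pab]]]; exists a, b; split=> // z /Pab /PQ.
Qed.

Lemma plus_maxb a b : plus a -> plus b -> plus (Order.max a b).
Proof. by rewrite /Order.max; case: ifP. Qed.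

Lemma minus_minb a b : ~~ plus a -> ~~ plus b -> ~~ plus (Order.min a b).
Proof. by rewrite /Order.min; case: ifP. Qed.

Lemma nbI x P Q : nb x P -> nb x Q -> nb x (fun z => P z /\ Q z).
Proof.
move=> [a [b [pa pb /andP[ax xb] Pab]]] [a' [b' [pa' pb' /andP[ax' xb'] Pab']]].
exists (Order.max a a'), (Order.min b b'); split.
- exact: plus_maxb.
- exact: minus_minb.
- by rewrite ge_max le_min ax ax' xb xb'.
- move=> z; rewrite ge_max le_min => /andP[/andP[az az'] /andP[zb zb']].
  by split; [apply: Pab; rewrite az | apply: Pab'; rewrite az'].
Qed.

Lemma nbT x P : (forall z, P z) -> nb x P.
Proof.
by move=> HP; exists kmin, kmax; rewrite plus_kmin plus_kmax kmin_le le_kmax.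
Qed.

Lemma nb_ltn x n (P : nat -> set K) : (forall j, (j < n)%N -> nb x (P j)) ->
  nb x (fun z => forall j, (j < n)%N -> P j z).
Proof.
elim: n => [|n IH] Pn; first by apply: nbT => z j.
have /nbI/(_ (Pn n (ltnSn n))) := IH (fun j jn => Pn j (ltnW jn)).
by apply: nbW => z [Pz Pnz] j; rewrite ltnS leq_eqVlt => /predU1P[->//|]; apply: Pz.
Qed.

Lemma nb_seq (I : eqType) (s : seq I) x (P : I -> set K) :
  (forall i, i \in s -> nb x (P i)) -> nb x (fun z => forall i, i \in s -> P i z).
Proof.
elim: s => [|i s IH] Ps; first exact: nbT.
have := nbI (Ps i (mem_head _ _)) (IH (fun j js => Ps j (@mem_behead _ (i :: s) j js))).
by apply: nbW => z [Pi Pz] j; rewrite inE => /predU1P[->|]; last apply: Pz.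
Qed.

Lemma nb_nb x P : nb x P -> nb x (nb^~ P).
Proof. by move=> [a [b [pa pb xab Pab]]]; exists a, b; split=> // z zab; exists a, b. Qed.

(** A left germ [b] is a place where K can be cut: nothing lies between [b] and [adj b], so the
    points up to [b] and the points from [adj b] on are two clopen sets. All separation properties
    come from such cuts. *)
Lemma lt_cut x y : x < y ->
  exists2 b, ~~ plus b & x <= b < y.
Proof.
move=> xy; have [px|px] := boolP (plus x); last by exists x; rewrite ?lexx.
have [py|py] := boolP (plus y).
  have y0 : y != kmin by apply: contraTneq xy => ->; rewrite -leNgt kmin_le.
  have [yy my _ /(_ _ xy) xy'] := adj_plus py y0.
  by exists (adj y); rewrite ?xy'.
by have [b [pb xb yb]] := plus_minus_dense px py xy; exists b; rewrite // ltW.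
Qed.

Lemma nb_lt x y : x < y -> nb x (fun z => z < y).
Proof.
move=> /lt_cut[b pb /andP[xb yb]]; exists kmin, b; split=> //.
- exact: plus_kmin.
- by rewrite kmin_le.
- by move=> z /andP[_ zb]; apply: le_lt_trans yb.
Qed.

Lemma nb_gt x y : x < y -> nb y (fun z => x < z).
Proof.
move=> /lt_cut[b pb /andP[xb yb]].
have bM : b != kmax by apply: contraTneq yb => ->; rewrite -leNgt le_kmax.
have [bb pab _ ab] := adj_minus pb bM.
exists (adj b), kmax; split=> //.
- exact: plus_kmax.
- by rewrite le_kmax ab.
- by move=> z /andP[bz _]; apply: le_lt_trans xb (lt_le_trans bb bz).
Qed.

Lemma nb_sep x y : x != y -> exists P Q,
  [/\ nb x P, nb y Q & forall z, P z -> ~ Q z].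
Proof.
rewrite neq_lt => /orP[] xy; have [b pb /andP[xb yb]] := lt_cut xy.
  have bM : b != kmax by apply: contraTneq yb => ->; rewrite -leNgt le_kmax.
  have [bb _ _ _] := adj_minus pb bM.
  exists (fun z => z < adj b), (fun z => b < z); split.
  - exact/nb_lt/(le_lt_trans xb).
  - exact: nb_gt.
  - have [_ _ _ ab] := adj_minus pb bM.
    by move=> z zb /ab; rewrite leNgt zb.
have bM : b != kmax by apply: contraTneq yb => ->; rewrite -leNgt le_kmax.
have [bb _ _ _] := adj_minus pb bM.
exists (fun z => b < z), (fun z => z < adj b); split.
- exact: nb_gt.
- exact/nb_lt/(le_lt_trans xb).
- have [_ _ _ ab] := adj_minus pb bM.
  by move=> z /ab abz; rewrite ltNge abz.
Qed.

(** The Heine-Borel argument: [S] collects the ends of the initial segments that are finitely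
    covered, and its least upper bound has to be [kmax]. *)
Lemma compactK (U : K -> set K) : (forall x, nb x (U x)) ->
  exists s : seq K, forall x, exists2 y, y \in s & U y x.
Proof.
move=> nbU.
pose S x := exists s : seq K, forall z, z <= x -> exists2 y, y \in s & U y z.
(* An interval starting at [a] can be glued to a covered segment as soon as the latter reaches
   [adj a], the immediate predecessor of [a]. *)
have step x a b : (a = kmin \/ exists2 w, S w & adj a <= w) ->
    (forall z, a <= z <= b -> U x z) -> plus a -> S b.
  move=> wS Uab pa; case: wS => [a0|[w [s sP] aw]].
    exists [:: x] => z zb; exists x; rewrite ?mem_head //.
    by apply: Uab; rewrite zb a0 kmin_le.
  exists (x :: s) => z zb; have [az|za] := leP a z.
    by exists x; rewrite ?mem_head //; apply: Uab; rewrite az.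
  have [a0|a0] := eqVneq a kmin; first by move: za; rewrite a0 ltNge kmin_le.
  have [_ _ _ /(_ _ za) zaa] := adj_plus pa a0.
  by have [y ys Uyz] := sP z (le_trans zaa aw); exists y; rewrite // inE ys orbT.
have [x [ubx lubx]] := lub_exists O S.
have [a [b [pa pb /andP[ax xb] Uab]]] := nbU x.
have Sb : S b.
  apply: (step x a) => //; have [->|a0] := eqVneq a kmin; [by left|right].
  have [aa _ _ _] := adj_plus pa a0.
  apply: contrapT => /forall2NP nS.
  have /lubx : forall w, S w -> w <= adj a.
    by move=> w Sw; have [//|/negP] := nS w; rewrite -ltNge => /ltW.
  by rewrite leNgt (lt_le_trans aa ax).
have bx : b = x by apply/le_anti; rewrite xb ubx.
have [bM|bM] := eqVneq b kmax.
  by case: Sb => s sP; exists s => z; apply: sP; rewrite bM le_kmax.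
have [bb pab adjb _] := adj_minus pb bM.
have [a' [c [pa' pc /andP[ax' xc] Uac]]] := nbU (adj b).
(* The covered point [b] is the least upper bound; its immediate successor [adj b] can be covered
   too, a contradiction. *)
have /ubx : S c.
  apply: (step (adj b) (adj b)) => //; first by right; exists b; rewrite ?adjb.
  by move=> z /andP[bz zc]; apply: Uac; rewrite zc (le_trans ax').
by rewrite -bx leNgt (lt_le_trans bb xc).
Qed.

Lemma kopenI U Q : kopen U -> kopen Q -> kopen (U `&` Q).
Proof. by move=> oU oQ x [Ux Qx]; apply: nbI; [apply: oU | apply: oQ]. Qed.

Lemma kopenU U Q : kopen U -> kopen Q -> kopen (U `|` Q).
Proof.
by move=> oU oQ x [/oU|/oQ]; apply: nbW => z Hz; [left|right].
Qed.

Lemma kclopenC U : kclopen U -> kclopen (~` U).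
Proof. by move=> [oU cU]; split; rewrite ?setCK. Qed.

Lemma kclopenI U Q : kclopen U -> kclopen Q -> kclopen (U `&` Q).
Proof.
by move=> [oU cU] [oQ cQ]; split; [exact: kopenI | rewrite setCI; exact: kopenU].
Qed.

Lemma kclopenU U Q : kclopen U -> kclopen Q -> kclopen (U `|` Q).
Proof.
by move=> [oU cU] [oQ cQ]; split; [exact: kopenU | rewrite setCU; exact: kopenI].
Qed.

Lemma kclopenD U Q : kclopen U -> kclopen Q -> kclopen (U `\` Q).
Proof. by move=> cU cQ; rewrite setDE; apply/kclopenI/kclopenC. Qed.

Lemma kclopen_itv a b : plus a -> ~~ plus b -> kclopen [set z | a <= z <= b].
Proof.
move=> pa pb; split=> [x xab|x /negP]; first by exists a, b.
rewrite negb_and -!ltNge => /orP[xa|bx].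
  by apply: nbW (nb_lt xa) => z za /= /andP[]; rewrite leNgt za.
by apply: nbW (nb_gt bx) => z za /= /andP[_]; rewrite leNgt za.
Qed.

End SplitOrder.

(** * Limit sets and minimal sets *)

Section Kiet.
Local Open Scope order_scope.
Local Open Scope classical_set_scope.

(** The fields come in pairs, one for [kmap] and one for [kinv], so that [kswap] reverses time by
    merely permuting them and each statement about the future can be reused for the past. *)
Record kiet d (K : orderType d) (O : split_order K) := Kiet {
  kind : finType;
  top0 : kind -> K;
  top1 : kind -> K;
  bot0 : kind -> K;
  bot1 : kind -> K;
  kmap : K -> K;
  kinv : K -> K;
  top_cover : forall x, exists a, top0 a <= x <= top1 a;
  bot_cover : forall x, exists a, bot0 a <= x <= bot1 a;
  kmap_top : forall a x, top0 a <= x <= top1 a -> bot0 a <= kmap x <= bot1 a;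
  kinv_bot : forall a x, bot0 a <= x <= bot1 a -> top0 a <= kinv x <= top1 a;
  kmapK : cancel kmap kinv;
  kinvK : cancel kinv kmap;
  kmap_mono : forall a x y, top0 a <= x -> x <= y -> y <= top1 a ->
    kmap x <= kmap y;
  kinv_mono : forall a x y, bot0 a <= x -> x <= y -> y <= bot1 a ->
    kinv x <= kinv y;
  kmap_plus : forall x, plus_of O (kmap x) = plus_of O x;
  kinv_plus : forall x, plus_of O (kinv x) = plus_of O x;
  top0_plus : forall a, plus_of O (top0 a);
  top1_plus : forall a, ~~ plus_of O (top1 a);
  bot0_plus : forall a, plus_of O (bot0 a);
  bot1_plus : forall a, ~~ plus_of O (bot1 a) }.

Global Arguments top0 {d K O} k _.
Global Arguments top1 {d K O} k _.
Global Arguments bot0 {d K O} k _.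
Global Arguments bot1 {d K O} k _.

Variables (d : Order.disp_t) (K : orderType d) (O : split_order K).

Definition kswap (X : kiet O) : kiet O :=
  Kiet (bot_cover X) (top_cover X) (@kinv_bot _ _ _ X) (@kmap_top _ _ _ X)
    (@kinvK _ _ _ X) (@kmapK _ _ _ X) (@kinv_mono _ _ _ X) (@kmap_mono _ _ _ X)
    (@kinv_plus _ _ _ X) (@kmap_plus _ _ _ X) (@bot0_plus _ _ _ X)
    (@bot1_plus _ _ _ X) (@top0_plus _ _ _ X) (@top1_plus _ _ _ X).

Implicit Types (X : kiet O) (x y z a b : K) (P Q U M : set K).
Local Notation plus := (plus_of O).
Local Notation adj := (adj_of O).
Local Notation kmin := (kmin_of O).
Local Notation kmax := (kmax_of O).
Local Notation nb := (nb O).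
Local Notation kopen := (kopen O).
Local Notation kclopen := (kclopen O).

Lemma kmap_inj X : injective (kmap X).
Proof. exact: can_inj (kmapK X). Qed.

Lemma kmap_iterK X n : cancel (iter n (kmap X)) (iter n (kinv X)).
Proof. by elim: n => // n IH x; rewrite [LHS]iterSr iterS kmapK IH. Qed.

Lemma kinv_iterK X n : cancel (iter n (kinv X)) (iter n (kmap X)).
Proof. exact: (kmap_iterK (kswap X)). Qed.

Lemma iter_kinv_kmap X k n x : (k <= n)%N ->
  iter k (kinv X) (iter n (kmap X) x) = iter (n - k) (kmap X) x.
Proof. by move=> kn; rewrite -{1}(subnKC kn) iterD kmap_iterK. Qed.

Lemma kmap_iter_plus X n x : plus (iter n (kmap X) x) = plus x.
Proof. by elim: n => //= n <-; rewrite kmap_plus. Qed.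

(** The neighbourhood is cut down to the bottom interval of the image, on which [kinv] is
    increasing; since [kinv] keeps the sides of germs, the pulled back ends bound a clopen interval
    again. *)
Lemma nb_kmap X x P : nb (kmap X x) P -> nb x (fun z => P (kmap X z)).
Proof.
move=> [c [e [pc pe /andP[cx xe] Pce]]].
have [a ax] := top_cover X x; have /andP[bx xb] := kmap_top ax.
pose c' := Order.max c (bot0 X a); pose e' := Order.min e (bot1 X a).
have c'e' : c' <= e'.
  by rewrite ge_max !le_min (le_trans cx xe)
    (le_trans cx xb) (le_trans bx xe) (le_trans bx xb).
have c'b : bot0 X a <= c' <= bot1 X a.
  by rewrite le_max lexx orbT (le_trans c'e') // ge_min lexx orbT.
have e'b : bot0 X a <= e' <= bot1 X a.
  by rewrite (le_trans _ c'e') ?le_max ?lexx ?orbT // ge_min lexx orbT.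
have xc'e' : c' <= kmap X x <= e' by rewrite ge_max le_min cx bx xe xb.
have /andP[t0c t1c] := kinv_bot c'b; have /andP[t0e t1e] := kinv_bot e'b.
exists (kinv X c'), (kinv X e'); split.
- by rewrite kinv_plus; apply: plus_maxb; rewrite // bot0_plus.
- by rewrite kinv_plus; apply: minus_minb; rewrite // bot1_plus.
- move: xc'e' => /andP[cx' xe']; rewrite -[x](kmapK X).
  by apply/andP; split; apply: (@kinv_mono _ _ _ X a) => //;
    [case/andP: c'b|case/andP: e'b].
- move=> z /andP[cz ze]; apply: Pce.
  have : c' <= kmap X z <= e'.
    rewrite -[c'](kinvK X) -[e'](kinvK X).
    by rewrite !(@kmap_mono _ _ _ X a) // ?(le_trans t0c) // (le_trans ze).
  by rewrite ge_max le_min => /andP[/andP[-> _] /andP[-> _]].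
Qed.

Lemma nb_iter X n x P :
  nb (iter n (kmap X) x) P -> nb x (fun z => P (iter n (kmap X) z)).
Proof.
elim: n x P => // n IH x P; rewrite iterSr => /IH/nb_kmap.
by apply: nbW => z; rewrite iterSr.
Qed.

Lemma kopen_iter X n U : kopen U -> kopen (iter n (kmap X) @^-1` U).
Proof. by move=> oU x /oU/nb_iter. Qed.

Lemma kclopen_iter X n U : kclopen U -> kclopen (iter n (kmap X) @^-1` U).
Proof. by move=> [oU cU]; split; [exact: kopen_iter | exact: (kopen_iter cU)]. Qed.

(** Visits are counted by their times, not as points: a periodic orbit is its own limit set, whereas
    a finite orbit has no [limit_point]. *)
Definition om X x := [set z | forall P, nb z P -> forall N,
  exists2 n, (N <= n)%N & P (iter n (kmap X) x)].

Definition invariant X M := forall x, M (kmap X x) <-> M x.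

Lemma invariant_swap X M : invariant X M -> invariant (kswap X) M.
Proof. by move=> iM x /=; rewrite -iM kinvK. Qed.

Lemma invariant_iter X M n x : invariant X M -> M (iter n (kmap X) x) <-> M x.
Proof. by move=> iM; elim: n => //= n IH; rewrite iM. Qed.

Lemma invariantC X M : invariant X M -> invariant X (~` M).
Proof. by move=> iM x; split=> nM /iM. Qed.

(** Otherwise every germ has a neighbourhood that the orbit leaves for good; finitely many of these
    cover K, and the orbit has nowhere to be after the largest of their times. *)
Lemma om_neq0 X x : om X x !=set0.
Proof.
apply: contrapT => om0.
have /choice[PN PNP] : forall z, exists PN : set K * nat,
    nb z PN.1 /\ forall n, (PN.2 <= n)%N -> ~ PN.1 (iter n (kmap X) x).
  move=> z; apply: contrapT => nz; apply: om0; exists z => P zP N.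
  apply: contrapT => /forall2NP nP; apply: nz; exists (P, N); split=> //= n Nn Pn.
  by have [/negP|] := nP n; rewrite ?Nn.
have [s sP] := compactK (fun z => (PNP z).1).
pose N := (\max_(z <- s) (PN z).2)%N.
have [y ys] := sP (iter N (kmap X) x).
by have [_ /(_ N)] := PNP y; apply; apply: leq_bigmax_seq.
Qed.

Lemma om_closed X x : kopen (~` om X x).
Proof.
move=> z nz; apply: contrapT => nnb; apply: nz => P zP N.
apply: contrapT => nP; apply: nnb.
by apply: nbW (nb_nb zP) => w wP /(_ _ wP N).
Qed.

Lemma om_invariant X x : invariant X (om X x).
Proof.
move=> z; split=> omz P zP N.
  have [n Nn] := omz _ (@nb_kmap (kswap X) (kmap X z) P
    (eq_ind_r (fun w => nb w P) zP (kmapK X z))) N.+1.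
  by case: n Nn => //= n Nn; rewrite kmapK; exists n.
by have [n Nn Pn] := omz _ (nb_kmap zP) N; exists n.+1 => //; exact: leqW.
Qed.

Lemma om_iter X n x : om X (iter n (kmap X) x) = om X x.
Proof.
apply/seteqP; split=> z omz P zP N.
  have [m Nm] := omz P zP N; rewrite -iterD; exists (m + n)%N => //.
  exact: leq_trans (leq_addr _ _).
have [m Nm Pm] := omz P zP (N + n)%N; exists (m - n)%N.
  by rewrite leq_subRL ?(leq_trans _ Nm) ?leq_addl // addnC.
by rewrite -iterD subnK // (leq_trans _ Nm) ?leq_addl.
Qed.

Lemma om_sub X x M : kopen (~` M) ->
  (forall n, M (iter n (kmap X) x)) -> om X x `<=` M.
Proof.
move=> cM xM z omz; apply: contrapT => /cM/omz/(_ 0%N)[n _].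
by apply; apply: xM.
Qed.

Definition closed_invariant X M :=
  [/\ M !=set0, kopen (~` M) & invariant X M].

Lemma closed_invariant_swap X M :
  closed_invariant X M -> closed_invariant (kswap X) M.
Proof. by move=> [M0 cM iM]; split=> //; exact: invariant_swap. Qed.

Lemma closed_invariant_om X x : closed_invariant X (om X x).
Proof. by split; [exact: om_neq0|exact: om_closed|exact: om_invariant]. Qed.

Definition minimal X M := closed_invariant X M /\
  forall N, closed_invariant X N -> N `<=` M -> N = M.

Lemma minimal_swap X M : minimal X M -> minimal (kswap X) M.
Proof.
move=> [cM mM]; split; first exact: closed_invariant_swap.
by move=> N /closed_invariant_swap; exact: mM.
Qed.

(** Zorn is applied to the open invariant sets that do not cover [C]; compactness prevents the union
    of a chain from covering it. What the maximal one leaves of [C] is minimal. *)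
Lemma minimal_exists X C : closed_invariant X C ->
  exists2 M, minimal X M & M `<=` C.
Proof.
move=> [[c0 Cc0] cC iC].
pose P U := [/\ kopen U, invariant X U & exists2 z, C z & ~ U z].
have [F FP totF|A [[oA iA [z0 Cz0 nAz0]] maxA]] := @Zorn_bigcup _ P.
  split.
  - move=> x [U FU Ux]; have [oU _ _] := FP U FU.
    by apply: nbW (oU x Ux) => z Uz; exists U.
  - move=> x; split=> -[U FU Ux]; exists U => //; have [_ iU _] := FP U FU; exact/iU.
  - apply: contrapT => /forall2NP nC.
    have inF z : C z -> exists2 U, F U & U z.
      by move=> Cz; have [|/contrapT[U FU Uz]] := nC z; last by exists U.
    have /choice[V VP] : forall z, exists U, nb z U /\
        (F U \/ U = ~` C).
      move=> z; have [/inF[U FU Uz]|nCz] := pselect (C z).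
        by exists U; split; [have [oU _ _] := FP U FU; exact: oU | left].
      by exists (~` C); split; [exact: cC | right].
    have [s sP] := compactK (fun z => (VP z).1).
    (* Among the finitely many sets of the cover that belong to the chain, one contains all the
       others; it would contain [C]. *)
    have [U FU UP] : exists2 U, F U & forall z, z \in s -> F (V z) -> V z `<=` U.
      have [U0 FU0 _] := inF _ Cc0.
      elim: s {sP} => [|y s [U FU UP]]; first by exists U0.
      have [FVy|nFVy] := pselect (F (V y)); last first.
        by exists U => // z; rewrite inE => /predU1P[->|/UP].
      have [VU|UV] := totF _ _ FVy FU.
        by exists U => // z; rewrite inE => /predU1P[->|/UP].
      exists (V y) => // z; rewrite inE => /predU1P[->_ //|zs FVz].
      exact: subset_trans (UP z zs FVz) UV.
    have [_ _ [z Cz nUz]] := FP U FU; apply: nUz.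
    have [y ys Vyz] := sP z; have [_ [FV|VC]] := VP y; first exact: UP FV _ Vyz.
    by rewrite VC in Vyz.
exists (C `&` ~` A); last by move=> z [].
split.
  split; first by exists z0.
  - by rewrite setCI setCK; exact: kopenU.
  - by move=> x; split=> -[Cx Ax]; split; try (by apply/iC); apply/(invariantC iA).
move=> N [[n0 Nn0] cN iN] NM; apply/seteqP; split=> // z [Cz nAz].
apply: contrapT => nNz; apply: (maxA (~` N)).
  by split=> [w Aw /NM[_]//|/(_ z nNz)].
by split; [|exact: invariantC|exists n0; [case: (NM _ Nn0)|apply]].
Qed.

End Kiet.

(** * Isolating neighbourhoods; periodic orbits *)

Section Good.
Local Open Scope order_scope.
Local Open Scope classical_set_scope.
Variables (d : Order.disp_t) (K : orderType d) (O : split_order K).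
Implicit Types (X : kiet O) (x y z a b : K) (P Q U M L : set K).
Local Notation plus := (plus_of O).
Local Notation adj := (adj_of O).
Local Notation kmin := (kmin_of O).
Local Notation kmax := (kmax_of O).
Local Notation nb := (nb O).
Local Notation kopen := (kopen O).
Local Notation kclopen := (kclopen O).

(** All germs of least period [p], not a single orbit: there may be infinitely many such orbits, and
    one domain has to hold them all when they cannot be separated by finitely many clopen sets. *)
Definition Zper X p := [set x | iter p (kmap X) x = x /\
  forall q, (0 < q < p)%N -> iter q (kmap X) x <> x].

(** Infinite is encoded as aperiodic: a minimal set that contains a periodic point is reduced to its
    orbit. *)
Definition infmin X M := minimal X M /\
  forall x p, M x -> (0 < p)%N -> iter p (kmap X) x <> x.

Definition label X L := (exists2 p, (0 < p)%N & L = Zper X p) \/ infmin X L.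

(* Two-sided isolation of L: a point that stays in U in the future, or in the
   past, has its limit set in L.  The last clause is what makes the projection
   to the line of an orbit staying in U independent of the side from which the
   orbit is accumulated. *)
Definition good X U L := [/\ kclopen U,
  forall x, U x -> (forall n, U (iter n (kmap X) x)) \/
                   (forall n, U (iter n (kinv X) x)),
  forall x, (forall n, U (iter n (kmap X) x)) -> om X x `<=` L,
  forall x, (forall n, U (iter n (kinv X) x)) -> om (kswap X) x `<=` L &
  infmin X L -> forall z, U z -> ~ L z -> plus z -> z != kmin -> L (adj z) ->
    kmap X (adj z) = adj (kmap X z) /\ kinv X (adj z) = adj (kinv X z)].

Lemma kmap_iter_eq X n x y :
  (iter n (kmap X) x = y) <-> (x = iter n (kinv X) y).
Proof. by split=> [<-|->]; rewrite ?kmap_iterK ?kinv_iterK. Qed.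

Lemma Zper_swap X p : Zper (kswap X) p = Zper X p.
Proof.
have fix_swap n x : (iter n (kinv X) x = x) <-> (iter n (kmap X) x = x).
  by rewrite kmap_iter_eq; split=> /esym.
apply/seteqP; split=> x [/= px nqx]; split; try exact/fix_swap.
  by move=> q /nqx qx /fix_swap.
by move=> q /nqx qx /fix_swap.
Qed.

Lemma infmin_swap X M : infmin X M -> infmin (kswap X) M.
Proof.
move=> [mM nM]; split; first exact: minimal_swap.
move=> x p Mx p0 /= /esym /kmap_iter_eq; exact: nM.
Qed.

Lemma label_swap X L : label X L -> label (kswap X) L.
Proof.
by case=> [[p p0 ->]|/infmin_swap]; [left; exists p; rewrite ?Zper_swap | right].
Qed.

Lemma good_swap X U L : good X U L -> good (kswap X) U L.
Proof.
move=> [cU sU fU bU tU]; split=> //; first by move=> x /sU[]; [right|left].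
by move=> /infmin_swap iL z Uz nLz pz z0 Laz; have [] := tU iL z Uz nLz pz z0 Laz.
Qed.

Lemma Zper_iter X p n x : Zper X p (iter n (kmap X) x) <-> Zper X p x.
Proof.
have fix_it q : (iter q (kmap X) (iter n (kmap X) x) = iter n (kmap X) x) <->
    (iter q (kmap X) x = x).
  by rewrite -iterD addnC iterD; split=> [/(can_inj (kmap_iterK X n))|->].
split=> -[/fix_it px nqx]; split=> // q /nqx qx; first by move=> /fix_it.
by move=> /fix_it.
Qed.

Lemma label_disjoint X L L' z : label X L -> label X L' -> L z -> L' z -> L = L'.
Proof.
case=> [[p p0 ->]|[[ciL mL] npL]] [[q q0 ->]|[[ciL' mL'] npL']].
- move=> [pz pminz] [qz qminz]; congr (Zper X _).
  have [pq|qp|//] := ltngtP p q; first by case: (qminz p); rewrite ?p0.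
  by case: (pminz q); rewrite ?q0.
- by move=> [pz _] /npL'/(_ p0).
- by move=> /npL/(_ q0) npz [].
move=> Lz L'z.
have ci : closed_invariant X (L `&` L').
  case: ciL ciL' => [_ cL iL] [_ cL' iL']; split; first by exists z.
  - by rewrite setCI; exact: kopenU.
  - by move=> x; split=> -[/iL Lx /iL' L'x].
by transitivity (L `&` L'); [apply/esym/mL|apply: mL'] => // x [].
Qed.

(** A point of [U'] keeps its future or its past in [U']. In the first case the limit set of [x]
    would lie in both labels; in the second case [x], which is in that past, would be in [U']. Hence
    removing [U'] does not cut a future that stays in [U]. *)
Lemma good_avoid X U L U' L' x : label X L -> label X L' -> L <> L' ->
  good X U L -> good X U' L' -> ~ U' x ->
  (forall n, U (iter n (kmap X) x)) -> forall n, ~ U' (iter n (kmap X) x).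
Proof.
move=> lL lL' LL' [_ _ fU _ _] [_ sU' fU' _ _] nU'x Ux n /sU'[] Vx.
  have [z omz] := om_neq0 X x; apply: LL'.
  apply: (label_disjoint (z := z) lL lL'); first exact: fU omz.
  by move: omz; rewrite -(om_iter X n); apply: fU'.
by apply: nU'x; have := Vx n; rewrite kmap_iterK.
Qed.

Lemma good_setD X U L U' L' : label X L -> label X L' -> L <> L' ->
  good X U L -> good X U' L' -> good X (U `\` U') L.
Proof.
move=> lL lL' LL' gU gU'; have [cU sU fU bU tU] := gU; have [cU' _ _ _ _] := gU'.
split.
- exact: kclopenD.
- move=> x [Ux nU'x]; have [Vx|Vx] := sU x Ux; [left|right] => n; split=> //.
    exact: (good_avoid lL lL' LL' gU gU').
  exact: (good_avoid (label_swap lL) (label_swap lL') LL' (good_swap gU) (good_swap gU')).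
- by move=> x Vx; apply: fU => n; have [] := Vx n.
- by move=> x Vx; apply: bU => n; have [] := Vx n.
- by move=> iL z [Uz _]; apply: tU.
Qed.

(** An orbit might alternate between the two sets forever. If it visits [U] at arbitrarily late
    times and no visit lasts forever, then each visit brings its whole past into [U], and these
    pasts exhaust the orbit. *)
Lemma good_setU_om X U U' L x : good X U L -> good X U' L ->
  (forall n, (U `|` U') (iter n (kmap X) x)) -> om X x `<=` L.
Proof.
move=> [_ sU fU _ _] [_ _ fU' _ _] Vx.
have [[N NU]|/forallNP io] :=
    pselect (exists N, forall n, (N <= n)%N -> ~ U (iter n (kmap X) x)).
  rewrite -(om_iter X N); apply: fU' => n; rewrite -iterD.
  by have [/NU|//] := Vx (n + N)%N; case; exact: leq_addl.
have {}io N : exists2 n, (N <= n)%N & U (iter n (kmap X) x).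
  apply: contrapT => /forall2NP nN; apply: (io N) => n Nn.
  by have [/negP|//] := nN n; rewrite Nn.
have [[n Un]|/forallNP nf] :=
    pselect (exists n, forall m, U (iter m (kmap X) (iter n (kmap X) x))).
  by rewrite -(om_iter X n); exact: fU.
apply: fU => n; have [m nm /sU[/nf//|/(_ (m - n)%N)]] := io n.
by rewrite -{2}(subnK nm) iterD kmap_iterK.
Qed.

Lemma good_setU X U U' L : good X U L -> good X U' L -> good X (U `|` U') L.
Proof.
move=> gU gU'; have [cU sU _ _ tU] := gU; have [cU' sU' _ _ tU'] := gU'.
split.
- exact: kclopenU.
- by move=> x [/sU|/sU'][] Vx; [left|right|left|right] => n; by [left|right].
- by move=> x; exact: good_setU_om.
- by move=> x; apply: (@good_setU_om (kswap X)); exact: good_swap.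
- by move=> iL z [Uz|Uz]; [exact: tU|exact: tU'].
Qed.

Lemma good_set0 X L : good X set0 L.
Proof.
split=> //; try by move=> x /(_ 0%N).
by split=> // x _; apply: nbT => z [].
Qed.

Lemma kclopen_ltn n (P : nat -> set K) : (forall j, (j < n)%N -> kclopen (P j)) ->
  kclopen [set z | exists2 j, (j < n)%N & P j z].
Proof.
move=> cP; split=> [z [j jn Pjz]|z /= nP].
  by have [oP _] := cP j jn; apply: nbW (oP z Pjz) => w Pjw; exists j.
apply: (@nbW _ _ _ _ (fun w => forall j, (j < n)%N -> ~ P j w)).
  by move=> w nPw [j jn]; apply: nPw.
apply: nb_ltn => j jn; have [_ cPj] := cP j jn; apply: cPj => Pjz.
by apply: nP; exists j.
Qed.

Section MonotoneSequence.
Variable s : nat -> K.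
Let acc z := forall P, nb z P -> forall N, exists2 k, (N <= k)%N & P (s k).

Lemma acc_monotone_lt z z' :
  (forall k, s k <= s k.+1) \/ (forall k, s k.+1 <= s k) ->
  acc z -> acc z' -> ~ z < z'.
Proof.
move=> ms az az' zz'; case: ms => ms.
  have {}ms : {homo s : i j / (i <= j)%N >-> i <= j}.
    by apply: homo_leq => // x y w; exact: le_trans.
  have [k _ zk] := az' _ (nb_gt O zz') 0%N.
  have [k' /ms kk'] := az _ (nb_lt O zk) k.
  by rewrite ltNge kk'.
have {}ms : {homo s : i j / (i <= j)%N >-> j <= i}.
  by apply: (@homo_leq _ _ (fun x y => y <= x)) => // x y w xy /le_trans; apply.
have [k _ zk] := az _ (nb_lt O zz') 0%N.
have [k' /ms kk'] := az' _ (nb_gt O zk) k.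
by rewrite ltNge kk'.
Qed.

Lemma acc_monotone z z' :
  (forall k, s k <= s k.+1) \/ (forall k, s k.+1 <= s k) ->
  acc z -> acc z' -> z = z'.
Proof.
move=> ms az az'; have [zz'|zz'|//] := ltgtP z z'.
  by have := acc_monotone_lt ms az az' zz'.
by have := acc_monotone_lt ms az' az zz'.
Qed.
End MonotoneSequence.

(** [J] is a section on which the return map is the [p]-th iterate and is increasing. The successive
    returns form a monotone sequence, which has at most one accumulation point; a limit point [y] in
    [J] and its image under the return map are both such points, so [y] is fixed. The absence of
    earlier returns makes [p] the least period. *)
Lemma om_periodic X p (J V : set K) : (0 < p)%N -> kopen J -> kopen (~` V) ->
  (forall x z, J x -> J z -> J (iter p (kmap X) x) -> J (iter p (kmap X) z) ->
     x <= z -> iter p (kmap X) x <= iter p (kmap X) z) ->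
  (forall x, (forall n, V (iter n (kmap X) x)) -> exists n, J (iter n (kmap X) x)) ->
  (forall x, J x -> (forall n, V (iter n (kmap X) x)) -> J (iter p (kmap X) x)) ->
  (forall x i, (0 < i < p)%N -> J x -> ~ J (iter i (kmap X) x)) ->
  forall x, (forall n, V (iter n (kmap X) x)) -> om X x `<=` Zper X p.
Proof.
move=> p0 oJ cV mono first next noret x Vx z.
have [n0 Jw] := first x Vx; rewrite -(om_iter X n0); set w := iter n0 _ x in Jw *.
have Vw n : V (iter n (kmap X) w) by rewrite -iterD.
have omV z' : om X w z' -> V z' by apply: om_sub.
move=> omz; have Vz n : V (iter n (kmap X) z).
  by apply: omV; apply/(invariant_iter _ _ (om_invariant X w)).
have [n Jz] := first z Vz; apply/(Zper_iter X p n); set y := iter n _ z in Jz *.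
have omy : om X w y by apply/(invariant_iter _ _ (om_invariant X w)).
have omy' : om X w (iter p (kmap X) y).
  by apply/(invariant_iter _ _ (om_invariant X w)).
have Jy' : J (iter p (kmap X) y).
  by apply: next => // m; rewrite -iterD.
pose s k := iter (k * p) (kmap X) w.
have sS k : s k.+1 = iter p (kmap X) (s k) by rewrite /s mulSn iterD.
have Vs k m : V (iter m (kmap X) (s k)) by rewrite -iterD.
have Js k : J (s k) by elim: k => // k IH; rewrite sS; apply: next.
have Jdvd m : J (iter m (kmap X) w) -> (p %| m)%N.
  rewrite {1}(divn_eq m p) addnC iterD => Jm; apply: contrapT => /negP pm.
  by apply: noret Jm; [rewrite lt0n pm ltn_pmod|exact: (Js (m %/ p)%N)].
have accs u : J u -> om X w u -> forall P, nb u P -> forall N,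
    exists2 k, (N <= k)%N & P (s k).
  move=> Ju omu P uP N.
  have [m Nm [Pm /Jdvd/dvdnP[k mE]]] := omu _ (nbI uP (oJ _ Ju)) (N * p)%N.
  by exists k; [rewrite mE leq_pmul2r in Nm|rewrite /s -mE].
split; last by move=> q q0p yq; apply: (noret _ _ q0p Jz); rewrite yq.
apply: esym (acc_monotone _ (accs _ Jz omy) (accs _ Jy' omy')).
have /orP[ws|ws] := le_total (s 0%N) (s 1%N); [left|right].
  elim=> // k IH; rewrite (sS k) (sS k.+1).
  by apply: mono => //; rewrite -sS.
elim=> // k IH; rewrite (sS k) (sS k.+1).
by apply: mono => //; rewrite -sS.
Qed.

(** Only the ends [a] and [b] are constrained: monotonicity confines the iterates of the points in
    between to the same top intervals. *)
Definition branch X n a b := forall j, (j < n)%N -> exists c,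
  top0 X c <= iter j (kmap X) a /\ iter j (kmap X) b <= top1 X c.

Lemma branch_mono X n a b x z : branch X n a b -> a <= x -> x <= z -> z <= b ->
  iter n (kmap X) x <= iter n (kmap X) z.
Proof.
elim: n a x z b => //= n IH a x z b bn ax xz zb.
have {}IH u v : a <= u -> u <= v -> v <= b ->
    iter n (kmap X) u <= iter n (kmap X) v.
  by move=> *; apply: (IH a _ _ b) => // j jn; apply: bn; exact: ltnW.
have [c [ca cb]] := bn n (ltnSn n).
apply: (@kmap_mono _ _ _ X c); [apply: le_trans ca _|exact: IH|apply: le_trans cb].
  by apply: IH; rewrite ?(le_trans xz).
by apply: IH; rewrite ?(le_trans ax).
Qed.

Lemma branch_onto X n a b w : branch X n a b -> a <= b ->
  iter n (kmap X) a <= w -> w <= iter n (kmap X) b ->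
  a <= iter n (kinv X) w <= b.
Proof.
elim: n w => [|n IH] w bn ab /= aw wb; first by rewrite aw.
have [c [ca cb]] := bn n (ltnSn n).
have bn' : branch X n a b by move=> j jn; apply: bn; exact: ltnW.
have iab := branch_mono bn' (lexx a) ab (lexx b).
have /andP[ba _] := kmap_top (introT andP (conj ca (le_trans iab cb))).
have /andP[_ bb] := kmap_top (introT andP (conj (le_trans ca iab) cb)).
rewrite -iterS iterSr; apply: IH => //.
  rewrite -[iter n _ a](kmapK X); apply: (@kinv_mono _ _ _ X c) => //.
  exact: le_trans wb bb.
rewrite -[iter n _ b](kmapK X); apply: (@kinv_mono _ _ _ X c) => //.
exact: le_trans ba aw.
Qed.

(** The last two conclusions, smallness and invariance in one direction of time, serve to trap an
    orbit near [y] in [periodic_om_al]. *)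
Lemma periodic_good X p y P : (0 < p)%N -> Zper X p y -> nb y P ->
  exists V, [/\ good X V (Zper X p), V y,
    forall x, V x -> exists2 j, (j < p)%N & P (iter j (kinv X) x) &
    (forall x, V x -> V (kmap X x)) \/ (forall x, V x -> V (kinv X x))].
Proof.
move=> p0 [py npy] yP.
have [c cP] := choice (fun j => top_cover X (iter j (kmap X) y)).
have nbc : nb y (fun z => forall j, (j < p)%N ->
    top0 X (c j) <= iter j (kmap X) z <= top1 X (c j)).
  apply: nb_ltn => j _; apply: (@nb_iter _ _ _ X j y [set w | _ <= w <= _]).
  by exists (top0 X (c j)), (top1 X (c j)); rewrite top0_plus top1_plus.
(* A neighbourhood of [y] that is disjoint from its image by the [j]-th iterate; these will exclude
   returns before time [p]. *)
have /choice[Q QP] : forall j, exists Q : set K, (0 < j < p)%N ->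
    nb y (fun z => Q z /\ ~ Q (iter j (kmap X) z)).
  move=> j.
  have [jp|] := boolP (0 < j < p)%N; last by exists setT.
  have [|Q [Q' [yQ yQ' QQ']]] := @nb_sep _ _ O y (iter j (kmap X) y).
    by apply/eqP => /esym; exact: npy.
  exists Q => _; apply: nbW (nbI yQ (nb_iter yQ')) => z [Qz Q'z]; split=> //.
  by move=> /QQ'.
have nbQ : nb y (fun z => forall j, (j < p)%N -> (0 < j)%N ->
    Q j z /\ ~ Q j (iter j (kmap X) z)).
  apply: nb_ltn => j jp; have [->|j0] := posnP j; first exact: nbT.
  by apply: nbW (QP j _) => //; rewrite j0.
have [a0 [b0 [pa0 pb0 /andP[ay0 yb0] J0P]]] := nbI yP (nbI nbc nbQ).
(* A germ sees only its own side, so the neighbourhood can be shrunk until [y] is one of its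
   ends. *)
have [a [b [pa pb /andP[ay yb] JP yab]]] : exists a b,
   [/\ plus a, ~~ plus b, a <= y <= b, (forall z, a <= z <= b -> a0 <= z <= b0) &
       y = a \/ y = b].
  have [pY|pY] := boolP (plus y).
    exists y, b0; split=> //; rewrite ?lexx //; last by left.
    by move=> z /andP[yz ->]; rewrite (le_trans ay0).
  exists a0, y; split=> //; rewrite ?lexx ?andbT //; last by right.
  by move=> z /andP[-> zy]; rewrite (le_trans zy).
have ab := le_trans ay yb.
have {}JP z := fun Jz => J0P z (JP z Jz).
pose J := [set z | a <= z <= b].
have br : branch X p a b.
  move=> j jp; exists (c j).
  have [|_ [/(_ j jp)/andP[-> _] _]] := JP a; first by rewrite lexx.
  by have [|_ [/(_ j jp)/andP[_ ->] _]] := JP b; first by rewrite lexx andbT.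
have noret x i : (0 < i < p)%N -> J x -> ~ J (iter i (kmap X) x).
  move=> /andP[i0 ip] Jx Jix.
  have [_ [_ /(_ i ip i0)[_]]] := JP _ Jx; apply.
  by have [_ [_ /(_ i ip i0)[]]] := JP _ Jix.
have noret' x i : (0 < i < p)%N -> J x -> ~ J (iter i (kinv X) x).
  by move=> ip Jx Jix; apply: (noret _ i ip Jix); rewrite kinv_iterK.
have pmono x z : J x -> J z -> x <= z -> iter p (kmap X) x <= iter p (kmap X) z.
  by move=> /andP[ax _] /andP[_ zb] xz; exact: branch_mono br ax xz zb.
(* The end [y] is fixed by the increasing map, so everything depends on whether the other end moves
   inward or outward. In the outward case the image of [J] contains [J], and [branch_onto] provides
   the preimages. *)
have Jinv : (forall z, J z -> J (iter p (kmap X) z)) \/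
            (forall z, J z -> J (iter p (kinv X) z)).
  have Ja : J a by rewrite /J /= lexx ab.
  have Jb : J b by rewrite /J /= lexx ab.
  case: yab => yE; rewrite yE in py.
    have [bb|bb] := leP (iter p (kmap X) b) b; [left|right] => z Jz.
      have /andP[az zb] := Jz; rewrite /J /= -{1}py pmono //.
      by rewrite (le_trans _ bb) // pmono.
    have /andP[az zb] := Jz.
    by apply: branch_onto br ab _ _; [rewrite py | rewrite (le_trans zb) // ltW].
  have [aa|aa] := leP a (iter p (kmap X) a); [left|right] => z Jz.
    have /andP[az zb] := Jz; rewrite /J /= -{1}py pmono // andbT.
    by rewrite (le_trans aa) // pmono.
  have /andP[az zb] := Jz.
  by apply: branch_onto br ab _ _; [rewrite (le_trans _ az) // ltW | rewrite py].
pose V := [set z | exists2 j, (j < p)%N & J (iter j (kinv X) z)].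
have clV : kclopen V.
  by apply: kclopen_ltn => j _; apply: (@kclopen_iter _ _ _ (kswap X)); exact: kclopen_itv.
have Vinv : (forall x, V x -> V (kmap X x)) \/ (forall x, V x -> V (kinv X x)).
  case: Jinv => Jp; [left|right] => x [j jp Jj].
    move: jp; rewrite leq_eqVlt => /predU1P[jp|jp].
      exists 0%N => //=; rewrite -[x](kinv_iterK X j) -iterS jp.
      exact: Jp.
    by exists j.+1 => //; rewrite iterSr kmapK.
  case: j jp Jj => [|j] jp Jj.
    exists p.-1; first by rewrite prednK.
    by rewrite -iterSr prednK //; exact: Jp.
  by exists j; [exact: ltnW|rewrite -iterSr].
have [[oV cV] oJ] : kclopen V /\ kopen J by split=> //; have [] := kclopen_itv pa pb.
have gV : good X V (Zper X p).
  split=> //.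
  - move=> x Vx; case: Vinv => iV; [left|right]; elim=> //= n; exact: iV.
  - apply: (om_periodic p0 oJ cV) => //; first by move=> x z Jx Jz _ _; exact: pmono.
    + move=> x /(_ p)[j jp Jj]; exists (p - j)%N.
      by move: Jj; rewrite -{1}(subnKC (ltnW jp)) iterD kmap_iterK.
    (* At time [p] the orbit is in the image of [J] by some iterate of order less than [p]; unless
       that order is 0, the orbit was back in [J] too early. *)
    + move=> x Jx /(_ p)[[|j] jp Jj] //; case: (noret x (p - j.+1)%N) => //.
        by rewrite subn_gt0 jp ltn_subrL p0.
      by move: Jj; rewrite -{1}(subnKC (ltnW jp)) iterD kmap_iterK.
  - rewrite -Zper_swap; apply: (om_periodic (X := kswap X) p0 oJ cV) => //.
    + move=> x z Jx Jz Jpx Jpz xz; rewrite leNgt; apply/negP => zx.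
      have := pmono _ _ Jpz Jpx (ltW zx); rewrite !kinv_iterK => zx'.
      have xzE : x = z by apply/le_anti; rewrite xz.
      by rewrite xzE ltxx in zx.
    + by move=> x /(_ 0%N)[j jp Jj]; exists j.
    + move=> x Jx /(_ 1%N)[j jp]; rewrite -iterD addn1 => Jj.
      move: jp; rewrite leq_eqVlt => /predU1P[<-//|jp].
      by case: (noret' x j.+1).
  - move=> [_ /(_ y p)] []//; exact: (conj py npy).
exists V; split=> //; first by exists 0%N; rewrite // /J /= ay yb.
by move=> x [j jp Jj]; exists j => //; have [] := JP _ Jj.
Qed.

(** If [x] is not on the orbit of [y], some small [V] around [y] misses [x]. But [x] visits [V] in
    the future and in the past, and [V] is invariant in one direction of time, so one of the visits
    is carried to [x] itself. *)
Lemma periodic_om_al X p x y : (0 < p)%N -> Zper X p y -> om X x y ->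
  om (kswap X) x y -> exists j, x = iter j (kmap X) y.
Proof.
move=> p0 yp omy aly; apply: contrapT => /forallNP nxy.
have [|V [[[oV cV] _ _ _ _] Vy VP Vinv]] := @periodic_good X p y
    (fun z => forall j, (j < p)%N -> z <> iter j (kinv X) x) p0 yp.
  apply: nb_ltn => j jp; have [|P [Q [yP zQ PQ]]] := @nb_sep _ _ O y (iter j (kinv X) x).
    by apply/eqP => yE; apply: (nxy j); rewrite yE kinv_iterK.
  by apply: nbW yP => z Pz zE; apply: PQ Pz _; rewrite zE; exact: nb_self zQ.
have [//|j jp /(_ j jp)//] := VP x.
case: Vinv => iV.
  have [n _ Vn] := aly _ (oV y Vy) 0%N.
  rewrite -[x](kinv_iterK X n); elim: n {Vn}(iter n _ x) (Vn : V _) => //= n IH z Vz.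
  by apply: iV; exact: IH.
have [n _ Vn] := omy _ (oV y Vy) 0%N.
rewrite -[x](kmap_iterK X n); elim: n {Vn}(iter n _ x) (Vn : V _) => //= n IH z Vz.
by apply: iV; exact: IH.
Qed.

End Good.

(** * Infinite minimal sets *)

Section InfiniteMinimal.
Local Open Scope order_scope.
Local Open Scope classical_set_scope.
Variables (d : Order.disp_t) (K : orderType d) (O : split_order K).
Implicit Types (X : kiet O) (x y z w a b m : K) (P Q U L : set K).
Local Notation plus := (plus_of O).
Local Notation adj := (adj_of O).
Local Notation kmin := (kmin_of O).
Local Notation kmax := (kmax_of O).
Local Notation nb := (nb O).
Local Notation kopen := (kopen O).
Local Notation kclopen := (kclopen O).

Lemma kmap_le X c x y : top0 X c <= x <= top1 X c -> top0 X c <= y <= top1 X c ->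
  (kmap X x <= kmap X y) = (x <= y).
Proof.
move=> /andP[cx xc] /andP[cy yc]; have [xy|yx] := leP x y.
  exact: kmap_mono cx xy yc.
apply/negP => Txy; have Tyx := kmap_mono cy (ltW yx) xc.
have /(@kmap_inj _ _ _ X) xyE : kmap X x = kmap X y by apply/le_anti; rewrite Txy.
by rewrite xyE ltxx in yx.
Qed.

Lemma kmap_lt X c x y : top0 X c <= x <= top1 X c -> top0 X c <= y <= top1 X c ->
  (kmap X x < kmap X y) = (x < y).
Proof. by move=> cx cy; rewrite !ltNge (kmap_le cy cx). Qed.

(** [adj z] is the immediate predecessor of [z], and an order isomorphism between intervals respects
    predecessors. *)
Lemma kmap_adj X c z : top0 X c <= adj z -> z <= top1 X c -> plus z -> z != kmin ->
  kmap X (adj z) = adj (kmap X z).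
Proof.
move=> cz zc pz z0; have [az maz _ zaz] := adj_plus pz z0.
have top_az : top0 X c <= adj z <= top1 X c by rewrite cz (le_trans (ltW az)).
have top_z : top0 X c <= z <= top1 X c by rewrite zc (le_trans cz) // ltW.
have Taz : kmap X (adj z) < kmap X z by rewrite (kmap_lt top_az top_z).
have pTz : plus (kmap X z) by rewrite kmap_plus.
have Tz0 : kmap X z != kmin by apply: contraTneq Taz => ->; rewrite -leNgt kmin_le.
have [aTz _ _ zaTz] := adj_plus pTz Tz0.
have aTaz := zaTz _ Taz.
have bot_w : bot0 X c <= adj (kmap X z) <= bot1 X c.
  have /andP[b0 _] := kmap_top top_az; have /andP[_ b1] := kmap_top top_z.
  by rewrite (le_trans b0) // (le_trans (ltW aTz)).
have top_w := kinv_bot bot_w.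
apply/le_anti; rewrite aTaz /= -[adj (kmap X z)](kinvK X) (kmap_le top_w top_az).
by apply: zaz; rewrite -(kmap_lt top_w top_z) kinvK.
Qed.

Variable M : set K.

(* z and w are in the same convex component of the complement of M, or are
   equal. *)
Definition sim z w := forall m, M m -> ((m < z) = (m < w)) /\ ((z < m) = (w < m)).

Lemma sim_refl z : sim z z. Proof. by []. Qed.

Lemma sim_sym z w : sim z w -> sim w z.
Proof. by move=> zw m /zw[-> ->]. Qed.

Lemma sim_trans z w v : sim z w -> sim w v -> sim z v.
Proof. by move=> zw wv m Mm; have [-> ->] := zw m Mm; exact: wv. Qed.

Lemma sim_in z w : M z -> sim z w -> w = z.
Proof.
move=> Mz /(_ z Mz)[]; rewrite !ltxx => zw wz; apply/le_anti.
by rewrite !leNgt -zw -wz.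
Qed.

(* The component of z and the two points of M that bound it lie in one top
   interval. *)
Definition freg X z := exists c m m',
  [/\ M m, M m', top0 X c <= m, m < z & z < m' /\ m' <= top1 X c].

Lemma freg_sim X z w : freg X z -> sim z w -> freg X w.
Proof.
move=> [c [m [m' [Mm Mm' cm mz [zm' mc']]]]] zw; exists c, m, m'; split=> //.
  by have [<- _] := zw m Mm.
by have [_ <-] := zw m' Mm'.
Qed.

Lemma freg_top X z : freg X z -> exists c, forall w, sim z w ->
  top0 X c <= w <= top1 X c.
Proof.
move=> [c [m [m' [Mm Mm' cm mz [zm' mc']]]]]; exists c => w zw.
have [mw _] := zw m Mm; have [_ wm'] := zw m' Mm'.
apply/andP; split; [apply: le_trans cm _|apply: le_trans mc'].
  by rewrite ltW // -mw.
by rewrite ltW // -wm'.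
Qed.

Lemma kmap_sim X z w : invariant X M -> freg X z -> sim z w ->
  sim (kmap X z) (kmap X w).
Proof.
move=> iM fz zw m Mm; have [c ctop] := freg_top fz.
have tz := ctop _ (sim_refl z); have tw := ctop _ zw.
have MTm : M (kinv X m) by apply/iM; rewrite kinvK.
have /andP[bz zb] := kmap_top tz; have /andP[bw wb] := kmap_top tw.
have [mb|bm] := ltP m (bot0 X c).
  rewrite (lt_le_trans mb bz) (lt_le_trans mb bw).
  by rewrite !ltNge (ltW (lt_le_trans mb bz)) (ltW (lt_le_trans mb bw)).
have [bm'|mb] := ltP (bot1 X c) m.
  rewrite (le_lt_trans zb bm') (le_lt_trans wb bm').
  by rewrite !ltNge (ltW (le_lt_trans zb bm')) (ltW (le_lt_trans wb bm')).
have tm := kinv_bot (introT andP (conj bm mb)).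
by rewrite -[m](kinvK X) !(kmap_lt tm) ?(kmap_lt _ tm) //; exact: zw.
Qed.

Lemma freg_swap X z : invariant X M -> freg X z -> freg (kswap X) (kmap X z).
Proof.
move=> iM [c [m [m' [Mm Mm' cm mz [zm' mc']]]]].
have mc : m <= top1 X c by rewrite (le_trans (ltW mz)) // (le_trans (ltW zm')).
have cm' : top0 X c <= m' by rewrite (le_trans cm) // (le_trans (ltW mz)) // ltW.
have tm : top0 X c <= m <= top1 X c by rewrite cm mc.
have tm' : top0 X c <= m' <= top1 X c by rewrite cm' mc'.
have tz : top0 X c <= z <= top1 X c.
  by rewrite (le_trans cm (ltW mz)) (le_trans (ltW zm') mc').
exists c, (kmap X m), (kmap X m'); split; try exact/iM.
- by have /andP[] := kmap_top tm.
- by rewrite (kmap_lt tm tz).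
- by rewrite (kmap_lt tz tm'); have /andP[] := kmap_top tm'.
Qed.

(** In a top interval containing [z], [M] is missing on one side of [z], so the component of [z]
    reaches an end of that interval. There are finitely many ends, hence finitely many irregular
    components. *)
Lemma irregular_sim X z : ~ M z -> ~ freg X z ->
  exists c, sim z (top0 X c) \/ sim z (top1 X c).
Proof.
move=> nMz nfz; have [c /andP[cz zc]] := top_cover X z; exists c.
have zm m : M m -> m <= z -> m < z.
  by move=> Mm; rewrite lt_neqAle => ->; rewrite andbT; apply: contra_notN nMz => /eqP <-.
have mz m : M m -> z <= m -> z < m.
  by move=> Mm; rewrite lt_neqAle => ->; rewrite andbT; apply: contra_notN nMz => /eqP ->.
have [[m [Mm cm mz']]|nm] := pselect (exists m, [/\ M m, top0 X c <= m & m < z]).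
  right => m' Mm'; have nm' : z < m' -> m' <= top1 X c -> False.
    by move=> zm' mc'; apply: nfz; exists c, m, m'.
  split; apply/idP/idP.
  - by move=> m'z; exact: lt_le_trans zc.
  - by move=> m'c; rewrite ltNge; apply/negP => /(mz _ Mm')/nm'; apply; exact: ltW.
  - by move=> zm'; rewrite ltNge; apply/negP; exact: nm'.
  - exact: le_lt_trans.
left => m Mm; have nm' : top0 X c <= m -> m < z -> False.
  by move=> cm mz'; apply: nm; exists m.
split; apply/idP/idP.
- by move=> mz'; rewrite ltNge; apply/negP => /nm'; exact.
- by move=> mc; exact: lt_le_trans cz.
- exact: le_lt_trans.
- by move=> cm; rewrite ltNge; apply/negP => /(zm _ Mm); apply: nm'; exact: ltW.
Qed.

Lemma irregular_seq X : exists E : seq K, forall z, ~ M z -> ~ freg X z ->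
  exists2 e, e \in E & sim z e.
Proof.
exists (codom (top0 X) ++ codom (top1 X)) => z nMz nfz.
have [c [zc|zc]] := irregular_sim nMz nfz; [exists (top0 X c)|exists (top1 X c)] => //.
  by rewrite mem_cat codom_f.
by rewrite mem_cat orbC codom_f.
Qed.

Lemma sim_nb z : kopen (~` M) -> ~ M z -> nb z (sim z).
Proof.
move=> cM /cM[a [b [pa pb /andP[az zb] abM]]]; exists a, b; split=> //.
  by rewrite az.
move=> w /andP[aw wb] m Mm.
have [ma|am] := ltP m a.
  rewrite (lt_le_trans ma az) (lt_le_trans ma aw).
  by rewrite !ltNge (ltW (lt_le_trans ma az)) (ltW (lt_le_trans ma aw)).
have [bm|mb] := ltP b m.
  rewrite (le_lt_trans zb bm) (le_lt_trans wb bm).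
  by rewrite !ltNge (ltW (le_lt_trans zb bm)) (ltW (le_lt_trans wb bm)).
by case: (abM m); rewrite ?am.
Qed.

Definition fbad X z := exists n, ~ freg X (iter n (kmap X) z).

Lemma nfbadP X z : ~ fbad X z -> forall n, freg X (iter n (kmap X) z).
Proof. by move=> nf n; apply: contrapT => nr; apply: nf; exists n. Qed.

Lemma fbad_iter X n z : fbad X (iter n (kmap X) z) -> fbad X z.
Proof. by move=> [j]; rewrite -iterD => nf; exists (j + n)%N. Qed.

Lemma iter_sim X n z w : invariant X M ->
  (forall j, (j < n)%N -> freg X (iter j (kmap X) z)) -> sim z w ->
  sim (iter n (kmap X) z) (iter n (kmap X) w).
Proof.
move=> iM; elim: n => //= n IH nr zw; apply: kmap_sim => //; first exact: nr.
by apply: IH => // j jn; apply: nr; exact: ltnW.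
Qed.

Lemma fbad_sim X z w : invariant X M -> fbad X z -> sim z w -> fbad X w.
Proof.
move=> iM [n nr] zw; apply: contrapT => /nfbadP nb.
by apply/nr/(freg_sim (nb n))/(iter_sim iM _ (sim_sym zw)).
Qed.

(** The last two cases make every remaining point off [M] regular for one step in both directions,
    which is what the comparison of two adjacent germs in [good] requires. *)
Definition bad X z := ~ M z /\
  [\/ fbad X z /\ fbad (kswap X) z, ~ freg X z | ~ freg (kswap X) z].

Lemma bad_swap X z : bad (kswap X) z <-> bad X z.
Proof.
split=> -[nMz nreg]; split=> //; case: nreg => [[f b]|n|n].
- by constructor 1; split; [exact: b|exact: f].
- by constructor 3; exact: n.
- by constructor 2; exact: n.
- by constructor 1; split; [exact: b|exact: f].
- by constructor 3; exact: n.
- by constructor 2; exact: n.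
Qed.

Lemma bad_sim X z w : invariant X M -> bad X z -> sim z w -> bad X w.
Proof.
move=> iM [nMz bz] zw; split.
  by move=> Mw; apply: nMz; rewrite (sim_in Mw (sim_sym zw)).
case: bz => [[fz bz]|nf|nb].
- by constructor 1; split; apply: fbad_sim zw => //; exact: invariant_swap.
- by constructor 2 => fw; apply/nf/(freg_sim fw)/sim_sym.
- by constructor 3 => bw; apply/nb/(freg_sim bw)/sim_sym.
Qed.

(* A bad class is an iterated preimage of an irregular one; the number of
   preimages to take is bounded since a further preimage is irregular too. *)
Lemma bad_seq X : invariant X M -> exists l : seq K,
  forall z, bad X z -> exists2 e, e \in l & sim z e.
Proof.
move=> iM; have [E EP] := irregular_seq X; have [E' EP'] := irregular_seq (kswap X).
(* [N e] is a time at which the past of [e] is irregular. A bad component first irregular after [n]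
   steps comes back from [e] through [n] regular steps, so [n] is at most [N e]. *)
have /choice[N NP] : forall e, exists n, fbad (kswap X) e ->
    ~ freg (kswap X) (iter n (kinv X) e).
  by move=> e; have [[n nf]|nb] := pselect (fbad (kswap X) e); [exists n|exists 0%N].
exists (E ++ E' ++ [seq iter i (kinv X) e | e <- E, i <- iota 0 (N e).+1]).
move=> z [nMz [[[n0 nf] bz]|nf|nb]]; last 2 first.
- by have [e eE ze] := EP z nMz nf; exists e; rewrite // mem_cat eE.
- by have [e eE ze] := EP' z nMz nb; exists e; rewrite // !mem_cat eE orbT.
have exn : exists n, `[< ~ freg X (iter n (kmap X) z) >].
  by exists n0; apply/asboolP.
have [n /asboolP nfn nmin] := ex_minnP exn.
have rj j : (j < n)%N -> freg X (iter j (kmap X) z).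
  by move=> jn; apply: contrapT => /asboolP/nmin; rewrite leqNgt jn.
have [|e eE ze] := EP (iter n (kmap X) z) _ nfn.
  by move=> /(invariant_iter _ _ iM).
have backE i : (i <= n)%N -> iter i (kinv X) (iter n (kmap X) z) = iter (n - i) (kmap X) z.
  by move=> ijn; rewrite -{1}(subnKC ijn) iterD kmap_iterK.
have breg i : (i < n)%N -> freg (kswap X) (iter i (kmap (kswap X)) (iter n (kmap X) z)).
  move=> ijn; rewrite backE ?(ltnW ijn) //.
  have nik : (n - i = (n - i).-1.+1)%N by rewrite prednK // subn_gt0.
  by rewrite nik; apply: freg_swap => //; apply: rj; rewrite -nik leq_subr.
have iM' := invariant_swap iM.
have zen : sim z (iter n (kinv X) e).
  by have := iter_sim iM' breg ze; rewrite /= kmap_iterK.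
exists (iter n (kinv X) e) => //; rewrite !mem_cat; apply/orP; right; apply/orP; right.
apply: allpairs_f_dep => //; rewrite mem_iota /= add0n ltnS leqNgt; apply/negP => Nn.
apply: (NP e).
  by apply: (@fbad_iter (kswap X) n); apply: fbad_sim bz zen.
apply: (@freg_sim (kswap X) _ _ (breg _ Nn)); apply: iter_sim => // j jN.
by apply: breg; exact: ltn_trans Nn.
Qed.

Lemma infmin_om X x : infmin X M -> M x -> om X x = M.
Proof.
move=> [[[_ cM iM] mM] _] Mx; apply: mM; first exact: closed_invariant_om.
by apply: om_sub => // n; apply/(invariant_iter _ _ iM).
Qed.

(** By minimality [m] is in its own limit set, and it returns near itself without ever coming back
    exactly. *)
Lemma infmin_nonisolated X m P : infmin X M -> M m -> nb m P ->
  exists2 m', P m' & M m' /\ m' <> m.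
Proof.
move=> iM Mm mP; have [[[_ _ inv] _] np] := iM.
have := Mm; rewrite -{1}(infmin_om iM Mm) => /(_ P mP 1%N)[n n1 Pn].
exists (iter n (kmap X) m) => //; split; last exact: np.
exact/(invariant_iter _ _ inv).
Qed.

(** If a point of [M] separates [m] from [z], cut there. Otherwise [m] bounds the component, and it
    must be the germ facing away from it: on the other side, points of [M] would accumulate at [m]
    inside the component. The cut is then at [m] itself. *)
Lemma nsim_nb X z m : infmin X M -> ~ M z -> M m -> nb m (fun w => ~ sim w z).
Proof.
move=> iM nMz Mm.
have mz : m != z by apply: contra_notN nMz => /eqP <-.
have [mltz|zltm|mzE] := ltgtP m z; last by rewrite mzE eqxx in mz.
  have [[m' [Mm' mm' m'z]]|nm] := pselect (exists m', [/\ M m', m < m' & m' < z]).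
    apply: nbW (nb_lt O mm') => w wm' /(_ m' Mm')[] + _.
    by rewrite m'z ltNge (ltW wm').
  have [pm|pm] := boolP (plus m).
    have mnb : nb m (fun w => m <= w).
      exists m, kmax; split=> //; [exact: plus_kmax|by rewrite lexx le_kmax|].
      by move=> w /andP[].
    have [m' [mm' m'z] [Mm' nmm']] := infmin_nonisolated iM Mm (nbI mnb (nb_lt O mltz)).
    by case: nm; exists m'; split=> //; rewrite lt_neqAle mm' andbT; apply/eqP => /esym.
  exists kmin, m; split=> //; [exact: plus_kmin|by rewrite lexx kmin_le|].
  by move=> w /andP[_ wm] /(_ m Mm)[]; rewrite mltz ltNge wm.
have [[m' [Mm' zm' m'm]]|nm] := pselect (exists m', [/\ M m', z < m' & m' < m]).
  apply: nbW (nb_gt O m'm) => w wm' /(_ m' Mm')[] _.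
  by rewrite zm' ltNge (ltW wm').
have [pm|pm] := boolP (plus m).
  exists m, kmax; split=> //; [exact: plus_kmax|by rewrite lexx le_kmax|].
  by move=> w /andP[wm _] /(_ m Mm)[]; rewrite zltm !ltNge wm.
have mnb : nb m (fun w => w <= m).
  exists kmin, m; split=> //; [exact: plus_kmin|by rewrite lexx kmin_le|].
  by move=> w /andP[].
have [m' [mm' m'z] [Mm' nmm']] := infmin_nonisolated iM Mm (nbI mnb (nb_gt O zltm)).
by case: nm; exists m'; split=> //; rewrite lt_neqAle mm' andbT; apply/eqP.
Qed.

(** By [bad_seq] only finitely many components are bad; each is open by [sim_nb], and by [nsim_nb]
    none accumulates on [M]. *)
Lemma bad_clopen X : infmin X M -> kclopen (~` bad X).
Proof.
move=> iM; have [[[M0 cM inv] mM] npM] := iM.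
have [l lP] := bad_seq inv.
split; last first.
  rewrite setCK => z bz; apply: nbW (sim_nb cM bz.1) => w zw.
  exact: bad_sim zw.
move=> z nbz; have [Mz|nMz] := pselect (M z); last first.
  by apply: nbW (sim_nb cM nMz) => w /sim_sym zw bw; apply/nbz/(bad_sim inv bw).
apply: (@nbW _ _ _ _ (fun w => forall e, e \in l -> ~ M e -> ~ sim w e)).
  move=> w we bw; have [e el se] := lP w bw; apply: (we e el) => // Me.
  by case: bw => nMw _; apply: nMw; rewrite (sim_in Me (sim_sym se)).
apply: nb_seq => e el; have [Me|nMe] := pselect (M e); first exact: nbT.
by apply: nbW (nsim_nb iM nMe Mz) => w nwe _.
Qed.

Lemma bad_forward X z : invariant X M -> ~ M z -> ~ bad X z ->
  (forall n, freg X (iter n (kmap X) z)) -> forall n, ~ bad X (iter n (kmap X) z).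
Proof.
move=> inv nMz nbz fz n [_ [[fb _]|nf|nb]].
- by have [j] := fbad_iter fb; apply.
- exact: nf.
case: n nb => [|n] nb; last by apply: nb; apply: freg_swap inv (fz n).
by apply: nbz; split=> //; constructor 3.
Qed.

(** The left end of the component of [w]: it turns the return of a component into the return of a
    point of [M]. *)
Definition lnbr w m := [/\ M m, m < w & forall m', M m' -> m' < w -> m' <= m].

Lemma lnbr_kmap X w m : invariant X M -> freg X w -> lnbr w m ->
  lnbr (kmap X w) (kmap X m).
Proof.
move=> inv [c [m0 [m1 [Mm0 Mm1 cm0 m0w [wm1 m1c]]]]] [Mm mw mmax].
have cm : top0 X c <= m by exact: le_trans (mmax _ Mm0 m0w).
have wc := le_trans (ltW wm1) m1c.
have tm : top0 X c <= m <= top1 X c by rewrite cm (le_trans (ltW mw)).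
have tw : top0 X c <= w <= top1 X c by rewrite wc (le_trans cm (ltW mw)).
split; [exact/inv|by rewrite (kmap_lt tm tw)|move=> m' Mm' m'w].
rewrite leNgt; apply/negP => mm'.
have bm' : bot0 X c <= m' <= bot1 X c.
  have /andP[bm _] := kmap_top tm; have /andP[_ wb] := kmap_top tw.
  by rewrite (le_trans bm (ltW mm')) (le_trans (ltW m'w)).
have tm' := kinv_bot bm'; move: mm' m'w.
rewrite -{1 2}[m'](kinvK X) (kmap_lt tm tm') (kmap_lt tm' tw) => mm' m'w.
have /mmax/(_ m'w) : M (kinv X m') by apply/inv; rewrite kinvK.
by rewrite leNgt mm'.
Qed.

Lemma lnbr_exists w m0 : kopen (~` M) -> M m0 -> m0 < w -> ~ M w -> exists m, lnbr w m.
Proof.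
move=> cM Mm0 m0w nMw.
have [s [ubs lubs]] := lub_exists O [set m | M m /\ m < w].
have Ms : M s.
  apply: contrapT => /cM[a [b [pa pb /andP[az sb] abM]]].
  have lta m : M m /\ m < w -> m < a.
    move=> mS; rewrite ltNge; apply/negP => am; apply: (abM m); last by case: mS.
    by rewrite am (le_trans _ sb) //; exact: ubs.
  have a0 : a != kmin.
    by apply: contraTneq (lta m0 (conj Mm0 m0w)) => ->; rewrite -leNgt kmin_le.
  have [aa _ _ amax] := adj_plus pa a0.
  have /lubs : forall m, M m /\ m < w -> m <= adj a by move=> m /lta/amax.
  by rewrite leNgt (lt_le_trans aa az).
exists s; split=> //; last by move=> m Mm mw; exact: ubs.
rewrite lt_neqAle; apply/andP; split; first by apply: contra_notN nMw => /eqP <-.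
by apply: lubs => m [_ /ltW].
Qed.

(** A limit point off [M] would have an open component that the orbit visits twice. As all
    components on the way are regular, this component is mapped to itself by some [q]-th iterate,
    and so is its left end, a periodic point of [M]. *)
Lemma bad_om X x : infmin X M -> (forall n, ~ bad X (iter n (kmap X) x)) ->
  om X x `<=` M.
Proof.
move=> iM nbx; have [[[M0 cM inv] mM] npM] := iM.
have [Mx|nMx] := pselect (M x).
  by apply: om_sub => // n; apply/(invariant_iter _ _ inv).
have nMx' n : ~ M (iter n (kmap X) x) by rewrite invariant_iter.
have fx n : freg X (iter n (kmap X) x).
  by apply: contrapT => nf; apply: (nbx n); split=> //; constructor 2.
move=> z omz; apply: contrapT => nMz.
have znb := sim_nb cM nMz.
have [n1 _ zn1] := omz _ znb 0%N; have [n2 n12 zn2] := omz _ znb n1.+1.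
pose w := iter n1 (kmap X) x; pose q := (n2 - n1)%N.
have wq : sim w (iter q (kmap X) w).
  rewrite -iterD subnK; last exact: ltnW.
  exact: sim_trans (sim_sym zn1) zn2.
have fw n : freg X (iter n (kmap X) w) by rewrite -iterD.
have [m lm] : exists m, lnbr w m.
  have [_ [m0 [_ [Mm0 _ _ m0w _]]]] := fw 0%N.
  exact: (lnbr_exists cM Mm0 m0w (nMx' n1)).
have lmn n : lnbr (iter n (kmap X) w) (iter n (kmap X) m).
  by elim: n => //= n IH; exact: lnbr_kmap.
have [Mm mw mmax] := lm; have [Mqm qmw qmax] := lmn q.
have q0 : (0 < q)%N by rewrite subn_gt0.
apply: (npM m q Mm q0); apply/le_anti; apply/andP; split.
  by apply: mmax => //; have [-> _] := wq _ Mqm.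
by apply: qmax => //; have [<-] := wq _ Mm.
Qed.

Lemma infmin_good X : infmin X M -> exists2 U, good X U M & M `<=` U.
Proof.
move=> iM; have [[[M0 cM inv] mM] npM] := iM.
have iM' := infmin_swap iM; have inv' := invariant_swap inv.
have bswap : bad (kswap X) = bad X by apply/funext => z; apply/propext/bad_swap.
exists (~` bad X); last by move=> z Mz [].
split.
- exact: bad_clopen.
- move=> x nbx; have [Mx|nMx] := pselect (M x).
    by left=> n [+ _]; apply; apply/(invariant_iter _ _ inv).
  have [fx|/nfbadP fx] := pselect (fbad X x); last by left; exact: bad_forward.
  have [bx|/nfbadP bx] := pselect (fbad (kswap X) x).
    by case: nbx; split=> //; constructor 1.
  right=> n; have := @bad_forward (kswap X) x inv' nMx.
  by rewrite bswap => /(_ nbx bx n).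
- by move=> x nbx; exact: bad_om.
- by move=> x nbx; apply: bad_om => //; rewrite bswap.
(* [adj z] is the end of the component of [z]. Regularity places both in one top interval, and
   likewise in one bottom interval, where [kmap_adj] applies. *)
move=> _ z nbz nMz pz z0 Maz.
have fz : freg X z by apply: contrapT => nf; apply: nbz; split=> //; constructor 2.
have bz : freg (kswap X) z by apply: contrapT => nf; apply: nbz; split=> //; constructor 3.
have [_ _ _ zaz] := adj_plus pz z0.
split.
  have [c [m [m' [Mm Mm' cm mz [zm' mc']]]]] := fz.
  by apply: (@kmap_adj X c) => //; [exact/(le_trans cm)/zaz|exact: le_trans (ltW zm') mc'].
have [c [m [m' [Mm Mm' cm mz [zm' mc']]]]] := bz.
by apply: (@kmap_adj (kswap X) c) => //; [exact/(le_trans cm)/zaz|exact: le_trans (ltW zm') mc'].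
Qed.

(** The least element of [M] is a right germ: a left germ would have a neighbourhood made of smaller
    points only, and would be isolated in [M]. Only right germs give points of the line, so this
    feeds the existence of a quasiminimal. *)
Lemma infmin_plus X : infmin X M -> exists2 m, M m & plus m.
Proof.
move=> iM; have [[[[m0 Mm0] cM _] _] _] := iM.
have [s [ubs lubs]] := lub_exists O [set v | forall m, M m -> v <= m].
have sM m : M m -> s <= m by move=> Mm; apply: lubs => v; apply.
have Ms : M s.
  apply: contrapT => /cM[a [b [pa pb /andP[as_ sb] abM]]].
  have ltb m : M m -> b < m.
    move=> Mm; rewrite ltNge; apply/negP => mb; apply: (abM m) => //.
    by rewrite mb (le_trans as_) // sM.
  have bM : b != kmax.
    by apply: contraTneq (ltb m0 Mm0) => ->; rewrite -leNgt le_kmax.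
  have [bb _ _ bmin] := adj_minus pb bM.
  have /ubs : forall m, M m -> adj b <= m by move=> m /ltb/bmin.
  by rewrite leNgt (le_lt_trans sb bb).
exists s => //; apply: contrapT => /negP ms.
have [|m ms' [Mm nms]] := @infmin_nonisolated X s (fun w => w <= s) iM Ms.
  exists kmin, s; split=> //; [exact: plus_kmin|by rewrite lexx kmin_le|].
  by move=> z /andP[].
by apply/nms/le_anti; rewrite ms' sM.
Qed.

End InfiniteMinimal.

(** * The clopen decomposition *)

Section Decomposition.
Local Open Scope order_scope.
Local Open Scope classical_set_scope.
Variables (d : Order.disp_t) (K : orderType d) (O : split_order K).
Implicit Types (X : kiet O) (x y z : K) (U L : set K) (s : seq (set K * set K)).

Lemma kswapK X : kswap (kswap X) = X.
Proof. by case: X. Qed.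

Lemma good_entered X x : exists UL n,
  [/\ label X UL.2, good X UL.1 UL.2 & UL.1 (iter n (kmap X) x)].
Proof.
have [M mM Mom] := minimal_exists (closed_invariant_om X x).
have [[y0 My0] cM iM] := mM.1.
have [[y [My [p0 [p00 py]]]]|np] := pselect (exists y, M y /\
    exists p, (0 < p)%N /\ iter p (kmap X) y = y); last first.
  have iMX : infmin X M.
    by split=> // y p My p0 py; apply: np; exists y; split=> //; exists p.
  have [U gU MU] := infmin_good iMX.
  have [oU _] : kclopen O U by case: gU.
  have [n _ Un] := Mom _ My0 _ (oU _ (MU _ My0)) 0%N.
  by exists (U, M), n; split=> //; right.
have exp : exists p, (0 < p)%N && (iter p (kmap X) y == y).
  by exists p0; rewrite p00 py eqxx.
have [p /andP[p1 /eqP ppy] pmin] := ex_minnP exp.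
have Zy : Zper X p y.
  split=> // q /andP[q0 qp] qy.
  by have := pmin q; rewrite q0 qy eqxx /= leqNgt qp => /(_ isT).
have [//|V [gV Vy _ _]] := @periodic_good _ _ _ X p y setT p1 Zy; first exact: nbT.
have [oV _] : kclopen O V by case: gV.
have [n _ Vn] := Mom _ My _ (oV _ Vy) 0%N.
by exists (V, Zper X p), n; split=> //; left; exists p.
Qed.

Lemma good_cover X : exists s, (forall p, p \in s -> label X p.2 /\ good X p.1 p.2) /\
  forall x, exists2 p, p \in s & exists n, p.1 (iter n (kmap X) x).
Proof.
have /choice[f /choice[n fP]] := good_entered X.
have /compactK[l lP] : forall x, nb O x [set z | (f x).1 (iter (n x) (kmap X) z)].
  move=> x; apply: nb_iter; have [_ gx fx] := fP x.
  by have [[oU _] _ _ _ _] := gx; exact: oU.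
exists [seq f x | x <- l]; split.
  by move=> _ /mapP[x _ ->]; have [] := fP x.
move=> x; have [y yl fy] := lP x; exists (f y); first exact: map_f.
by exists (n y).
Qed.

Lemma good_bigU X L s : (forall p, p \in s -> good X p.1 L) ->
  good X [set z | exists2 p, p \in s & p.1 z] L.
Proof.
elim: s => [|p s IH] sP.
  rewrite (_ : [set _ | _] = set0); first exact: good_set0.
  by apply/seteqP; split=> z // [p].
rewrite (_ : [set _ | _] = p.1 `|` [set z | exists2 p, p \in s & p.1 z]).
  apply: good_setU; first by apply: sP; rewrite mem_head.
  by apply: IH => q qs; apply: sP; rewrite inE qs orbT.
apply/seteqP; split=> [z [q]|z [pz|[q qs qz]]].
- by rewrite inE => /predU1P[->|qs qz]; [left|right; exists q].
- by exists p; rewrite ?mem_head.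
- by exists q; rewrite // inE qs orbT.
Qed.

(** All sets with the label of the head are merged into [U], which is then removed from the others.
    Empty results are dropped, since a domain must contain a recurrent orbit; the induction is on
    the size because [rest] is not a sublist. *)
Lemma good_disjoint X s : (forall p, p \in s -> label X p.2 /\ good X p.1 p.2) ->
  exists s', [/\ forall p, p \in s' -> [/\ label X p.2, good X p.1 p.2 & p.1 !=set0],
    pairwise (fun p q => p.1 `&` q.1 == set0) s' &
    forall z, (exists2 p, p \in s & p.1 z) <-> (exists2 p, p \in s' & p.1 z)].
Proof.
have [n] := ubnP (size s); elim: n s => // n IH [|p s] sn sP.
  by exists [::].
pose L := p.2; pose same := [seq q <- p :: s | q.2 == L].
pose U := [set z | exists2 q, q \in same & q.1 z].
pose rest := [seq (q.1 `\` U, q.2) | q <- p :: s & q.2 != L].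
have gU : good X U L.
  apply: good_bigU => q; rewrite mem_filter => /andP[/eqP <- qs].
  by have [] := sP q qs.
have lL : label X L by have [] := sP p (mem_head _ _).
have [|q|s' [s'P s'd s'U]] := IH rest.
- rewrite size_map /= eqxx /=; apply: leq_ltn_trans (_ : _ <= size s)%N _ => //.
  by rewrite size_filter count_size.
- move=> /mapP[q']; rewrite mem_filter => /andP[/eqP qL /sP[lq gq]] -> /=.
  by split=> //; exact: good_setD gU.
have s'nU q z : q \in s' -> q.1 z -> ~ U z.
  move=> qs qz; have [_ /(_ (ex_intro2 _ _ q qs qz))] := s'U z.
  by move=> [q0 /mapP[q' _ ->] []].
have covers z : (exists2 q, q \in p :: s & q.1 z) <->
    (U z \/ exists2 q, q \in s' & q.1 z).
  split=> [[q qs qz]|[[q]|/s'U[q0 /mapP[q]]]].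
  - have [Uz|nUz] := pselect (U z); first by left.
    right; apply/s'U; exists (q.1 `\` U, q.2) => //; apply/mapP; exists q => //.
    rewrite mem_filter qs andbT; apply/eqP => qL; apply: nUz; exists q => //.
    by rewrite mem_filter qL eqxx.
  - by rewrite mem_filter => /andP[_ qs] qz; exists q.
  - by rewrite mem_filter => /andP[_ qs] -> [qz _]; exists q.
have [U0|/set0P U0] := eqVneq U set0.
  exists s'; split=> // z; rewrite covers; split=> [[|//]|]; last by right.
  by rewrite U0.
exists ((U, L) :: s'); split.
- by move=> q; rewrite inE => /predU1P[->|/s'P].
- rewrite /= s'd andbT; apply/allP => q qs /=; apply/eqP/seteqP; split=> // z [Uz qz].
  exact: (s'nU q z).
- move=> z; rewrite covers; split=> [[Uz|[q qs qz]]|[q]].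
  + by exists (U, L); rewrite ?mem_head.
  + by exists q; rewrite // inE qs orbT.
  + by rewrite inE => /predU1P[->|qs qz]; [left|right; exists q].
Qed.

(** Being [good] does not depend on the direction of time, so a cover for the futures and one for
    the pasts can be concatenated before being made disjoint. *)
Theorem recurrence_decomposition X : exists s,
  [/\ forall p, p \in s -> [/\ label X p.2, good X p.1 p.2 & p.1 !=set0],
    pairwise (fun p q => p.1 `&` q.1 == set0) s,
    forall x, exists n, exists2 p, p \in s & p.1 (iter n (kmap X) x) &
    forall x, exists n, exists2 p, p \in s & p.1 (iter n (kinv X) x)].
Proof.
have [s1 [s1P s1c]] := good_cover X.
have [s2 [s2P s2c]] := good_cover (kswap X).
have [p|s [sP sd sU]] := @good_disjoint X (s1 ++ s2).
  rewrite mem_cat => /orP[/s1P//|/s2P[lp gp]].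
  by rewrite -(kswapK X); split; [exact: label_swap|exact: good_swap].
exists s; split=> // x.
  have [p ps [n pn]] := s1c x; exists n; apply/sU; exists p => //.
  by rewrite mem_cat ps.
have [p ps [n pn]] := s2c x; exists n; apply/sU; exists p => //.
by rewrite mem_cat ps orbT.
Qed.

End Decomposition.

(** * Germs of the unit interval *)

Section Germs.
Variable R : realType.
Let LR : orderType _ := (R *l bool : orderType _)%type.

Definition germ_pair (x : R) (s : bool) : LR := (x, s).

Definition in_germs (z : LR) :=
  ((germ_pair 0 true <= z) && (z <= germ_pair 1 false))%O.

(* (x, true) stands for the right germ of [0, 1) at x, (x, false) for the left
   germ at x. *)
Record germ := Germ { gval : LR; gvalP : in_germs gval }.
HB.instance Definition _ := [isSub for gval].
HB.instance Definition _ := [Choice of germ by <:].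
HB.instance Definition _ :=
  [SubChoice_isSubOrder of germ by <: with Order.default_display].

Definition gx (z : germ) : R := (gval z).1.
Definition gs (z : germ) : bool := (gval z).2.

Lemma germ_eq z w : gx z = gx w -> gs z = gs w -> z = w.
Proof.
case: z w => [[x s] xs] [[y t] yt]; rewrite /gx /gs /= => xy st.
by apply: val_inj; rewrite /= xy st.
Qed.

Lemma germ_le (z w : germ) :
  (z <= w)%O = (gx z < gx w) || ((gx z == gx w) && (gs z ==> gs w)).
Proof.
case: z w => [[x s] xs] [[y t] yt]; rewrite /gx /gs /=.
rewrite leEsub /= lexi_pair.
have -> : (s <= t)%O = (s ==> t) by case: s t {xs yt} => [] [].
by have [] := ltgtP x y; rewrite ?andbF.
Qed.

Lemma in_germsE x s : in_germs (germ_pair x s) =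
  if s then 0 <= x < 1 else 0 < x <= 1.
Proof.
rewrite /in_germs /germ_pair !lexi_pair; case: s => /=.
  by rewrite implybT andbT implybF -ltNge andbC [x <= 1]le_eqVlt andbC;
    case: ltP; rewrite ?orbT ?andbT ?andbF.
by rewrite implybF -ltNge implybT andbT; case: ltgtP.
Qed.

Lemma germP z : if gs z then 0 <= gx z < 1 else 0 < gx z <= 1.
Proof. by case: z => [[x s] xs]; rewrite -in_germsE. Qed.

Lemma gx01 z : 0 <= gx z <= 1.
Proof. by have := germP z; case: gs => /andP[z0 z1]; rewrite ?z0 ?z1 ltW. Qed.

Definition mkgerm x s (h : if s then 0 <= x < 1 else 0 < x <= 1) : germ :=
  Germ (etrans (in_germsE x s) h).

Lemma germ_exists x s : (if s then 0 <= x < 1 else 0 < x <= 1) ->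
  exists z, gx z = x /\ gs z = s.
Proof. by move=> h; exists (mkgerm h). Qed.

Lemma germ_lt (z w : germ) :
  (z < w)%O = (gx z < gx w) || [&& gx z == gx w, ~~ gs z & gs w].
Proof.
rewrite ltNge germ_le negb_or -leNgt negb_and negb_imply.
have [zw|zw|zw] := ltgtP (gx z) (gx w) => //=.
by rewrite andbC.
Qed.

Lemma germ01 : 0 <= (0 : R) < 1. Proof. by rewrite lexx ltr01. Qed.
Lemma germ11 : 0 < (1 : R) <= 1. Proof. by rewrite lexx ltr01. Qed.
Definition gmin : germ := @mkgerm 0 true germ01.
Definition gmax : germ := @mkgerm 1 false germ11.

(** At [gmin] and [gmax] the other germ lies outside K and [insubd] returns [z] itself. *)
Definition gadj (z : germ) : germ := insubd z (germ_pair (gx z) (~~ gs z)).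

Lemma gadjP z : z != gmin -> z != gmax -> gx (gadj z) = gx z /\ gs (gadj z) = ~~ gs z.
Proof.
move=> zm zM; suff h : in_germs (germ_pair (gx z) (~~ gs z)).
  by rewrite /gx /gs /gadj val_insubd h.
rewrite in_germsE; have := germP z; case zs: (gs z) => /= /andP[z0 z1].
  rewrite (ltW z1) andbT lt_neqAle z0 andbT; apply: contra zm => /eqP z0E.
  by apply/eqP/germ_eq; rewrite ?zs.
rewrite (ltW z0) lt_neqAle z1 andbT; apply: contra zM => /eqP z1E.
by apply/eqP/germ_eq; rewrite ?zs.
Qed.

Lemma gs_gmin_neq z : ~~ gs z -> z != gmin.
Proof. by apply: contra => /eqP ->. Qed.

Lemma gs_gmax_neq z : gs z -> z != gmax.
Proof. by apply: contraTneq => ->. Qed.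

Lemma gmin_le z : (gmin <= z)%O.
Proof.
rewrite germ_le (_ : gx gmin = 0) // (_ : gs gmin = true) //=.
have := germP z; case: (gs z) => /andP[z0 z1].
  by rewrite andbT orbC -le_eqVlt.
by rewrite z0.
Qed.

Lemma le_gmax z : (z <= gmax)%O.
Proof.
rewrite germ_le (_ : gx gmax = 1) // (_ : gs gmax = false) //=.
have := germP z; case: (gs z) => /andP[z0 z1]; first by rewrite z1.
by rewrite andbT orbC -le_eqVlt.
Qed.

Lemma gadj_plus z : gs z -> z != gmin -> [/\ (gadj z < z)%O, ~~ gs (gadj z),
  gadj (gadj z) = z & forall w, (w < z)%O -> (w <= gadj z)%O].
Proof.
move=> zs zm; have [ax as_] := gadjP zm (gs_gmax_neq zs); rewrite zs in as_.
have am : ~~ gs (gadj z) by rewrite as_.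
split=> //; first by rewrite germ_lt ax as_ zs eqxx orbT.
  have aM : gadj z != gmax.
    have := germP z; rewrite zs => /andP[_ z1].
    by apply: contraTneq z1 => aE; rewrite -leNgt -ax aE.
  have [aax aas] := gadjP (gs_gmin_neq am) aM.
  by apply: germ_eq; rewrite ?aax // aas as_ zs.
move=> w; rewrite germ_lt germ_le ax as_ zs andbT => /orP[->//|/andP[-> /negbTE ->]].
by rewrite orbT.
Qed.

Lemma gadj_minus z : ~~ gs z -> z != gmax -> [/\ (z < gadj z)%O, gs (gadj z),
  gadj (gadj z) = z & forall w, (z < w)%O -> (gadj z <= w)%O].
Proof.
move=> zs zM; have [ax as_] := gadjP (gs_gmin_neq zs) zM; rewrite zs in as_.
have aM := gs_gmax_neq as_.
split=> //; first by rewrite germ_lt ax as_ zs eqxx orbT.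
  have am : gadj z != gmin.
    have := germP z; rewrite (negbTE zs) => /andP[z0 _].
    by apply: contraTneq z0 => aE; rewrite -leNgt -ax aE.
  have [aax aas] := gadjP am aM.
  by apply: germ_eq; rewrite ?aax // aas as_ (negbTE zs).
move=> w; rewrite germ_lt germ_le ax as_ zs => /orP[->//|/andP[-> ->]].
by rewrite orbT.
Qed.

Lemma germ_dense z w : gs z -> ~~ gs w -> (z < w)%O ->
  exists b, [/\ ~~ gs b, (z < b)%O & (b < w)%O].
Proof.
move=> zs ws; rewrite germ_lt (negbTE ws) !andbF orbF => zw.
have /andP[z0 _] := gx01 z; have /andP[_ w1] := gx01 w.
have [|b [bx bs]] := @germ_exists ((gx z + gx w) / 2) false.
  by apply/andP; split; lra.
exists b; rewrite !germ_lt bs bx; split=> //; apply/orP; left; lra.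
Qed.

(** Over the supremum [x] of the projections, the bound is the right germ if it belongs to [S], and
    the left germ otherwise. The left germ exists because [x = 0] would force [S] to contain the
    right germ at 0. *)
Lemma germ_lub (S : set germ) : exists s, (forall z, S z -> (z <= s)%O) /\
  forall u, (forall z, S z -> (z <= u)%O) -> (s <= u)%O.
Proof.
have [->|/set0P[z0 Sz0]] := eqVneq S set0.
  by exists gmin; split=> // u _; exact: gmin_le.
have supE : has_sup [set gx z | z in S].
  split; first by exists (gx z0), z0.
  by exists 1 => _ [z _ <-]; have /andP[] := gx01 z.
pose x := sup [set gx z | z in S].
have xub z : S z -> gx z <= x by move=> Sz; apply: sup_upper_bound => //; exists z.
have xlub y : (forall z, S z -> gx z <= y) -> x <= y.
  by move=> yub; apply: ge_sup; [case: supE|move=> _ [z Sz <-]; exact: yub].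
have [[s [Ss [sx ss]]]|nS] := pselect (exists s, S s /\ gx s = x /\ gs s).
  exists s; split=> [z Sz|u]; last exact.
  by rewrite germ_le ss implybT andbT sx orbC -le_eqVlt xub.
have [|s [sx ss]] := @germ_exists x false.
  have x1 : x <= 1 by apply: xlub => z _; have /andP[] := gx01 z.
  rewrite x1 andbT lt_neqAle; apply/andP; split; last first.
    by apply: le_trans (xub _ Sz0); have /andP[] := gx01 z0.
  apply/eqP => x0; apply: nS; exists z0; split=> //.
  have z00 : gx z0 = 0.
    by apply/le_anti; rewrite {1}x0 xub //; have /andP[] := gx01 z0.
  split; first by rewrite z00 x0.
  by have := germP z0; case: gs => //; rewrite z00 ltxx.
exists s; split=> [z Sz|u uS].
  have := xub z Sz; rewrite germ_le sx le_eqVlt => /predU1P[zx|->//].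
  rewrite zx eqxx ltxx /= ss; apply/implyP => zs.
  by case: nS; exists z.
rewrite germ_le sx ss /= andbT orbC -le_eqVlt; apply: xlub => z /uS.
by rewrite germ_le => /orP[/ltW//|/andP[/eqP ->]].
Qed.

Definition germ_order : split_order germ :=
  @SplitOrder _ germ gs gadj gmin gmax gmin_le le_gmax isT isT
    gadj_plus gadj_minus germ_dense germ_lub.

End Germs.

(** * Lifting a GIET to germs *)

Section RealSets.
Variable R : realType.
Implicit Types (z w : germ R) (U : set (germ R)) (x y l r : R).
Local Notation GO := (germ_order R).

(** A clopen interval is right-open when read on right germs and left-open when read on left germs:
    a g-GIET and its [left_open_map] are two halves of one map. *)
Lemma germ_itv (a b z : germ R) : gs a -> ~~ gs b -> (a <= z <= b)%O =
  if gs z then gx a <= gx z < gx b else gx a < gx z <= gx b.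
Proof.
move=> sa sb; rewrite !germ_le sa (negbTE sb) /= implybF.
by case: (gs z); rewrite /= ?andbT ?andbF ?orbF //; congr (_ && _);
  rewrite orbC -le_eqVlt.
Qed.

(* The trace on the line of a set of germs: its right germs. *)
Definition rset U : set R := [set x | exists z, [/\ gx z = x, gs z & U z]].

Lemma rset01 U x : rset U x -> 0 <= x < 1.
Proof. by move=> [z [<- sz _]]; have := germP z; rewrite sz. Qed.

Lemma rset_finite_union U : kclopen GO U -> finite_right_open_union (rset U).
Proof.
move=> [oU cU].
have /choice[p pP] : forall z, exists p : germ R * germ R,
    [/\ gs p.1, ~~ gs p.2, (p.1 <= z <= p.2)%O &
        forall w, (p.1 <= w <= p.2)%O -> U w <-> U z].
  move=> z; have [Uz|nUz] := pselect (U z).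
    by have [a [b [sa sb zab Uab]]] := oU z Uz; exists (a, b); split=> // w /Uab.
  have [a [b [sa sb zab Uab]]] := cU z nUz; exists (a, b); split=> // w /Uab Uw.
  by split.
have [z|s sP] := @compactK _ _ GO (fun z => [set w | (p z).1 <= w <= (p z).2]%O).
  by have [sa sb zab _] := pP z; exists (p z).1, (p z).2.
exists [seq (gx (p z).1, gx (p z).2) | z <- s & `[< U z >]]; split.
  move=> _ /mapP[z _ ->] /=; have [sa sb /andP[az zb] _] := pP z.
  have := le_trans az zb; rewrite germ_le sa (negbTE sb) andbF orbF.
  by [].
apply/seteqP; split=> [x [w [<- sw Uw]]|x [q /= /mapP[z]]].
  have [z zs wz] := sP w; have [sa sb _ /(_ w wz) Uwz] := pP z.
  exists (gx (p z).1, gx (p z).2).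
    apply/mapP; exists z => //; rewrite mem_filter zs andbT.
    exact/asboolP/Uwz.
  by rewrite /= in_itv /=; move: wz; rewrite /= (germ_itv _ sa sb) sw.
rewrite mem_filter => /andP[/asboolP Uz zs] -> /=; rewrite in_itv /= => /andP[ax xb].
have [sa sb _ Uab] := pP z.
have [|w [wx sw]] := @germ_exists R x true.
  have /andP[a0 _] := gx01 (p z).1; have /andP[_ b1] := gx01 (p z).2.
  by rewrite (le_trans a0 ax) (lt_le_trans xb b1).
exists w; split=> //; apply/(Uab w) => //.
by rewrite (germ_itv _ sa sb) sw wx ax xb.
Qed.

(** Neighbourhoods of the two germs at [x] together project onto a neighbourhood of [x]. *)
Lemma nb_nbhs x (P Q : set (germ R)) : 0 <= x < 1 ->
  (forall z, gx z = x -> gs z -> nb GO z P) ->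
  (forall z, gx z = x -> ~~ gs z -> nb GO z Q) ->
  \forall y \near x, forall z, gx z = y -> P z \/ Q z.
Proof.
move=> x01 xP xQ; have [z [zx sz]] := @germ_exists R x true x01.
have [a [b [sa sb zab Pab]]] := xP z zx sz.
move: zab; rewrite (germ_itv _ sa sb) sz zx => /andP[ax xb].
have [l lx lQ] : exists2 l, l < x & forall w, l < gx w -> gx w <= x ->
    ((gx w == x) ==> ~~ gs w) -> Q w.
  (* There is no left germ at 0, where the left half is void and any [l] below [x] will do. *)
  have [x0|] := ltP 0 x; last first.
    move=> x0; exists (x - 1) => [|w _ wx]; first by rewrite ltrBlDr ltrDl.
    move=> ws; have := germP w; have {}wx : gx w = 0 by have /andP[? ?] := gx01 w; lra.
    have xE0 : x = 0 by case/andP: x01 => ? ?; lra.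
    move: ws; rewrite wx xE0 eqxx /=.
    by case: (gs w) => //= _; rewrite ltxx.
  have [|z' [zx' sz']] := @germ_exists R x false; first by rewrite x0 ltW //; case/andP: x01.
  have sz'' : ~~ gs z' by rewrite sz'.
  have [a' [b' [sa' sb' zab' Qab]]] := xQ z' zx' sz''.
  move: zab'; rewrite (germ_itv _ sa' sb') sz' zx' => /andP[ax' xb'].
  exists (gx a') => // w aw wx ws; apply: Qab; rewrite (germ_itv _ sa' sb').
  move: ws; have [wxE|wxE] /= := eqVneq (gx w) x.
    by move=> /negbTE ->; rewrite aw wxE.
  have wltx : gx w < x by rewrite lt_neqAle wxE.
  by rewrite aw (ltW aw) (lt_le_trans wltx xb') (ltW (lt_le_trans wltx xb')); case: gs.
near=> y => w wy; have [xy|yx] := ltP x (gx w).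
  left; apply: Pab; rewrite (germ_itv _ sa sb).
  have wb : gx w < gx b by rewrite wy; near: y; exact: lt_nbhsl.
  by rewrite (le_lt_trans ax xy) (ltW (le_lt_trans ax xy)) wb (ltW wb); case: gs.
have [/andP[/eqP wx sw]|nw] := boolP ((gx w == x) && gs w).
  by left; apply: Pab; rewrite (germ_itv _ sa sb) sw wx ax xb.
right; apply: lQ => //; last by move: nw; rewrite negb_and implybE.
by rewrite wy; near: y; exact: lt_nbhsr.
Unshelve. all: by end_near. Qed.

Lemma nb_near z (P : set R) : nbhs (gx z) P -> nb GO z (fun w => P (gx w)).
Proof.
move=> /nbhs_ballP[e /= e0 eP].
have up : nb GO z (fun w => gx w < gx z + e).
  have [ze|ze] := ltP 1 (gx z + e).
    by apply: nbT => w; have /andP[_ w1] := gx01 w; exact: le_lt_trans ze.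
  have [|b [bx sb]] := @germ_exists R (gx z + e / 2) true.
    by have /andP[? ?] := gx01 z; lra.
  have zb : (z < b)%O by rewrite germ_lt bx; apply/orP; left; lra.
  apply: nbW (nb_lt GO zb) => w; rewrite germ_lt bx => /orP[|/andP[/eqP -> _]]; lra.
have dn : nb GO z (fun w => gx z - e < gx w).
  have [ze|ze] := ltP (gx z - e) 0.
    by apply: nbT => w; have /andP[w0 _] := gx01 w; exact: lt_le_trans w0.
  have [|b [bx sb]] := @germ_exists R (gx z - e / 2) false.
    by have /andP[? ?] := gx01 z; lra.
  have zb : (b < z)%O by rewrite germ_lt bx; apply/orP; left; lra.
  apply: nbW (nb_gt GO zb) => w; rewrite germ_lt bx => /orP[|/andP[/eqP <- _]]; lra.
apply: nbW (nbI up dn) => w [wu wd]; apply: eP.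
by rewrite /ball /= ltr_norml; apply/andP; split; lra.
Qed.

End RealSets.

Section Tiles.
Variables (R : realType) (A : finType) (l r : A -> R).
Hypothesis l_lt_r : forall a, l a < r a.
Hypothesis tile_triv : trivIset setT (fun a => `[l a, r a[%classic).
Hypothesis tile_cov : \bigcup_a `[l a, r a[%classic = `[0, 1[%classic.
Implicit Types (a b : A) (x : R) (z : germ R).

Lemma tile_sub a x : l a <= x < r a -> 0 <= x < 1.
Proof.
move=> lxr; have : `[0, 1[%classic x by rewrite -tile_cov; exists a; rewrite //= in_itv.
by rewrite /= in_itv.
Qed.

Lemma tile_uniq a b x : l a <= x < r a -> l b <= x < r b -> a = b.
Proof.
by move=> ax bx; apply: (tile_triv I I); exists x; split; rewrite /= in_itv.
Qed.

Lemma tile_l a : 0 <= l a < 1.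
Proof. by apply: (@tile_sub a); rewrite lexx l_lt_r. Qed.

Lemma tile_r a : 0 < r a <= 1.
Proof.
have /andP[l0 l1] := tile_l a; rewrite (le_lt_trans l0) //=.
rewrite leNgt; apply/negP => r1; have := @tile_sub a 1.
by rewrite (ltW l1) r1 ltxx andbF => /(_ isT).
Qed.

Definition ltile a : germ R := @mkgerm R (l a) true (tile_l a).
Definition rtile a : germ R := @mkgerm R (r a) false (tile_r a).

Lemma in_tile a z : (ltile a <= z <= rtile a)%O =
  if gs z then l a <= gx z < r a else l a < gx z <= r a.
Proof. exact: germ_itv. Qed.

(** For a left germ the tile is the one with the largest left end below it; [gx z / 2] only serves
    to show that some tile starts below. If that tile stopped before [z], the next one would start
    later and still below [z]. *)
Lemma tile_cover z : exists a, (ltile a <= z <= rtile a)%O.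
Proof.
suff [a az] : exists a, if gs z then l a <= gx z < r a else l a < gx z <= r a.
  by exists a; rewrite in_tile.
have cover x : 0 <= x < 1 -> exists a, l a <= x < r a.
  move=> x01; have : `[0, 1[%classic x by rewrite /= in_itv.
  by rewrite -tile_cov => -[a _]; rewrite /= in_itv; exists a.
have := germP z; case: (gs z) => [/cover//|/andP[z0 z1]].
have [|a0 /andP[la0 _]] := cover (gx z / 2); first by apply/andP; split; lra.
have la0z : l a0 < gx z by lra.
have [a laz amax] := @arg_maxP _ _ _ a0 (fun a => l a < gx z) l la0z.
exists a; rewrite laz leNgt; apply/negP => raz.
have /andP[ra0 ra1] := tile_r a.
have [|b /andP[lbr rab]] := cover (r a).
  by rewrite (ltW ra0) (lt_le_trans raz).
have lb : l b <= l a := amax b (le_lt_trans lbr raz).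
have lr := l_lt_r a.
have ab : a = b.
  by apply: (@tile_uniq a b (l a)); rewrite ?lexx //= lb (lt_trans lr).
by rewrite ab ltxx in rab.
Qed.

Lemma germ_tile_uniq a b z : (ltile a <= z <= rtile a)%O ->
  (ltile b <= z <= rtile b)%O -> a = b.
Proof.
rewrite !in_tile; case: (gs z); first exact: tile_uniq.
move=> /andP[laz zra] /andP[lbz zrb].
have [m [mz la lb]] : exists m, [/\ m < gx z, l a <= m & l b <= m].
  by exists (Num.max (l a) (l b)); rewrite gt_max laz lbz !le_max !lexx orbT.
by apply: (@tile_uniq a b m); rewrite ?la ?lb (lt_le_trans mz).
Qed.

End Tiles.

Section IncreasingBijection.
Variables (R : realType) (l r l' r' : R) (f : R -> R).
Hypothesis lr : l < r.
Hypothesis lr' : l' < r'.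
Hypothesis fbij : set_bij `[l, r[%classic `[l', r'[%classic f.
Hypothesis fmono : forall x y, l <= x < r -> l <= y < r -> x < y -> f x < f y.
Implicit Types x y : R.

(** The continuous extension to the right endpoint, which is the action on left germs. *)
Definition ext x := if x < r then f x else r'.

Lemma ext_open x : l <= x < r -> l' <= f x < r'.
Proof.
move=> xlr; have [+ _ _] := fbij => /(_ x).
by rewrite /= !in_itv /= xlr => /(_ isT).
Qed.

Lemma ext_img x : l <= x <= r -> l' <= ext x <= r'.
Proof.
move=> /andP[lx xr]; rewrite /ext; case: ifPn => [xr'|_].
  by have /andP[-> /ltW ->] := ext_open (introT andP (conj lx xr')).
by rewrite lexx ltW.
Qed.

Lemma ext_lt x y : l <= x -> x < y -> y <= r -> ext x < ext y.
Proof.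
move=> lx xy yr; rewrite /ext (lt_le_trans xy yr); case: ifPn => [yr'|_].
  by apply: fmono; rewrite ?lx ?(lt_trans xy yr') ?(le_trans lx (ltW xy)).
by have /andP[] := ext_open (introT andP (conj lx (lt_le_trans xy yr))).
Qed.

Lemma ext_le x y : l <= x <= r -> l <= y <= r -> (ext x <= ext y) = (x <= y).
Proof.
move=> /andP[lx xr] /andP[ly yr]; have [xy|xy|->] := ltgtP x y; last by rewrite lexx.
  by rewrite ltW // ext_lt.
by rewrite leNgt ext_lt.
Qed.

Lemma ext_inj x y : l <= x <= r -> l <= y <= r -> ext x = ext y -> x = y.
Proof.
move=> xlr ylr xy; apply/le_anti.
by rewrite -(ext_le xlr ylr) -(ext_le ylr xlr) xy lexx.
Qed.

Lemma ext_surj y : l' <= y <= r' -> exists2 x, l <= x <= r & ext x = y.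
Proof.
move=> /andP[ly yr]; have [yr'|ry] := ltP y r'; last first.
  by exists r; rewrite ?lexx ?ltW // /ext ltxx; apply/le_anti; rewrite ry yr.
have [_ _ /(_ y)] := fbij; rewrite /= in_itv /= ly yr' => /(_ isT)[x].
rewrite /= in_itv /= => /andP[lx xr] fx; exists x; rewrite ?lx ?(ltW xr) //.
by rewrite /ext xr.
Qed.

Lemma extl : ext l = l'.
Proof.
have [|x /andP[lx xr] ex] := @ext_surj l'; first by rewrite lexx ltW.
have /andP[l'l _] := ext_img (introT andP (conj (lexx l) (ltW lr))).
apply/le_anti; rewrite l'l andbT -[X in _ <= X]ex ext_le ?lx ?xr ?lexx ?ltW //.
Qed.

Lemma extr : ext r = r'. Proof. by rewrite /ext ltxx. Qed.

End IncreasingBijection.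

Section Lift.
Variables (R : realType) (r : R) (A : finType) (T : gGIET r A).
Hypothesis T_GIET : is_GIET T.
Local Notation GO := (germ_order R).
Implicit Types (z w : germ R) (a : A).

Lemma gfun_bij a :
  set_bij `[tl T a, tr T a[%classic `[bl T a, br T a[%classic (gfun T).
Proof. by have [] := gfun_diffeo T a. Qed.

Lemma gfun_mono a x y : tl T a <= x < tr T a -> tl T a <= y < tr T a ->
  x < y -> gfun T x < gfun T y.
Proof. by move=> ax ay; apply: (gfun_incr (a := a)); rewrite /top /= in_itv. Qed.

Definition text a := ext (tr T a) (br T a) (gfun T).

(** Sides are kept, and both kinds of germs in a tile move by [text]; on right germs it agrees with
    [gfun], as they never sit at a right endpoint. *)
Theorem giet_lift : exists X : kiet GO,
  (forall z, gs z -> gx (kmap X z) = gfun T (gx z)) /\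
  (forall z, ~~ gs z -> exists2 a, tl T a < gx z <= tr T a &
     gx (kmap X z) = text a (gx z)).
Proof.
have [tcov bcov] := T_GIET.
pose t0 := ltile (tl_lt_tr T) tcov; pose t1 := rtile (tl_lt_tr T) tcov.
pose b0 := ltile (bl_lt_br T) bcov; pose b1 := rtile (bl_lt_br T) bcov.
have tP a z : (t0 a <= z <= t1 a)%O =
    if gs z then tl T a <= gx z < tr T a else tl T a < gx z <= tr T a.
  exact: in_tile.
have bP a z : (b0 a <= z <= b1 a)%O =
    if gs z then bl T a <= gx z < br T a else bl T a < gx z <= br T a.
  exact: in_tile.
have weak (x y u : R) s : (if s then x <= u < y else x < u <= y) -> x <= u <= y.
  by case: s => /andP[xu uy]; rewrite ?xu ?uy ltW.
have tlr a := ltW (tl_lt_tr T a).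
have blr a := ltW (bl_lt_br T a).
have extlt a := @ext_lt R _ _ _ _ _ (gfun_bij a) (@gfun_mono a).
have extle a := @ext_le R _ _ _ _ _ (gfun_bij a) (@gfun_mono a).
have extinj a := @ext_inj R _ _ _ _ _ (gfun_bij a) (@gfun_mono a).
have img a z : (t0 a <= z <= t1 a)%O -> exists w,
    [/\ gs w = gs z, gx w = text a (gx z) & (b0 a <= w <= b1 a)%O].
  rewrite tP => az; have azw := weak _ _ _ _ az.
  suff h : if gs z then bl T a <= text a (gx z) < br T a
           else bl T a < text a (gx z) <= br T a.
    have [|w [wx ws]] := @germ_exists R (text a (gx z)) (gs z).
      move: h; have := tile_l (bl_lt_br T) bcov a; have := tile_r (bl_lt_br T) bcov a.
      by case: (gs z) => /andP[u1 u2] /andP[v1 v2] /andP[w1 w2]; apply/andP; split; lra.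
    by exists w; rewrite bP ws wx.
  have := ext_img (bl_lt_br T a) (gfun_bij a) azw.
  case: (gs z) az => /andP[az zb] /andP[u v]; rewrite ?u ?v ?andbT /=.
    rewrite -(@extr _ (tr T a) (br T a) (gfun T)); exact: extlt.
  rewrite -(extl (tl_lt_tr T a) (bl_lt_br T a) (gfun_bij a) (@gfun_mono a)).
  exact: extlt.
have preimg a w : (b0 a <= w <= b1 a)%O -> exists z,
    [/\ gs z = gs w, gx w = text a (gx z) & (t0 a <= z <= t1 a)%O].
  rewrite bP => bw; have bww := weak _ _ _ _ bw.
  have [x xlr xw] := ext_surj (tl_lt_tr T a) (gfun_bij a) bww.
  suff h : if gs w then tl T a <= x < tr T a else tl T a < x <= tr T a.
    have [|z [zx zs]] := @germ_exists R x (gs w).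
      move: h; have := tile_l (tl_lt_tr T) tcov a; have := tile_r (tl_lt_tr T) tcov a.
      by case: (gs w) => /andP[u1 u2] /andP[v1 v2] /andP[w1 w2]; apply/andP; split; lra.
    by exists z; rewrite tP zs zx /text xw.
  case/andP: xlr => xl xr; case: (gs w) bw => /andP[u v]; rewrite ?xl ?xr ?andbT /=.
    rewrite lt_neqAle xr andbT; apply: contraTneq v => xE.
    by rewrite -xw xE extr ltxx.
  rewrite lt_neqAle xl andbT eq_sym; apply: contraTneq u => xE.
  rewrite -xw xE (extl (tl_lt_tr T a) (bl_lt_br T a) (gfun_bij a) (@gfun_mono a)).
  by rewrite ltxx.
have /choice[f fP] : forall z, exists w, exists a, [/\ (t0 a <= z <= t1 a)%O,
    gs w = gs z, gx w = text a (gx z) & (b0 a <= w <= b1 a)%O].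
  move=> z; have [a az] := tile_cover (tl_lt_tr T) (@top_disjoint _ _ _ T) tcov z.
  by have [w [ws wx bw]] := img a z az; exists w, a.
have /choice[g gP] : forall w, exists z, exists a, [/\ (b0 a <= w <= b1 a)%O,
    gs z = gs w, gx w = text a (gx z) & (t0 a <= z <= t1 a)%O].
  move=> w; have [a aw] := tile_cover (bl_lt_br T) (@bot_disjoint _ _ _ T) bcov w.
  by have [z [zs zx bz]] := preimg a w aw; exists z, a.
have tuniq := germ_tile_uniq (@top_disjoint _ _ _ T).
have buniq := germ_tile_uniq (@bot_disjoint _ _ _ T).
have fE a z : (t0 a <= z <= t1 a)%O -> gx (f z) = text a (gx z) /\ (b0 a <= f z <= b1 a)%O.
  by move=> az; have [b [bz fs fx bf]] := fP z; rewrite (tuniq _ _ _ _ _ az bz).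
have gE a w : (b0 a <= w <= b1 a)%O -> gx w = text a (gx (g w)) /\ (t0 a <= g w <= t1 a)%O.
  by move=> aw; have [b [bw ws wx tw]] := gP w; rewrite (buniq _ _ _ _ _ aw bw).
have twk a z : (t0 a <= z <= t1 a)%O -> tl T a <= gx z <= tr T a.
  by rewrite tP; exact: weak.
have fs z : gs (f z) = gs z by have [a []] := fP z.
have gsE z : gs (g z) = gs z by have [a []] := gP z.
have fK : cancel f g.
  move=> z; have [a [az sz xz bz]] := fP z; have [gx_ tg] := gE _ _ bz.
  apply: germ_eq; last by rewrite gsE fs.
  by apply: (extinj a _ _ (twk _ _ tg) (twk _ _ az)); rewrite -/(text a) -gx_ -xz.
have gK : cancel g f.
  move=> w; have [a [aw sw xw tw]] := gP w; have [fx_ bf] := fE _ _ tw.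
  by apply: germ_eq; rewrite ?fs ?gsE // fx_ xw.
have fmono a z w : (t0 a <= z)%O -> (z <= w)%O -> (w <= t1 a)%O -> (f z <= f w)%O.
  move=> az zw wb.
  have tz : (t0 a <= z <= t1 a)%O by rewrite az (le_trans zw wb).
  have tw : (t0 a <= w <= t1 a)%O by rewrite wb (le_trans az zw).
  have [fz _] := fE _ _ tz; have [fw _] := fE _ _ tw.
  move: zw; rewrite !germ_le !fs fz fw => /orP[zw|/andP[/eqP -> ->]].
    by rewrite extlt //; [have /andP[] := twk _ _ tz|have /andP[] := twk _ _ tw].
  by rewrite eqxx orbT.
have gmono a z w : (b0 a <= z)%O -> (z <= w)%O -> (w <= b1 a)%O -> (g z <= g w)%O.
  move=> az zw wb.
  have bz : (b0 a <= z <= b1 a)%O by rewrite az (le_trans zw wb).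
  have bw : (b0 a <= w <= b1 a)%O by rewrite wb (le_trans az zw).
  rewrite leNgt; apply/negP => wz.
  have [_ /andP[tz _]] := gE _ _ bw; have [_ /andP[_ tw]] := gE _ _ bz.
  have := fmono a _ _ tz (ltW wz) tw; rewrite !gK => wz'.
  by move: wz; rewrite (_ : z = w) ?ltxx //; apply/le_anti; rewrite zw.
exists (@Kiet _ _ GO A t0 t1 b0 b1 f g
  (tile_cover (tl_lt_tr T) (@top_disjoint _ _ _ T) tcov)
  (tile_cover (bl_lt_br T) (@bot_disjoint _ _ _ T) bcov)
  (fun a z az => (fE a z az).2) (fun a z az => (gE a z az).2) fK gK fmono gmono
  fs gsE (fun=> isT) (fun=> isT) (fun=> isT) (fun=> isT)).
split=> z sz /=; have [a [az _ fx _]] := fP z; move: az; rewrite tP.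
  by rewrite sz => /andP[_ zr]; rewrite fx /text /ext zr.
by rewrite (negbTE sz) => az; exists a.
Qed.

End Lift.

(** * Restrictions *)

Section Smoothness.
Variable R : realType.
Implicit Types (D E : set R) (f g : R -> R) (r : R).

Lemma class_C_sub r D D' f : D' `<=` D -> class_C r D f -> class_C r D' f.
Proof.
move=> D'D [F [F0 dF cF [M HM]]]; exists F; split.
- by move=> x /D'D; exact: F0.
- move=> k kn x /D'D Dx; apply: cvg_trans (dF k kn x Dx).
  by apply: cvg_app; exact: within_subset D'D.
- exact: continuous_subspaceW D'D cF.
- by exists M => x y /D'D Dx /D'D; exact: HM.
Qed.

Lemma C_diffeo_sub r D E D' f : D' `<=` D -> C_diffeo r D E f ->
  C_diffeo r D' (f @` D') f.
Proof.
move=> D'D [[fE finj _] Cf [g gf Cg]]; split.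
- split=> [x D'x|x y|y [x D'x <-]]; [by exists x| |by exists x].
  by move=> /set_mem/D'D Dx /set_mem/D'D Dy; apply: finj; exact/mem_set.
- exact: class_C_sub Cf.
- exists g; first by move=> x /D'D; exact: gf.
  by apply: class_C_sub Cg => _ [x /D'D Dx <-]; exact: fE.
Qed.

Lemma closure_itvco (l r : R) : l < r -> closure `[l, r[%classic = `[l, r]%classic.
Proof.
move=> lr; apply/seteqP; split.
  have <- : closure `[l, r]%classic = `[l, r]%classic by apply/esym/closure_id/itv_closed.
  by apply: closure_subset => x; rewrite /= !in_itv /= => /andP[-> /ltW].
move=> x; rewrite /= in_itv /= => /andP[lx]; rewrite le_eqVlt => /predU1P[->|xr].
  move=> B /nbhs_ballP[e /= e0 eB]; exists (Num.max l (r - e / 2)); split.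
    by rewrite /= in_itv /= le_max lexx gt_max lr /=; lra.
  apply: eB; rewrite /ball /=.
  have h1 : Num.max l (r - e / 2) < r by rewrite gt_max lr /=; lra.
  have h2 : r - e / 2 <= Num.max l (r - e / 2) by rewrite le_max lexx orbT.
  by rewrite ltr_norml; apply/andP; split; lra.
by apply: subset_closure; rewrite /= in_itv /= lx.
Qed.

Lemma itvco_sub (l r l' r' : R) : l < r ->
  `[l, r[%classic `<=` `[l', r'[%classic -> l' <= l /\ r <= r'.
Proof.
move=> lr sub; split.
  have /sub : `[l, r[%classic l by rewrite /= in_itv /= lexx.
  by rewrite /= in_itv /= => /andP[].
rewrite leNgt; apply/negP => r'r.
have /sub : `[l, r[%classic (Num.max l r').
  by rewrite /= in_itv /= le_max lexx gt_max lr r'r.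
by rewrite /= in_itv /= gt_max ltxx !andbF.
Qed.

Lemma itvco_inj (l r l' r' : R) : l < r -> l' < r' ->
  `[l, r[%classic = `[l', r'[%classic -> l = l' /\ r = r'.
Proof.
move=> lr lr' E.
have [l'l rr'] : l' <= l /\ r <= r' by apply: itvco_sub => //; rewrite E.
have [ll' r'r] : l <= l' /\ r' <= r by apply: itvco_sub => //; rewrite E.
by split; apply/le_anti; rewrite ?ll' ?l'l ?rr' ?r'r.
Qed.

Lemma seq_min (s : seq R) : s != [::] ->
  exists2 m, m \in s & forall x, x \in s -> m <= x.
Proof.
elim: s => // x s IH _; have [->|/IH[m ms mmin]] := eqVneq s [::].
  by exists x; rewrite ?mem_head // => y; rewrite inE => /eqP ->.
have [xm|mx] := leP x m.
  exists x; rewrite ?mem_head // => y; rewrite inE => /predU1P[->//|/mmin].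
  exact: le_trans.
exists m; rewrite ?inE ?ms ?orbT // => y /[!inE] /predU1P[->|/mmin//].
exact: ltW.
Qed.

Lemma seq_max (s : seq R) : s != [::] ->
  exists2 m, m \in s & forall x, x \in s -> x <= m.
Proof.
move=> s0; have [|m] := @seq_min [seq - x | x <- s]; first by case: s s0.
move=> /mapP[x xs ->] xmax; exists x => // y ys.
by rewrite -lerN2; apply/xmax/map_f.
Qed.

(** The component extends from the smallest listed left end, to the largest listed right end, from
    which [C] is filled up to [x]. That its ends are in the list makes the alphabet of a restriction
    finite. *)
Lemma component_itvco (s : seq (R * R)) (C : set R) x :
  C = \bigcup_(p in [set` s]) `[p.1, p.2[%classic -> C x ->
  exists l r, [/\ l \in map fst s, r \in map snd s, l <= x < r &
    connected_component C x = `[l, r[%classic].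
Proof.
move=> CE Cx.
have inC p y : p \in s -> p.1 <= y < p.2 -> C y.
  by move=> ps py; rewrite CE; exists p; rewrite //= in_itv.
have Cin y : C y -> exists2 p, p \in s & p.1 <= y < p.2.
  by rewrite CE => -[p /= ps]; rewrite in_itv /=; exists p.
have [p0 p0s /andP[p0x xp0]] := Cin x Cx.
pose Ls := [seq l <- map fst s | `[< l <= x /\ forall y, l <= y <= x -> C y >]].
pose Rs := [seq r <- map snd s | `[< x < r /\ forall y, x <= y < r -> C y >]].
have Ls0 : p0.1 \in Ls.
  rewrite mem_filter map_f // andbT; apply/asboolP; split=> // y /andP[py yx].
  by apply: (inC p0) => //; rewrite py (le_lt_trans yx).
have Rs0 : p0.2 \in Rs.
  rewrite mem_filter map_f // andbT; apply/asboolP; split=> // y /andP[py yx].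
  by apply: (inC p0) => //; rewrite yx (le_trans p0x).
have [|l] := @seq_min Ls; first by apply: contraTneq Ls0 => ->.
rewrite mem_filter => /andP[/asboolP[lx lC] ls] lmin.
have [|r] := @seq_max Rs; first by apply: contraTneq Rs0 => ->.
rewrite mem_filter => /andP[/asboolP[xr rC] rs] rmax.
exists l, r; split=> //; first by rewrite lx xr.
apply/seteqP; split; last first.
  apply: connected_component_max; first by rewrite /= in_itv /= lx xr.
    move=> y; rewrite /= in_itv /= => /andP[ly yr].
    by have [xy|yx] := leP x y; [apply: rC; rewrite xy|apply: lC; rewrite ly ltW].
  by apply/connected_intervalP => u v uI vI z; exact: interval_is_interval uI vI z.
move=> y cy; have /connected_intervalP ci := @component_connected _ C x.
have cx : connected_component C x x by exact: connected_component_refl.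
have sub := @connected_component_sub _ C x.
rewrite /= in_itv /=; apply/andP; split; [rewrite leNgt|rewrite ltNge];
  apply/negP => hy.
  have [q qs /andP[qy yq]] := Cin y (sub _ cy).
  have : q.1 \in Ls.
    rewrite mem_filter map_f // andbT; apply/asboolP; split.
      by rewrite (le_trans qy) // (le_trans (ltW hy)).
    move=> t /andP[qt tx]; have [yt|ty] := leP y t.
      by apply: sub; apply: (ci y x cy cx); rewrite yt tx.
    by apply: (inC q) => //; rewrite qt (lt_trans ty).
  by move=> /lmin; rewrite leNgt (le_lt_trans qy hy).
have cr : connected_component C x r by apply: (ci x y cx cy); rewrite (ltW xr).
have [q qs /andP[qr rq]] := Cin r (sub _ cr).
have : q.2 \in Rs.
  rewrite mem_filter map_f // andbT; apply/asboolP; split.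
    exact: lt_trans rq.
  move=> t /andP[xt tq]; have [rt|tr] := leP r t.
    by apply: (inC q) => //; rewrite tq (le_trans qr).
  by apply: sub; apply: (ci x r cx cr); rewrite xt ltW.
by move=> /rmax; rewrite leNgt rq.
Qed.

End Smoothness.

Section Restriction.
Variables (R : realType) (r : R) (A : finType) (T : gGIET r A).

Lemma gfun_inj x y : pdom T x -> pdom T y -> gfun T x = gfun T y -> x = y.
Proof.
move=> [a _ ax] [b _ by_] xy.
have [[fa ia _] _ _] := gfun_diffeo T a; have [[fb _ _] _ _] := gfun_diffeo T b.
have ab : a = b.
  apply: (@bot_disjoint _ _ _ T _ _ I I); exists (gfun T x); split; first exact: fa.
  by rewrite xy; exact: fb.
by apply: ia; rewrite ?inE // ab.
Qed.

Lemma text_img (a : A) l u : tl T a <= l -> l < u -> u <= tr T a ->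
  [/\ bl T a <= gfun T l, gfun T l < text T a u, text T a u <= br T a,
   `[gfun T l, text T a u[%classic = gfun T @` `[l, u[%classic &
   `[gfun T l, text T a u]%classic = text T a @` `[l, u]%classic].
Proof.
move=> al lu ua.
have tb := tl_lt_tr T a; have bb := bl_lt_br T a.
have elt := @ext_lt R _ _ _ _ _ (@gfun_bij _ _ _ T a) (@gfun_mono _ _ _ T a).
have ele := @ext_le R _ _ _ _ _ (@gfun_bij _ _ _ T a) (@gfun_mono _ _ _ T a).
have exl : gfun T l = text T a l by rewrite /text /ext (lt_le_trans lu ua).
have lI : tl T a <= l <= tr T a by rewrite al (le_trans (ltW lu)).
have uI : tl T a <= u <= tr T a by rewrite ua (le_trans al (ltW lu)).
have /andP[l1 l2] := ext_img bb (@gfun_bij _ _ _ T a) lI.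
have /andP[u1 u2] := ext_img bb (@gfun_bij _ _ _ T a) uI.
have closed_img : `[gfun T l, text T a u]%classic = text T a @` `[l, u]%classic.
  apply/seteqP; split=> [y|y [x]]; rewrite /= !in_itv /= exl.
    move=> /andP[ly yu].
    have [|x xI xy] := ext_surj tb (@gfun_bij _ _ _ T a) (y := y).
      by rewrite (le_trans l1 ly) (le_trans yu u2).
    by exists x => //; rewrite in_itv /= -(ele l x) // -(ele x u) // xy ly yu.
  move=> /andP[lx xu] <-.
  have xI : tl T a <= x <= tr T a by rewrite (le_trans al lx) (le_trans xu ua).
  by rewrite /text !ele // lx xu.
split=> //; first by rewrite exl.
- by rewrite exl; exact: elt.
apply/seteqP; split=> [y|y [x]]; rewrite /= in_itv /=.
  move=> /andP[ly yu]; have : `[gfun T l, text T a u]%classic y.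
    by rewrite /= in_itv /= ly ltW.
  rewrite closed_img => -[x]; rewrite /= in_itv /= => /andP[lx xu] xy.
  have xltu : x < u.
    by rewrite lt_neqAle xu andbT; apply: contraTneq yu => <-; rewrite -xy ltxx.
  exists x; first by rewrite in_itv /= lx.
  by rewrite -xy /text /ext (lt_le_trans xltu ua).
move=> /andP[lx xu] <-; rewrite in_itv /=.
have -> : gfun T x = text T a x by rewrite /text /ext (lt_le_trans xu ua).
have xI : tl T a <= x <= tr T a by rewrite (le_trans al lx) (le_trans (ltW xu) ua).
by rewrite exl ele // lx /=; apply: elt; rewrite // (le_trans al lx).
Qed.

(** At the right endpoint injectivity decides: every value other than [br T a] is already taken
    inside the interval. *)
Lemma extension_text (a : A) (g : R -> R) : (forall x, top T a x -> g x = gfun T x) ->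
  C_diffeo r (closure (top T a)) (closure (bot T a)) g ->
  forall x, tl T a <= x <= tr T a -> g x = text T a x.
Proof.
rewrite /top /bot !closure_itvco ?tl_lt_tr ?bl_lt_br // => gT [[gE ginj _] _ _] x.
move=> /andP[ax]; rewrite le_eqVlt => /predU1P[->|xa]; last first.
  by rewrite gT /text /ext ?xa // /= in_itv /= ax xa.
have tb := tl_lt_tr T a; have bb := bl_lt_br T a.
have trI : `[tl T a, tr T a]%classic (tr T a) by rewrite /= in_itv /= lexx ltW.
rewrite /text extr; have := gE _ trI; rewrite /= in_itv /= => /andP[b1].
rewrite le_eqVlt => /predU1P[//|b2].
have [_ _ /(_ (g (tr T a)))[]] := @gfun_bij _ _ _ T a.
  by rewrite /= in_itv /= b1 b2.
move=> y yI /esym; rewrite -gT // => /ginj tE.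
have {}yI : tl T a <= y < tr T a by move: yI; rewrite /= in_itv.
have : tr T a = y.
  by apply: tE; rewrite inE //= in_itv /=; case/andP: yI => -> /ltW ->.
by case/andP: yI => _ + yE; rewrite -yE ltxx.
Qed.

(** The last conclusion is for left germs: a point approached by [J] from the left may be a right
    endpoint of the restriction, and it must move there as it does under [T]. *)
Theorem restriction_exists (J : set R) : J `<=` pdom T -> finite_right_open_union J ->
  exists (B : finType) (S : gGIET r B), [/\ is_restriction T J S, gfun S = gfun T,
    pdom S = J, pcod S = gfun T @` J &
    forall a x, tl T a < x <= tr T a ->
      (exists2 y, y < x & `[y, x[%classic `<=` J) ->
      exists2 b, tl S b < x <= tr S b & text S b x = text T a x].
Proof.
move=> JT [s [s_lt JE]].
pose sa a := [seq q <- [seq (Num.max p.1 (tl T a), Num.min p.2 (tr T a)) | p <- s] |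
   q.1 < q.2].
have JaE a : J `&` top T a = \bigcup_(p in [set` sa a]) `[p.1, p.2[%classic.
  rewrite JE; apply/seteqP; split=> [x [[p /= ps]]|x [q /=]].
    rewrite /top /= !in_itv /= => /andP[px xp] /andP[ax xa].
    have xI : Num.max p.1 (tl T a) <= x < Num.min p.2 (tr T a).
      by rewrite ge_max lt_min px ax xp xa.
    exists (Num.max p.1 (tl T a), Num.min p.2 (tr T a)); last by rewrite /= in_itv.
    rewrite /= mem_filter /=; case/andP: xI => xI1 xI2.
    by rewrite (le_lt_trans xI1 xI2); apply/mapP; exists p.
  rewrite mem_filter => /andP[_ /mapP[p ps ->]] /=; rewrite in_itv /= ge_max lt_min.
  move=> /andP[/andP[px ax] /andP[xp xa]]; split; last by rewrite /top /= in_itv /= ax.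
  by exists p; rewrite //= in_itv /= px.
pose isc (q : R * R) := exists a x, (J `&` top T a) x /\
  connected_component (J `&` top T a) x = `[q.1, q.2[%classic.
(* A finite list of candidate intervals; [B] keeps those that are components. *)
pose L := flatten [seq [seq (l, u) | l <- map fst (sa a), u <- map snd (sa a)] | a <- enum A].
pose B : finType := seq_sub [seq q <- L | `[< isc q >]].
have Bc (b : B) : isc (ssval b).
  by have := ssvalP b; rewrite mem_filter => /andP[/asboolP].
have inB a x : (J `&` top T a) x -> exists b : B,
    `[(ssval b).1, (ssval b).2[%classic = connected_component (J `&` top T a) x.
  move=> Jax; have [l [u [ls us _ cE]]] := component_itvco (JaE a) Jax.
  have luB : (l, u) \in [seq q <- L | `[< isc q >]].
    rewrite mem_filter; apply/andP; split; first by apply/asboolP; exists a, x.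
    apply/flattenP; exists [seq (l, u) | l <- map fst (sa a), u <- map snd (sa a)].
      by apply/mapP; exists a; rewrite ?mem_enum.
    by apply/allpairsP; exists (l, u).
  by exists (SeqSub luB).
have /choice[al alP] : forall b : B, exists a, exists x, (J `&` top T a) x /\
  connected_component (J `&` top T a) x = `[(ssval b).1, (ssval b).2[%classic.
  by move=> b; exact: Bc.
pose l (b : B) := (ssval b).1; pose u (b : B) := (ssval b).2.
have lsub b : `[l b, u b[%classic `<=` J `&` top T (al b).
  by have [x [_ <-]] := alP b; exact: connected_component_sub.
have lu b : l b < u b.
  have [x [Jx cE]] := alP b; have := connected_component_refl Jx.
  by rewrite cE /= in_itv /= => /andP[h1 h2]; exact: le_lt_trans h2.
have al_l b : tl T (al b) <= l b.
  have /lsub[_] : `[l b, u b[%classic (l b) by rewrite /= in_itv /= lexx lu.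
  by rewrite /top /= in_itv /= => /andP[].
have al_u b : u b <= tr T (al b).
  rewrite leNgt; apply/negP => tu.
  have /lsub[_] : `[l b, u b[%classic (Num.max (l b) (tr T (al b))).
    by rewrite /= in_itv /= le_max lexx gt_max lu tu.
  by rewrite /top /= in_itv /= gt_max ltxx !andbF.
have img b := text_img (al_l b) (lu b) (al_u b).
pose bl' b := gfun T (l b); pose br' b := text T (al b) (u b).
have bl_br b : bl' b < br' b by have [] := img b.
have botE b : `[bl' b, br' b[%classic = gfun T @` `[l b, u b[%classic by have [] := img b.
have cbotE b : `[bl' b, br' b]%classic = text T (al b) @` `[l b, u b]%classic.
  by have [] := img b.
have sub_top b : `[l b, u b[%classic `<=` top T (al b) by move=> x /lsub[].
have sub01 b : `[l b, u b[%classic `<=` `[0, 1[%classic.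
  by apply: subset_trans (@sub_top b) _; exact: top_sub01.
have bsub01 b : `[bl' b, br' b[%classic `<=` `[0, 1[%classic.
  rewrite botE => _ [x /sub_top ax <-]; apply: (@bot_sub01 _ _ _ T (al b)).
  by have [[fa _ _] _ _] := gfun_diffeo T (al b); exact: fa.
have ldisj : trivIset setT (fun b => `[l b, u b[%classic).
  move=> b b' _ _ [y [yb yb']].
  have aE : al b = al b'.
    by apply: (@top_disjoint _ _ _ T _ _ I I); exists y;
      split; [exact: sub_top yb|exact: sub_top yb'].
  have [x [_ cx]] := alP b; have [x' [_ cx']] := alP b'.
  have yc : connected_component (J `&` top T (al b)) x y by rewrite cx.
  have yc' : connected_component (J `&` top T (al b)) x' y by rewrite aE cx'.
  have E : `[l b, u b[%classic = `[l b', u b'[%classic.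
    rewrite -cx -cx' -aE (same_connected_component yc).
    by rewrite (same_connected_component yc').
  have [lE uE] := itvco_inj (lu b) (lu b') E.
  by apply: val_inj; rewrite /= [LHS]surjective_pairing [RHS]surjective_pairing; congr (_, _).
have bdisj : trivIset setT (fun b => `[bl' b, br' b[%classic).
  move=> b b' _ _ [y []]; rewrite !botE => -[x xb xy] [x' xb' xy'].
  apply: (ldisj _ _ I I); exists x; split=> //.
  rewrite (@gfun_inj x x') ?xy ?xy' //; first by exists (al b); rewrite //; exact: sub_top xb.
  by exists (al b') => //; exact: sub_top xb'.
have diffeo b : C_diffeo r `[l b, u b[%classic `[bl' b, br' b[%classic (gfun T).
  by rewrite botE; apply: C_diffeo_sub (@sub_top b) (gfun_diffeo T (al b)).
have incr b x y : `[l b, u b[%classic x -> `[l b, u b[%classic y -> x < y ->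
    gfun T x < gfun T y.
  by move=> /sub_top ax /sub_top ay; exact: gfun_incr ax ay.
have extends b : exists g : R -> R, (forall x, `[l b, u b[%classic x -> g x = gfun T x) /\
    C_diffeo r (closure `[l b, u b[%classic) (closure `[bl' b, br' b[%classic) g.
  have [g [gT gC]] := gfun_extends T (al b); exists g; split.
    by move=> x /sub_top; exact: gT.
  have gtext := extension_text gT gC.
  have gE : `[bl' b, br' b]%classic = g @` `[l b, u b]%classic.
    rewrite cbotE; apply/seteqP; split=> [_ [x xI <-]|_ [x xI <-]]; exists x => //.
      rewrite gtext //; move: xI; rewrite /= in_itv /= => /andP[lx xu].
      by rewrite (le_trans (al_l b)) // (le_trans xu).
    rewrite gtext //; move: xI; rewrite /= in_itv /= => /andP[lx xu].
    by rewrite (le_trans (al_l b)) // (le_trans xu).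
  rewrite !closure_itvco // gE; apply: C_diffeo_sub gC.
  rewrite closure_itvco ?tl_lt_tr // => x; rewrite /= !in_itv /= => /andP[lx xu].
  by rewrite (le_trans (al_l b)) // (le_trans xu).
pose S : gGIET r B := GGIET lu bl_br sub01 bsub01 ldisj bdisj diffeo incr extends.
have topU : \bigcup_b top S b = J.
  apply/seteqP; split=> [x [b _ /lsub[]]//|x Jx].
  have [a _ ax] := JT x Jx; have [b bE] := inB a x (conj Jx ax).
  exists b => //.
  have -> : top S b = connected_component (J `&` top T a) x := bE.
  exact: connected_component_refl.
have botU : \bigcup_b bot S b = gfun T @` J.
  have bE b : bot S b = gfun T @` top S b := botE b.
  rewrite -topU; apply/seteqP; split=> [y [b _]|_ [x [b _ bx] <-]].
    by rewrite bE => -[x bx <-]; exists x => //; exists b.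
  by exists b => //; rewrite bE; exists x.
exists B, S; split=> //.
  split=> //; first by split=> //; exists s.
  apply/seteqP; split=> [_ [b _ <-]|C [a [x Jx ->]]].
    by have [x [Jx cE]] := alP b; exists (al b), x.
  by have [b bE] := inB a x Jx; exists b.
move=> a x /andP[ax xa] [y yx yJ].
(* Close enough to [x] for [[z, x)] to lie in [J] and in the top interval of [a]; the midpoint is
   strictly between [y] and [x]. *)
pose z := Num.max y (Num.max (tl T a) ((x + y) / 2)).
have [yz az zx] : [/\ y <= z, tl T a <= z & z < x].
  split; rewrite ?le_max ?lexx ?orbT // gt_max yx gt_max ax /=; lra.
have Jz t : z <= t -> t < x -> (J `&` top T a) t.
  move=> zt tx; split; first by apply: yJ; rewrite /= in_itv /= (le_trans yz zt).
  by rewrite /top /= in_itv /= (le_trans az zt) (lt_le_trans tx).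
have [b bE] := inB a z (Jz z (lexx z) zx).
have zxb : `[z, x[%classic `<=` `[l b, u b[%classic.
  have -> : `[l b, u b[%classic = connected_component (J `&` top T a) z := bE.
  apply: connected_component_max.
  - by rewrite /= in_itv /= lexx.
  - by move=> t; rewrite /= in_itv /= => /andP[]; exact: Jz.
  - by apply/connected_intervalP => v w vI wI t; exact: interval_is_interval vI wI t.
have lbz : l b <= z.
  have /zxb : `[z, x[%classic z by rewrite /= in_itv /= lexx.
  by rewrite /= in_itv /= => /andP[].
have xub : x <= u b.
  rewrite leNgt; apply/negP => ux.
  have /zxb : `[z, x[%classic (Num.max z (u b)).
    by rewrite /= in_itv /= le_max lexx gt_max zx ux.
  by rewrite /= in_itv /= gt_max ltxx !andbF.
have aE : al b = a.
  apply: (@top_disjoint _ _ _ T _ _ I I); exists z; split; last by have [] := Jz z (lexx z) zx.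
  by apply: (@sub_top b); rewrite /= in_itv /= lbz (lt_le_trans zx).
exists b; first by rewrite /= (le_lt_trans lbz zx).
rewrite /text /ext /= /br' aE; case: ifPn => [xu|].
  by rewrite -aE (lt_le_trans xu (al_u b)).
rewrite -leNgt => ux; have xE : x = u b by apply/le_anti; rewrite xub ux.
by rewrite /text /ext -xE.
Qed.

End Restriction.

(** * Orbits on the line and orbits of germs *)

Section Tracking.
Variables (R : realType) (X : kiet (germ_order R)).
Implicit Types (z w : germ R) (U : set (germ R)) (x y : R) (E : set R).
Local Notation GO := (germ_order R).
Local Notation T := (kmap X).
Local Notation T' := (kinv X).

Lemma gs_iter n z : gs (iter n T z) = gs z.
Proof. exact: (kmap_iter_plus X n z). Qed.

Lemma gs_iter_inv n z : gs (iter n T' z) = gs z.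
Proof. exact: (kmap_iter_plus (kswap X) n z). Qed.

(** The germ [w] may be on either side. If neither germ at [gx z] were a limit, the orbit would
    avoid neighbourhoods of both from some time [N] on, hence a neighbourhood of [gx z] on the line
    by [nb_nbhs]. *)
Lemma limit_om z E : (forall y, E y -> exists n, y = gx (iter n T z)) ->
  0 <= gx z < 1 -> limit_point E (gx z) -> exists2 w, gx w = gx z & om X z w.
Proof.
move=> EP z01 Elim; apply: contrapT => /forall2NP nw.
pose Q N := [set v : germ R | forall n, (N <= n)%N -> iter n T z <> v].
have QP w : gx w = gx z -> exists N, nb GO w (Q N).
  move=> wz; have [//|/existsNP[P /not_implyP[wP /existsNP[N nN]]]] := nw w.
  exists N; apply: nbW wP => v Pv n Nn zv; apply: nN; exists n => //.
  by rewrite zv.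
have QW N N' v : (N <= N')%N -> Q N v -> Q N' v.
  by move=> NN' Qv n N'n; apply: Qv; exact: leq_trans N'n.
have [N NP] : exists N, forall w, gx w = gx z -> nb GO w (Q N).
  have side s : exists N, forall w, gx w = gx z -> gs w = s -> nb GO w (Q N).
    have [[w [wz ws]]|nws] := pselect (exists w, gx w = gx z /\ gs w = s); last first.
      by exists 0%N => w wz ws; case: nws; exists w.
    have [N NQ] := QP w wz; exists N => v vz vs.
    by rewrite (_ : v = w) //; apply: germ_eq; rewrite ?wz ?ws.
  have [N1 N1P] := side true; have [N2 N2P] := side false.
  exists (maxn N1 N2) => w wz; case sw: (gs w).
    by apply: nbW (N1P w wz sw) => v; apply: QW; exact: leq_maxl.
  by apply: nbW (N2P w wz sw) => v; apply: QW; exact: leq_maxr.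
have near1 := nb_nbhs z01 (fun w wz _ => NP w wz) (fun w wz _ => NP w wz).
(* The finitely many earlier iterates are kept away one by one, except those that project exactly to
   [gx z], which do not count for [limit_point]. *)
have near2' (n : 'I_N) : \forall y \near gx z,
    gx (iter n T z) != gx z -> gx (iter n T z) != y.
  have [->|nz] := eqVneq (gx (iter n T z)) (gx z); first by near=> y.
  move: nz; rewrite neq_lt => /orP[nz|nz].
    near=> y => _; rewrite lt_eqF //; near: y; exact: lt_nbhsr.
  by near=> y => _; rewrite gt_eqF //; near: y; exact: lt_nbhsl.
have near2 := @filter_forall _ _ _ _ (nbhs_filter (gx z)) near2'.
have [y [yz /EP[n yE] [/= yQ yN]]] := Elim _ (filterI near1 near2).
have nN : (n < N)%N.
  rewrite ltnNge; apply/negP => Nn.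
  by have [/(_ n Nn)|/(_ n Nn)] := yQ (iter n T z) (esym yE).
have := yN (Ordinal nN); rewrite /= -yE => /(_ yz); by rewrite eqxx.
Unshelve. all: by end_near. Qed.

Lemma om_limit z E : om X z z -> (forall p, (0 < p)%N -> iter p T z <> z) ->
  (forall n, E (gx (iter n T z))) -> limit_point E (gx z).
Proof.
move=> omz np Ez V /nb_near/omz/(_ 1%N)[n n1 Vn].
exists (gx (iter n T z)); split=> //.
by apply/eqP => nz; apply: (np n n1); apply: germ_eq; rewrite ?gs_iter.
Qed.

(* The side s = false serves for left_open_map, whose periodic orbits are the
   orbits at right endpoints. *)
Definition tracks (F : partial_map R) (s : bool) U :=
  [/\ forall x, pdom F x -> exists w, [/\ gs w = s, gx w = x & U w],
      forall w, gs w = s -> U w -> pdom F (gx w) /\ F (gx w) = gx (T w) &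
      pcod F = pfun F @` pdom F].

Section Orbits.
Variables (F : partial_map R) (s : bool) (U : set (germ R)).
Hypothesis FU : tracks F s U.

Lemma tracks_dom z : gs z = s -> pdom F (gx z) <-> U z.
Proof.
have [F1 F2 _] := FU; move=> sz; split=> [/F1[w [sw wz Uw]]|/(F2 _ sz)[]//].
by rewrite (_ : z = w) //; apply: germ_eq; rewrite ?sz ?sw ?wz.
Qed.

Lemma tracks_cod z : gs z = s -> pcod F (gx z) <-> U (T' z).
Proof.
have [F1 F2 ->] := FU; move=> sz; split=> [[x /F1[w [sw <- Uw]]]|Uz].
  have [_ ->] := F2 w sw Uw => wz.
  rewrite (_ : z = T w) ?kmapK //; apply: germ_eq; rewrite ?wz //.
  by rewrite sz -sw; exact/esym/(kmap_plus X).
have sTz : gs (T' z) = s by rewrite -sz; exact: (kinv_plus X).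
have [Fz FzE] := F2 _ sTz Uz.
by exists (gx (T' z)) => //; rewrite FzE kinvK.
Qed.

Lemma tracks_iter n z : gs z = s ->
  (forall m, (m < n)%N -> pdom F (iter m F (gx z))) <->
  (forall m, (m < n)%N -> U (iter m T z)).
Proof.
have [F1 F2 _] := FU => sz.
have iterE k : (forall m, (m < k)%N -> U (iter m T z)) -> iter k F (gx z) = gx (iter k T z).
  elim: k => //= k IH Uz; rewrite IH; last by move=> m mk; apply: Uz; exact: ltnW.
  by have [] := F2 (iter k T z); rewrite ?gs_iter //; apply: Uz.
split=> Hz.
  elim: n Hz => [|n IH] Hz m //; rewrite ltnS leq_eqVlt => /predU1P[->|]; last first.
    by apply: IH => k kn; apply: Hz; exact: ltnW.
  have := Hz n (ltnSn n); rewrite iterE ?tracks_dom ?gs_iter //.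
  by apply: IH => k kn; apply: Hz; exact: ltnW.
move=> m mn; rewrite iterE; last by move=> k km; apply: Hz; exact: ltn_trans mn.
by apply/tracks_dom; rewrite ?gs_iter //; exact: Hz.
Qed.

Lemma iter_gx n z : gs z = s -> (forall m, (m < n)%N -> U (iter m T z)) ->
  iter n F (gx z) = gx (iter n T z).
Proof.
have [_ F2 _] := FU => sz; elim: n => //= n IH Uz.
rewrite IH; last by move=> m mk; apply: Uz; exact: ltnW.
by have [] := F2 (iter n T z); rewrite ?gs_iter //; apply: Uz.
Qed.

Lemma fwd_orbitP z y : gs z = s -> fwd_orbit F (gx z) y <->
  exists2 n, forall m, (m < n)%N -> U (iter m T z) & y = gx (iter n T z).
Proof.
move=> sz; split=> [[n [/tracks_iter Uz <-]]|[n Uz ->]]; exists n.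
- by apply: Uz.
- by rewrite iter_gx //; exact: Uz.
- by split; [exact/tracks_iter|exact: iter_gx].
Qed.

(** The shift in [m.+1] reflects that the preimages of [z], and not [z] itself, must be in the
    domain. *)
Lemma bwd_orbitP z y : gs z = s -> bwd_orbit F (gx z) y <->
  exists2 n, forall m, (m < n)%N -> U (iter m.+1 T' z) & y = gx (iter n T' z).
Proof.
have [F1 F2 _] := FU => sz; split=> [[n [dy yz]]|[n Uz ->]]; exists n.
- have [w [sw wy Uw]] : exists w, [/\ gs w = s, gx w = y & forall m, (m < n)%N -> U (iter m T w)].
    case: n dy yz => [|n] dy yz; first by exists z; rewrite sz -yz.
    have [w [sw wy _]] := F1 y (dy 0%N isT).
    by exists w; split=> //; apply/tracks_iter => //; rewrite wy.
  have zw : z = iter n T w.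
    by apply: germ_eq; rewrite ?gs_iter ?sz ?sw // -yz -wy iter_gx.
  by move=> m mn; rewrite zw iter_kinv_kmap //; apply: Uw; rewrite ltn_subrL (leq_ltn_trans _ mn).
- have [w [sw wy Uw]] : exists w, [/\ gs w = s, gx w = y & forall m, (m < n)%N -> U (iter m T w)].
    case: n dy yz => [|n] dy yz; first by exists z; rewrite sz -yz.
    have [w [sw wy _]] := F1 y (dy 0%N isT).
    by exists w; split=> //; apply/tracks_iter => //; rewrite wy.
  have -> : z = iter n T w.
    by apply: germ_eq; rewrite ?gs_iter ?sz ?sw // -yz -wy iter_gx.
  by rewrite kmap_iterK.
have sw : gs (iter n T' z) = s by rewrite gs_iter_inv.
have Uw m : (m < n)%N -> U (iter m T (iter n T' z)).
  move=> mn; have -> : iter m T (iter n T' z) = iter (n - m) T' z.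
    exact: (@iter_kinv_kmap _ _ _ (kswap X) m n z (ltnW mn)).
  have -> : (n - m = (n - m).-1.+1)%N by rewrite prednK // subn_gt0.
  by apply: Uz; rewrite prednK ?subn_gt0 // leq_subr.
by split; [exact/tracks_iter|rewrite iter_gx // kinv_iterK].
Qed.

Lemma regular_orbitP z : gs z = s -> regular_orbit F (gx z) <->
  (forall n, U (iter n T z)) /\ (forall n, U (iter n T' z)).
Proof.
move=> sz; split=> [[dz oz]|[Uz U'z]].
  have Uz n : U (iter n T z).
    elim/ltn_ind: n => n IH; apply/tracks_dom; first by rewrite gs_iter.
    by have [|//] := oz (gx (iter n T z)); left; apply/fwd_orbitP => //; exists n.
  split=> // n; elim/ltn_ind: n => -[|n] IH; first exact: (Uz 0%N).
  apply/tracks_cod; first by rewrite gs_iter_inv.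
  have [|//] := oz (gx (iter n T' z)); right; apply/bwd_orbitP => //; exists n => // m mn.
  by apply: IH; rewrite ltnS.
split; first by apply/tracks_dom => //; exact: (Uz 0%N).
move=> y [/fwd_orbitP|/bwd_orbitP] => /(_ sz)[n _ ->]; split.
- by apply/tracks_dom; rewrite ?gs_iter.
- apply/tracks_cod; rewrite ?gs_iter //; case: n => [|n]; first exact: (U'z 1%N).
  by rewrite iterS kmapK.
- by apply/tracks_dom; rewrite ?gs_iter_inv.
- by apply/tracks_cod; rewrite ?gs_iter_inv //; exact: (U'z n.+1).
Qed.

Lemma full_orbit_fwd n z : gs z = s -> (forall n, U (iter n T z)) ->
  full_orbit F (gx z) (gx (iter n T z)).
Proof. by move=> sz Uz; left; apply/fwd_orbitP => //; exists n. Qed.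

Lemma full_orbit_germ z y : gs z = s -> full_orbit F (gx z) y ->
  exists n, y = gx (iter n T z) \/ y = gx (iter n T' z).
Proof.
move=> sz [/fwd_orbitP|/bwd_orbitP] => /(_ sz)[n _ ->]; exists n; by [left|right].
Qed.

Lemma fixed_full_orbit p z : gs z = s -> (0 < p)%N -> iter p T z = z ->
  (forall n, U (iter n T z)) -> full_orbit F (gx z) = (fun n => gx (iter n T z)) @` `I_p.
Proof.
move=> sz p0 pz Uz.
have kz k : iter (k * p) T z = z by elim: k => // k IH; rewrite mulSn iterD IH.
apply/seteqP; split=> [y /(full_orbit_germ sz)[n yE]|_ [n np <-]]; last first.
  exact: full_orbit_fwd.
have {yE}[m ->] : exists m, y = gx (iter m T z).
  case: yE => ->; first by exists n.
  (* On a cycle of length [p], going back [n] steps is going forward [n * p - n] steps. *)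
  exists (n * p - n)%N; rewrite -iter_kinv_kmap; last by rewrite leq_pmulr.
  by rewrite kz.
exists (m %% p)%N; first by rewrite /= ltn_mod.
by rewrite {2}(divn_eq m p) addnC iterD kz.
Qed.

Lemma finite_orbit_fixed z : gs z = s -> (forall n, U (iter n T z)) ->
  finite_set (full_orbit F (gx z)) -> exists2 p, (0 < p)%N & iter p T z = z.
Proof.
move=> sz Uz fin; apply: contrapT => /forall2NP np.
apply: infinite_nat; pose f n := gx (iter n T z).
have finj : injective f.
  move=> m n; wlog mn : m n / (m <= n)%N => [hw fmn|].
    by have [/hw|/ltnW/hw/(_ (esym fmn))] := leqP m n; [apply|].
  move=> fmn; apply/eqP; rewrite eqn_leq mn /= -subn_eq0 -leqn0 leqNgt; apply/negP => nm.
  have [/negP|] := np (n - m)%N; first by rewrite nm.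
  apply; apply: (can_inj (kmap_iterK X m)); rewrite -iterD subnKC //.
  by apply: germ_eq; rewrite ?gs_iter.
have : (f @` setT #= [set: nat])%card by apply: inj_card_eq => m n _ _; exact: finj.
move=> /eq_finite_set <-; apply: sub_finite_set fin => _ [n _ <-].
exact: full_orbit_fwd.
Qed.

Lemma fixed_periodic p z : gs z = s -> (0 < p)%N -> iter p T z = z ->
  (forall n, U (iter n T z)) -> Defs.periodic F (gx z).
Proof.
move=> sz p0 pz Uz; split; last first.
  by rewrite (fixed_full_orbit sz p0 pz Uz); exact/finite_image/finite_II.
apply/regular_orbitP => //; split=> // n.
have kz k : iter (k * p) T z = z by elim: k => // k IH; rewrite mulSn iterD IH.
by rewrite -(kz n) iter_kinv_kmap // leq_pmulr.
Qed.

Lemma Zper_period p z : gs z = s -> (0 < p)%N -> Zper X p z ->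
  (forall n, U (iter n T z)) -> periodic_of_period F p (gx z).
Proof.
move=> sz p0 [pz npz] Uz; split; first exact: fixed_periodic pz Uz.
rewrite (fixed_full_orbit sz p0 pz Uz); apply: inj_card_eq => m n; rewrite !inE /=.
wlog mn : m n / (m <= n)%N => [hw mp np fmn|].
  by have [/hw|/ltnW/hw/(_ np mp (esym fmn))] := leqP m n; [apply|].
move=> mp np fmn; apply/eqP; rewrite eqn_leq mn /= -subn_eq0 -leqn0 leqNgt; apply/negP => nm.
apply: (npz (n - m)%N); first by rewrite nm (leq_ltn_trans (leq_subr _ _)).
apply: (can_inj (kmap_iterK X m)); rewrite -iterD subnKC //.
by apply: germ_eq; rewrite ?gs_iter.
Qed.

End Orbits.

Lemma first_exit (P : nat -> Prop) : (exists n, ~ P n) ->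
  exists n, ~ P n /\ forall m, (m < n)%N -> P m.
Proof.
move=> [n0 nP]; have exn : exists n, `[< ~ P n >] by exists n0; apply/asboolP.
have [n /asboolP nPn nmin] := ex_minnP exn; exists n; split=> // m mn.
by apply: contrapT => /asboolP/nmin; rewrite leqNgt mn.
Qed.

Section RightGerms.
Variables (F : partial_map R) (U : set (germ R)).
Hypothesis FU : tracks F true U.

Lemma transient_exits z : gs z -> transient F (gx z) ->
  (exists n, ~ U (iter n T z)) /\ (exists n, ~ U (iter n T' z)).
Proof.
move=> sz [_ _ [y fy [_ ny]] [y' by' [_ ny']]]; split.
  have [n _ yE] := (fwd_orbitP FU y sz).1 fy; exists n.
  by apply: contra_not ny; rewrite yE => /(tracks_dom FU); apply; rewrite gs_iter.
have [n _ yE] := (bwd_orbitP FU y' sz).1 by'; exists n.+1.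
apply: contra_not ny'; rewrite yE => Un.
by apply/(tracks_cod FU) => //; rewrite gs_iter_inv.
Qed.

Lemma exits_transient z : gs z -> U z -> (exists n, ~ U (iter n T z)) ->
  (exists n, ~ U (iter n T' z)) -> transient F (gx z).
Proof.
move=> sz Uz /first_exit[n [nUn Un]] /first_exit[[|m] [nUm Um]];
  first by case: nUm.
have gx01' w : gs w -> `[0, 1[%classic (gx w).
  by move=> sw; rewrite /= in_itv /=; have := germP w; rewrite sw.
split.
- exact/(tracks_dom FU).
- apply: (@sub_finite_set _ _ ((fun k => gx (iter k T z)) @` `I_n.+1 `|`
    (fun k => gx (iter k T' z)) @` `I_m.+1)); last first.
    by rewrite finite_setU; split; exact/finite_image/finite_II.
  move=> y [/(fwd_orbitP FU y sz)|/(bwd_orbitP FU y sz)][k Uk ->]; [left|right];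
    exists k => //=; rewrite ltnS leqNgt; apply/negP => nk.
    exact/nUn/Uk.
  exact/nUm/Uk.
- exists (gx (iter n T z)); first by apply/(fwd_orbitP FU) => //; exists n.
  split; first by apply: gx01'; rewrite gs_iter.
  by move/(tracks_dom FU); apply: contra_not nUn; apply; rewrite gs_iter.
exists (gx (iter m T' z)).
  by apply/(bwd_orbitP FU) => //; exists m => // k km; exact: Um.
split; first by apply: gx01'; rewrite gs_iter_inv.
by move/(tracks_cod FU); apply: contra_not nUm; apply; rewrite gs_iter_inv.
Qed.

End RightGerms.
End Tracking.

Section LeftOpen.
Variables (R : realType) (r : R) (B : finType) (S : gGIET r B).
Local Notation GO := (germ_order R).

Lemma top01 b : 0 <= tl S b /\ tr S b <= 1.
Proof. by apply: itvco_sub; [exact: tl_lt_tr|exact: top_sub01]. Qed.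

Lemma ocitv_uniq a b x : tl S a < x <= tr S a -> tl S b < x <= tr S b -> a = b.
Proof.
move=> /andP[ax xa] /andP[bx xb].
have [m [mx ma mb]] : exists m, [/\ m < x, tl S a <= m & tl S b <= m].
  by exists (Num.max (tl S a) (tl S b)); rewrite gt_max ax bx !le_max !lexx orbT.
apply: (@top_disjoint _ _ _ S _ _ I I); exists m; split.
  by rewrite /top /= in_itv /= ma (lt_le_trans mx).
by rewrite /top /= in_itv /= mb (lt_le_trans mx).
Qed.

(** An increasing map onto [[bl, br)] takes values above [br - e], and stays above them to the
    right. *)
Lemma gfun_cvg_left b : gfun S y @[y --> (tr S b)^'-] --> br S b.
Proof.
apply/cvgrPdist_lt => e e0.
have [x x1 [x2 xe]] : exists2 x, tl S b <= x & x < tr S b /\ br S b - e < gfun S x.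
  have lb := bl_lt_br S b; have lt_ := tl_lt_tr S b.
  have [|x] := @ext_surj _ _ _ _ _ _ lt_ (gfun_bij S b) (Num.max (bl S b) (br S b - e / 2)).
    rewrite le_max lexx /= ge_max (ltW lb) /=; lra.
  move=> /andP[lx xr]; rewrite /ext; case: ifPn => [xlt|_] xE.
    exists x => //; split=> //; rewrite xE lt_max; apply/orP; right; lra.
  have : br S b < br S b by rewrite {1}xE gt_max lb /=; lra.
  by rewrite ltxx.
near=> y.
have xy : x < y by near: y; exact: nbhs_left_gt.
have yr : y < tr S b by near: y; exact: nbhs_left_lt.
have yI : tl S b <= y < tr S b by rewrite yr (le_trans x1 (ltW xy)).
have Sxy : gfun S x < gfun S y by apply: (@gfun_mono _ _ _ S b) => //; rewrite x1 x2.
have /andP[_ Syb] := ext_open (gfun_bij S b) yI.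
rewrite ltr_norml; apply/andP; split; lra.
Unshelve. all: by end_near. Qed.

Lemma left_open_mapE b x : tl S b < x <= tr S b -> left_open_map S x = text S b x.
Proof.
move=> bx; rewrite /left_open_map /= /text /ext; case: ifPn.
  move=> /asboolP[a /andP[ax xa]].
  have -> : b = a by apply: ocitv_uniq bx _; rewrite ax ltW.
  by rewrite xa.
move=> /asboolPn nx; have /andP[bx1 bx2] := bx.
case: ifPn => [xb|]; first by case: nx; exists b; rewrite bx1.
rewrite -leNgt => xb; have -> : x = tr S b by apply/le_anti; rewrite bx2 xb.
by apply: cvg_lim => //; exact: gfun_cvg_left.
Qed.

Lemma left_open_tracks (X : kiet GO) (U : set (germ R)) : kclopen GO U ->
  pdom S = rset U ->
  (forall w, ~~ gs w -> U w -> exists2 b, tl S b < gx w <= tr S b &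
    text S b (gx w) = gx (kmap X w)) ->
  tracks X (left_open_map S) false U.
Proof.
move=> [oU cU] SU Xw; split.
- move=> x [b _]; rewrite /= in_itv /= => /andP[bx xb].
  have [t0 t1] := top01 b.
  have [|w [wx sw]] := @germ_exists R x false.
    by rewrite (le_lt_trans t0 bx) (le_trans xb t1).
  exists w; split=> //; apply: contrapT => /cU[a [c [sa sc]]].
  rewrite (germ_itv _ sa sc) sw wx => /andP[ax xc] acU.
  (* If the left germ at [x] were outside the clopen [U], so would be the right germs just below
     [x]; the one at [t] is in the domain. *)
  pose t := Num.max (gx a) (tl S b).
  have tx : t < x by rewrite gt_max ax bx.
  have : pdom S t.
    by exists b => //; rewrite /top /= in_itv /= le_max lexx orbT (lt_le_trans tx xb).
  rewrite SU => -[v [vt sv Uv]]; apply: (acU v _ Uv).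
  by rewrite (germ_itv _ sa sc) sv vt le_max lexx (lt_le_trans tx xc).
- move=> w sw Uw; have [|b bw wE] := Xw w _ Uw; first by rewrite sw.
  split; first by exists b; rewrite //= in_itv.
  by rewrite (left_open_mapE bw) wE.
apply/seteqP; split=> [y [b _]|_ [x [b _] + <-]]; rewrite /= in_itv /=.
  move=> /andP[by_ yb].
  have [|x /andP[bx xb] xy] := ext_surj (tl_lt_tr S b) (gfun_bij S b) (y := y).
    by rewrite (ltW by_).
  have bx' : tl S b < x.
    rewrite lt_neqAle bx andbT; apply: contraTneq by_ => xE.
    rewrite -xy -xE (extl (tl_lt_tr S b) (bl_lt_br S b) (gfun_bij S b) (@gfun_mono _ _ _ S b)).
    by rewrite ltxx.
  have xI : tl S b < x <= tr S b by rewrite bx'.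
  by exists x; [exists b; rewrite //= in_itv|exact: etrans (left_open_mapE xI) xy].
move=> bx; exists b => //; rewrite /= in_itv /=; have := left_open_mapE bx.
rewrite /= => ->.
have /andP[bx1 bx2] := bx.
rewrite -{1}(extl (tl_lt_tr S b) (bl_lt_br S b) (gfun_bij S b) (@gfun_mono _ _ _ S b)).
rewrite (ext_lt (gfun_bij S b) (@gfun_mono _ _ _ S b)) //=.
have bxw : tl S b <= x <= tr S b by rewrite (ltW bx1).
by have /andP[] := ext_img (bl_lt_br S b) (gfun_bij S b) bxw.
Qed.

End LeftOpen.

(** * The decomposition theorem *)

Section Types.
Variables (R : realType) (r : R) (B : finType) (S : gGIET r B).
Variables (X : kiet (germ_order R)) (U L : set (germ R)).
Local Notation GO := (germ_order R).
Implicit Types z w : germ R.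
Hypothesis gU : good X U L.
Hypothesis U0 : U !=set0.
Hypothesis S_tracks : tracks X S true U.

Lemma kopenCU : kopen GO (~` U).
Proof. by case: gU => [[]]. Qed.

Lemma tracked_dom x : pdom S x -> exists z, [/\ gs z, gx z = x & U z].
Proof. by have [/(_ x)] := S_tracks. Qed.

(** The limit set, in the direction in which it stays in [U], of any point of [U]: a nonempty piece
    always carries the dynamics of its label. *)
Lemma closed_invariant_inside : exists C, [/\ closed_invariant X C, C `<=` L & C `<=` U].
Proof.
have [z0 Uz0] := U0; have [_ sU fU bU _] := gU; have [Uz|Uz] := sU z0 Uz0.
  exists (om X z0); split; [exact: closed_invariant_om|exact: fU|].
  by apply: om_sub => //; exact: kopenCU.
exists (om (kswap X) z0); split; [|exact: bU|by apply: om_sub => //; exact: kopenCU].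
by rewrite -{1}(kswapK X); apply: closed_invariant_swap; exact: closed_invariant_om.
Qed.

Lemma regular_om z : gs z -> regular_orbit S (gx z) ->
  om X z `<=` L /\ om (kswap X) z `<=` L.
Proof.
move=> sz /(regular_orbitP S_tracks sz)[Uz U'z]; have [_ _ fU bU _] := gU.
by split; [exact: fU|exact: bU].
Qed.

Lemma periodic_mem z : gs z -> Defs.periodic S (gx z) ->
  L z /\ exists2 p, (0 < p)%N & iter p (kmap X) z = z.
Proof.
move=> sz [rz fz]; have [Uz U'z] := (regular_orbitP S_tracks sz).1 rz.
have [p p0 pz] := finite_orbit_fixed S_tracks sz Uz fz.
split; last by exists p.
have [omL _] := regular_om sz rz; apply: omL => P zP N.
exists (N * p)%N; first by rewrite leq_pmulr.
rewrite (_ : iter _ _ z = z); first exact: nb_self zP.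
by elim: N => // N IH; rewrite mulSn iterD IH.
Qed.

Lemma nontrivially_recurrent_om z : gs z -> nontrivially_recurrent S (gx z) ->
  [/\ forall p, (0 < p)%N -> iter p (kmap X) z <> z,
    exists2 w, gx w = gx z & om X z w &
    exists2 w, gx w = gx z & om (kswap X) z w].
Proof.
move=> sz [rz infz [[omz _] [alz _]]].
have [Uz U'z] := (regular_orbitP S_tracks sz).1 rz.
have z01 : 0 <= gx z < 1 by have := germP z; rewrite sz.
split.
- move=> p p0 pz; apply: infz; rewrite (fixed_full_orbit S_tracks sz p0 pz Uz).
  exact/finite_image/finite_II.
- by apply: limit_om omz => // y /(fwd_orbitP S_tracks y sz)[n _ ->]; exists n.
- by apply: (limit_om _ z01 alz) => y /(bwd_orbitP S_tracks y sz)[n _ ->]; exists n.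
Qed.

(** A periodic right germ is a periodic point. The orbit of a periodic left germ either passes
    through a right endpoint, or stays in the interiors of the intervals, where the right germs at
    the same points are periodic as well. *)
Lemma Zper_periodic_type p : tracks X (left_open_map S) false U ->
  (0 < p)%N -> L = Zper X p ->
  (forall w, ~~ gs w -> U w -> exists2 b, tl S b < gx w <= tr S b &
    text S b (gx w) = gx (kmap X w)) ->
  (forall z, gs z -> U z -> gx (kmap X z) = gfun S (gx z)) ->
  pdom S = rset U -> periodic_type S.
Proof.
move=> LS_tracks p0 LE XL XR SU; split.
  have [C [[[y Cy] _ iC] CL CU]] := closed_invariant_inside.
  have Uy n : U (iter n (kmap X) y) by apply: CU; apply/invariant_iter.
  have [py npy] : Zper X p y by rewrite -LE; exact: CL.
  case sy : (gs y).
    by exists (gx y); constructor 1; exact (fixed_periodic S_tracks sy p0 py Uy).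
  have nsy n : ~~ gs (iter n (kmap X) y) by rewrite gs_iter sy.
  have [[n [b xb]]|nend] := pselect (exists n b, gx (iter n (kmap X) y) = tr S b).
    exists (gx y); constructor 3; split; first exact (fixed_periodic LS_tracks sy p0 py Uy).
    by exists b; rewrite -xb; exact (full_orbit_fwd LS_tracks n sy Uy).
  have inner n : exists w, [/\ gs w, gx w = gx (iter n (kmap X) y), U w &
      gx (kmap X w) = gx (iter n.+1 (kmap X) y)].
    have [b /andP[lx xr] xE] := XL _ (nsy n) (Uy n).
    have xltr : gx (iter n (kmap X) y) < tr S b.
      by rewrite lt_neqAle xr andbT; apply/eqP => xb; apply: nend; exists n, b.
    have : rset U (gx (iter n (kmap X) y)).
      by rewrite -SU; exists b => //; rewrite /top /= in_itv /= (ltW lx).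
    move=> [w [wx sw Uw]]; exists w; split=> //.
    by rewrite XR // wx -xE /text /ext xltr.
  have [w [sw wx Uw _]] := inner 0%N.
  have wn n : gx (iter n (kmap X) w) = gx (iter n (kmap X) y).
    elim: n => // n IH; have [v [sv vx Uv vE]] := inner n.
    rewrite [iter n.+1 _ w]/= -vE; congr (gx (kmap X _)).
    by apply: germ_eq; rewrite ?vx ?gs_iter ?sw ?sv.
  have Uw' n : U (iter n (kmap X) w).
    have [v [sv vx Uv _]] := inner n.
    by rewrite (_ : iter _ _ w = v) //; apply: germ_eq; rewrite ?vx ?gs_iter ?sw ?sv.
  have pw : iter p (kmap X) w = w.
    by apply: germ_eq; rewrite ?gs_iter // wn py wx.
  by exists (gx w); constructor 1; exact (fixed_periodic S_tracks sw p0 pw Uw').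
exists p => x [px|nx].
  have /tracked_dom[z [sz zx _]] : pdom S x by case: px => [[]].
  move: px; rewrite -zx => px; have [Lz _] := periodic_mem sz px.
  apply: (Zper_period S_tracks) => //; first by rewrite -LE.
  by have [Uz _] := (regular_orbitP S_tracks sz).1 px.1.
have /tracked_dom[z [sz zx _]] : pdom S x by case: nx => [[]].
move: nx; rewrite -zx => nx; have [np [w wz omw] [w' wz' alw']] := nontrivially_recurrent_om sz nx.
have [omL alL] : om X z `<=` L /\ om (kswap X) z `<=` L by case: nx => rz _ _; exact: regular_om.
(* The right germ at this point is [z], which is not periodic. So both limit sets of [z] contain the
   left germ, and [periodic_om_al] puts [z] on its orbit, which is made of left germs. *)
have left_side v : gx v = gx z -> L v -> gs v = false.
  move=> vz; rewrite LE => -[pv _]; apply/negP => sv; apply: (np p p0).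
  by rewrite (_ : z = v) //; apply: germ_eq; rewrite ?sv ?sz.
have sw := left_side w wz (omL _ omw); have sw' := left_side w' wz' (alL _ alw').
have ww' : w' = w by apply: germ_eq; rewrite ?wz ?wz' ?sw ?sw'.
rewrite ww' in alw'.
have [j zw] : exists j, z = iter j (kmap X) w.
  by apply: (periodic_om_al p0 _ omw alw'); rewrite -LE; exact: omL.
by have := gs_iter X j w; rewrite -zw sz sw.
Qed.

(** By the last clause of [good] the orbit of [z] stays adjacent to that of [gadj z], so the two
    have the same projection although [z] is not in [L]. [Y] is either [X] or its reversal. *)
Lemma shadow (Y : kiet GO) z : infmin Y L -> good Y U L -> (forall n, U (iter n (kmap Y) z)) ->
  ~ L z -> gs z -> z != gmin R -> L (gadj z) -> forall n,
  exists2 m, L m & gx m = gx (iter n (kmap Y) z).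
Proof.
move=> iL [_ _ _ _ tight] Uz nLz sz z0 Laz n.
have invL : invariant Y L by case: iL => [[[]]].
pose v := iter n (kmap Y) z.
suff [vm Lv] : v != gmin R /\ L (gadj v).
  exists (gadj v) => //; have sv : gs v by rewrite gs_iter.
  by have [] := gadjP vm (gs_gmax_neq sv).
rewrite /v; elim: n {v} => //= n [vm Lv]; set v := iter n (kmap Y) z in vm Lv *.
have sv : gs v by rewrite gs_iter.
have nLv : ~ L v by rewrite /v invariant_iter.
have [aE _] := tight iL v (Uz n) nLv sv vm Lv.
have {}aE : kmap Y (gadj v) = gadj (kmap Y v) by [].
have [ax as_] := gadjP vm (gs_gmax_neq sv).
split; last by rewrite -aE; apply/invL.
(* If the image were [gmin], the default value of [gadj] would be the right germ [gmin], whereas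
   [kmap] sends the left germ [gadj v] to a left germ. *)
apply/eqP => kv.
have : gs (kmap Y (gadj v)) = gs (gadj v) by exact: (kmap_plus Y).
rewrite aE kv as_ sv /gadj /gs val_insubd.
by rewrite in_germsE /= ltxx.
Qed.

(** Uniqueness holds because the closure of every non-trivially recurrent orbit is the projection of
    [L]: the orbit projects into it, this projection is closed in [0, 1), and the limit set of the
    germ is all of [L] by minimality. *)
Lemma infmin_quasiminimal_type : infmin X L -> pdom S = rset U -> quasiminimal_type S.
Proof.
move=> iL SU; have [[[L0 cL invL] mL] npL] := iL.
have omE z : om X z `<=` L -> om X z = L by apply: mL; exact: closed_invariant_om.
have LU : L `<=` U.
  by have [C [ciC CL CU]] := closed_invariant_inside; rewrite -(mL C).
have orbit_closure z : gs z -> nontrivially_recurrent S (gx z) ->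
    closure (full_orbit S (gx z)) `&` pdom S = (@gx R @` L) `&` pdom S.
  move=> sz nz; have [np [w wz omw] _] := nontrivially_recurrent_om sz nz.
  have [rz _ _] := nz; have [omL alL] := regular_om sz rz.
  have [Uz U'z] := (regular_orbitP S_tracks sz).1 rz.
  have near_L y : full_orbit S (gx z) y -> exists2 m, L m & gx m = y.
    move=> /(full_orbit_germ S_tracks sz)[n yE].
    have [Lz|nLz] := pselect (L z).
      case: yE => ->; first by exists (iter n (kmap X) z) => //; apply/invariant_iter.
      exists (iter n (kinv X) z) => //.
      by apply/(invariant_iter (X := kswap X)) => //; exact: invariant_swap.
    have wL : L w by exact: omL.
    have sw : gs w = false.
      apply/negP => sw; apply: nLz; rewrite (_ : z = w) //.
      by apply: germ_eq; rewrite ?wz ?sw.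
    have z0 : z != gmin R.
      have := germP w; rewrite sw wz => /andP[+ _].
      by apply: contraTneq => ->; rewrite ltxx.
    have Laz : L (gadj z).
      have [ax as_] := gadjP z0 (gs_gmax_neq sz).
      by rewrite (_ : gadj z = w) //; apply: germ_eq; rewrite ?ax ?as_ ?wz ?sw ?sz.
    case: yE => ->; first exact: (shadow iL gU Uz nLz sz z0 Laz).
    exact: (shadow (infmin_swap iL) (good_swap gU) U'z nLz sz z0 Laz).
  apply/seteqP; split=> y [cy Sy]; split=> //.
    have y01 : 0 <= y < 1 by move: Sy; rewrite SU => /rset01.
    apply: contrapT => nLy.
    have nbL v : gx v = y -> nb GO v (~` L).
      by move=> vy; apply: cL => Lv; apply: nLy; exists v.
    have [t [/near_L[m Lm mt] /(_ m mt)[]//]] :=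
      cy _ (nb_nbhs y01 (fun v vy _ => nbL v vy) (fun v vy _ => nbL v vy)).
  case: cy => m Lm <- V /nb_near mV.
  have := Lm; rewrite -(omE z omL) => /(_ _ mV 0%N)[n _ Vn].
  by exists (gx (iter n (kmap X) z)); split=> //; exact (full_orbit_fwd S_tracks n sz Uz).
have rec_nontrivial x : recurrent S x -> nontrivially_recurrent S x.
  case=> // px; have /tracked_dom[z [sz zx _]] : pdom S x by case: px => [[]].
  move: px; rewrite -zx => px; have [Lz [p p0 pz]] := periodic_mem sz px.
  by case: (npL z p Lz p0).
split=> //.
have [z Lz sz] := infmin_plus iL.
have iL' := infmin_swap iL.
have invL' : invariant (kswap X) L by exact: invariant_swap.
have Uz n : U (iter n (kmap X) z) by apply: LU; apply/invariant_iter.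
have U'z n : U (iter n (kinv X) z) by apply: LU; apply/(invariant_iter (X := kswap X)).
have rz : regular_orbit S (gx z) by apply/(regular_orbitP S_tracks).
have omz : om X z z by rewrite (infmin_om iL Lz).
have alz : om (kswap X) z z by rewrite (infmin_om iL' Lz).
have np p : (0 < p)%N -> iter p (kmap X) z <> z by exact: npL.
have np' p : (0 < p)%N -> iter p (kinv X) z <> z.
  by case: iL' => _ npL' p0; exact: npL'.
have nz : nontrivially_recurrent S (gx z).
  split=> //.
    by move=> /(finite_orbit_fixed S_tracks sz Uz)[p p0]; exact: np.
  split; split; try by case: rz.
    apply: (om_limit omz np) => n; apply/(fwd_orbitP S_tracks) => //.
    by exists n.
  apply: (om_limit alz np') => n; apply/(bwd_orbitP S_tracks) => //.
  by exists n => // m _; exact: (U'z m.+1).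
exists (closure (full_orbit S (gx z)) `&` pdom S); split; first by exists (gx z).
move=> Q [x nx ->]; have /tracked_dom[w [sw wx _]] : pdom S x by case: nx => [[]].
by rewrite -wx in nx *; rewrite !orbit_closure.
Qed.

End Types.

Section Main.
Variables (R : realType) (r : R) (A : finType) (T : gGIET r A).
Hypothesis T_GIET : is_GIET T.
Variable X : kiet (germ_order R).
Hypothesis XR : forall z, gs z -> gx (kmap X z) = gfun T (gx z).
Hypothesis XL : forall z, ~~ gs z -> exists2 a, tl T a < gx z <= tr T a &
  gx (kmap X z) = text T a (gx z).
Local Notation GO := (germ_order R).

Lemma restriction_tracks (U : set (germ R)) : kclopen GO U ->
  exists (B : finType) (S : gGIET r B),
    [/\ is_restriction T (rset U) S /\ pdom S = rset U, tracks X S true U,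
      tracks X (left_open_map S) false U,
      forall w, ~~ gs w -> U w -> exists2 b, tl S b < gx w <= tr S b &
        text S b (gx w) = gx (kmap X w) &
      forall z, gs z -> U z -> gx (kmap X z) = gfun S (gx z)].
Proof.
move=> cU; have [oU _] := cU.
have JT : rset U `<=` pdom T.
  by case: T_GIET => -> _ x /rset01 x01; rewrite /= in_itv.
have [B [S [resS ST SU SV Sleft]]] := restriction_exists JT (rset_finite_union cU).
have left_end w : ~~ gs w -> U w -> exists2 b, tl S b < gx w <= tr S b &
    text S b (gx w) = gx (kmap X w).
  move=> sw Uw; have [a aw aE] := XL sw.
  have [a0 [b0 [sa sb + abU]]] := oU w Uw; rewrite (germ_itv _ sa sb) (negbTE sw) => /andP[a0w wb0].
  have [|b bw bE] := Sleft a (gx w) aw.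
    exists (gx a0) => // t; rewrite /= in_itv /= => /andP[a0t tw].
    have [|v [vt sv]] := @germ_exists R t true.
      have /andP[a00 _] := gx01 a0; have /andP[_ w1] := gx01 w.
      by rewrite (le_trans a00 a0t) (lt_le_trans tw w1).
    by exists v; split=> //; apply: abU; rewrite (germ_itv _ sa sb) sv vt a0t (lt_le_trans tw).
  by exists b => //; rewrite bE aE.
exists B, S; split=> //; last 2 first.
- exact: left_open_tracks cU SU left_end.
- by move=> z sz _; rewrite ST XR.
split.
- by move=> x; rewrite SU => -[z [zx sz Uz]]; exists z.
- by move=> z sz Uz; rewrite SU /= ST XR //; split=> //; exists z.
- by rewrite SU /= ST -SV.
Qed.

Lemma kclopen_seq (s : seq (set (germ R) * set (germ R))) :
  (forall p, p \in s -> kclopen GO p.1) ->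
  kclopen GO [set z | exists2 p, p \in s & p.1 z].
Proof.
move=> cs; split=> [z [p ps pz]|z nz].
  have [op _] := cs p ps; apply: nbW (op z pz) => w pw; by exists p.
apply: (@nbW _ _ GO _ (fun w => forall p, p \in s -> ~ p.1 w)).
  by move=> w nw [p ps pw]; exact: nw pw.
apply: nb_seq => p ps; have [_ cp] := cs p ps; apply: cp => pz.
by apply: nz; exists p.
Qed.

Lemma good_restriction (U L : set (germ R)) : label X L -> good X U L -> U !=set0 ->
  exists (B : finType) (S : gGIET r B), [/\ is_restriction T (rset U) S,
    forall x, rset U x -> ~ transient S x &
    (periodic_type S /\ ~ quasiminimal_type S) \/
    (quasiminimal_type S /\ ~ periodic_type S)].
Proof.
move=> lL gU U0; have [cU sU _ _ _] := gU.
have [B [S [[resS SU] S_tracks LS_tracks SL SR]]] := restriction_tracks cU.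
(* A quasiminimal comes from an infinite recurrent orbit, which a periodic domain would make
   finite. *)
have excl : periodic_type S -> quasiminimal_type S -> False.
  move=> [_ [p pP]] [[Q [[x nx _] _]] _].
  have [[_ fx] _] := pP x (or_intror nx).
  by case: nx => _ /(_ fx).
exists B, S; split=> //.
  move=> x [z [<- sz Uz]] /(transient_exits S_tracks sz)[[n nU] [n' nU']].
  by have [/(_ n)|/(_ n')] := sU z Uz.
case: lL => [[p p0 LE]|iL]; [left|right].
  have pS := Zper_periodic_type gU U0 S_tracks LS_tracks p0 LE SL SR SU.
  by split=> // /(excl pS).
have qS := infmin_quasiminimal_type gU U0 S_tracks iL SU.
by split=> // /excl/(_ qS).
Qed.

End Main.

Theorem theorem1p1 (R : realType) (r : R) (r_ge1 : 1 <= r)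
    (A : finType) (T : gGIET r A) (T_GIET : is_GIET T) :
  exists (D : set R) (k : nat) (Rs : 'I_k -> set R),
    [/\ finite_right_open_union D,
        forall i, finite_right_open_union (Rs i),
        `[0, 1[%classic = D `|` \bigcup_i Rs i,
        forall i, D `&` Rs i = set0 &
        trivIset setT Rs] /\
    [/\ domain_of_transition T D,
        forall i, domain_of_recurrence T (Rs i) &
        forall i, exists (B : finType) (S : gGIET r B),
          is_restriction T (Rs i) S /\
          ((periodic_type S /\ ~ quasiminimal_type S) \/
           (quasiminimal_type S /\ ~ periodic_type S))].
Proof.
have [X [XR XL]] := giet_lift T_GIET.
have [s [sP sd sfwd sbwd]] := recurrence_decomposition X.
pose V := [set z : germ R | exists2 p, p \in s & p.1 z].
have cs p : p \in s -> kclopen (germ_order R) p.1 by move=> /sP[_ []].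
have cV : kclopen (germ_order R) (~` V) by exact/kclopenC/kclopen_seq.
pose p0 := (set0, set0) : set (germ R) * set (germ R).
have ps (i : 'I_(size s)) : nth p0 s i \in s by rewrite mem_nth.
exists (rset (~` V)), (size s), (fun i => rset (nth p0 s i).1); split; split.
- exact: rset_finite_union.
- by move=> i; apply: rset_finite_union; exact: cs.
- apply/seteqP; split=> [x|x [/rset01|[i _ /rset01]]]; rewrite /= in_itv //= => x01.
  have [z [<- sz]] := @germ_exists R x true x01.
  have [[p /(nthP p0)[i si <-] pz]|nVz] := pselect (V z); [right|left].
    by exists (Ordinal si) => //=; exists z.
  by exists z.
- move=> i; apply/seteqP; split=> // x [[z [zx sz nVz]] [w [wx sw pw]]].
  apply: nVz; exists (nth p0 s i) => //.
  by rewrite (_ : z = w) //; apply: germ_eq; rewrite ?sz ?zx.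
- move=> i j _ _ [x [[z [zx sz pz]] [w [wx sw pw]]]].
  have zw : z = w by apply: germ_eq; rewrite ?sz ?zx.
  rewrite -zw in pw; apply: val_inj => /=; have [ij|ij|//] := ltngtP i j.
    have /(pairwiseP p0)/(_ i j (ltn_ord i) (ltn_ord j) ij)/eqP/seteqP[/(_ z)] := sd.
    by move=> /(_ (conj pz pw)).
  have /(pairwiseP p0)/(_ j i (ltn_ord j) (ltn_ord i) ij)/eqP/seteqP[/(_ z)] := sd.
  by move=> /(_ (conj pw pz)).
(* Every future and every past enters [V], so a point of the complement leaves it on both sides. *)
- have [B [S [[resS SU] S_tracks _ _ _]]] := restriction_tracks T_GIET XR XL cV.
  exists B, S; split=> // x [z [<- sz Vz]]; apply: (exits_transient S_tracks) => //.
    by have [n Vn] := sfwd z; exists n => /(_ Vn).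
  by have [n Vn] := sbwd z; exists n => /(_ Vn).
- move=> i; have [lL gU U0] := sP _ (ps i).
  have [B [S [resS nS _]]] := good_restriction T_GIET XR XL lL gU U0.
  by exists B, S.
- move=> i; have [lL gU U0] := sP _ (ps i).
  have [B [S [resS _ tS]]] := good_restriction T_GIET XR XL lL gU U0.
  by exists B, S.
Qed.
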